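(* Let $V$ be the vertex algebra (over the integers) of the double cover of an even lattice $L$, and let $D^*V$ be the sum of the spaces $D^{(i)}V$ for $i\ge1$, so that $V/D^*V$ is a Lie algebra (with bracket $[u,v]=u_0v$) acting on $V$ by $u\mapsto u_0$. Suppose that $\alpha,\gamma\in L$ with $\gamma$ of norm $0$ and $\alpha$ orthogonal to $\gamma$. Then $$\exp\Big(\sum_{i>0}\frac{x^i}{i}(\alpha(1)e^{i\gamma})_0\Big)$$ is a lifting of $(\alpha(1)e^\gamma)_0$ in the universal enveloping algebra of $(V/D^*V)\otimes\mathbb Q$ all of whose coefficients (of powers of $x$) map $V$ to $V$.
   Context: Vertex algebra of an even lattice $L$. The double cover $\hat L$ is a central extension of $L$ by $\{\pm1\}$, in which a lift of $\alpha\in L$ is written $e^\alpha$ (determined up to sign), with $e^\alpha e^\beta=(-1)^{(\alpha,\beta)}e^\beta e^\alpha$. Let $V\otimes\mathbb Q$ be the ring $\mathbb Q\{\hat L\}\otimes S(\bigoplus_{j>0}L(j)\otimes\mathbb Q)$, where $\mathbb Q\{\hat L\}$ is the group ring of $\hat L$ with the central element $-1$ identified with the scalar $-1$, $L(j)$ is a copy of $L$ with elements written $\alpha(j)$, and $S$ is the symmetric algebra. It has the derivation $D$ with $D\alpha(j)=j\alpha(j+1)$, $De^\alpha=\alpha(1)e^\alpha$; put $D^{(i)}=D^i/i!$. $V$ is the smallest subring containing all $e^\alpha$ and closed under all $D^{(i)}$. For $j>0$ let $\alpha(j)$ also denote the operator of multiplication by $\alpha(j)$, let $\alpha(-j)$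 be the derivation with $\alpha(-j)\beta(k)=j(\alpha,\beta)\delta_{jk}$, $\alpha(-j)e^\beta=0$, and let $\alpha(0)$ act on the $L$-degree $\beta$ piece as $(\alpha,\beta)$ (where $e^\beta$ has degree $\beta$ and the $\alpha(j)$ have degree $0$). The vertex algebra structure is the usual one, with $u(z)=\sum_nu_nz^{-n-1}$, $\alpha(1)(z)=\sum_j\alpha(j)z^{j-1}$, and $e^\alpha(z)=e^\alpha z^{\alpha(0)}\exp(\sum_{j>0}\alpha(j)z^j/j)\exp(-\sum_{j>0}\alpha(-j)z^{-j}/j)$; all operators $u_n$ with $u\in V$ map $V$ to $V$. Fix a lift $e^\gamma\in\hat L$ of $\gamma$ and put $e^{i\gamma}=(e^\gamma)^i$. The operator $u_0$ for $u\in V$ depends only on the class of $u$ in $V/D^*V$, and $(u)_0$ is also used to denote this class as an element of the Lie algebra $V/D^*V$. In a Hopf algebra $H$, a lifting of $a_1\in H$ is a group-like element $\sum_{n\ge0}a_nx^n\in H[[x]]$ with $a_0=1$ and the given $a_1$, where group-like means $\Delta(a_n)=\sum_{0\le m\le n}a_m\otimes a_{n-m}$ for all $n$. *)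

(* Defs.v *)
From HB Require Import structures.
From mathcomp Require Import all_boot all_order all_algebra.
From mathcomp Require Import finmap.
From mathcomp.multinomials Require Import monalg.
From mathcomp Require Import boolp classical_sets cardinality fsbigop.

Set Implicit Arguments.
Unset Strict Implicit.
Unset Printing Implicit Defensive.

Import Order.TTheory GRing.Theory Num.Theory.
Local Open Scope ring_scope.

(* A lattice with a chosen basis: L = Z^n, the form given by a Gram matrix.
   The form may be degenerate or indefinite. *)
Definition gramform n (G : 'M[int]_n) (a b : 'rV[int]_n) : int :=
  (a *m G *m b^T) 0 0.

Record evenLattice := EvenLattice {
  rk : nat;
  gram : 'M[int]_rk;
  gram_sym : forall a b, gramform gram a b = gramform gram b a;
  gram_even : forall a, (2 %| gramform gram a a)%Z }.

Definition vec (L : evenLattice) := 'rV[int]_(rk L).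
Definition ip (L : evenLattice) (a b : vec L) : int := gramform (gram L) a b.
Definition basis (L : evenLattice) (k : 'I_(rk L)) : vec L := 'e_k.

(* A central extension of L by {+-1} with a chosen section a |-> e_a is the
   set bool * L of pairs (s, a), standing for (-1)^s e_a, with
   e_a e_b = (-1)^(cocyc a b) e_(a+b).  The first three fields say that this
   is a group with unit e_0; the last is e_a e_b = (-1)^(a,b) e_b e_a. *)
Record doubleCover (L : evenLattice) := DoubleCover {
  cocyc : vec L -> vec L -> bool;
  cocycA : forall a b c,
    cocyc a b (+) cocyc (a + b) c = cocyc b c (+) cocyc a (b + c);
  cocyc0l : forall a, cocyc 0 a = false;
  cocyc0r : forall a, cocyc a 0 = false;
  cocyc_comm : forall a b, cocyc a b (+) cocyc b a = odd `|ip a b|%N }.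

Section LinearExtension.
Variables (K : choiceType) (W : lmodType rat).
Implicit Types (f : K -> W) (u : {malg rat[K]}).

Definition lext f u : W := \sum_(k <- msupp u) u@_k *: f k.

Lemma lextEw f u (d : {fset K}) : (msupp u `<=` d)%fset ->
  lext f u = \sum_(k <- d) u@_k *: f k.
Proof.
move=> le; rewrite /lext; apply: big_fset_incl => // k _ /mcoeff_outdom ->.
by rewrite scale0r.
Qed.

Lemma lext_is_linear f : linear (lext f).
Proof.
move=> a u v; pose d := (msupp u `|` msupp v)%fset.
rewrite (@lextEw _ (a *: u + v) d); last first.
  apply: fsubset_trans (msuppD_le _ _) _.
  by apply: fsetSU; exact: msuppZ_le.
rewrite (@lextEw _ u d) ?fsubsetUl// (@lextEw _ v d) ?fsubsetUr//.
rewrite scaler_sumr -big_split; apply: eq_bigr => k _ /=.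
by rewrite mcoeffD mcoeffZ scalerDl scalerA.
Qed.

HB.instance Definition _ f :=
  GRing.isLinear.Build rat {malg rat[K]} W _ (lext f) (lext_is_linear f).

Lemma lextU f k : lext f << k >> = f k.
Proof.
rewrite (@lextEw _ _ [fset k]%fset) ?msuppU_le//.
by rewrite big_seq_fset1 mcoeffUU scale1r.
Qed.

Lemma lext_eq f g u : f =1 g -> lext f u = lext g u.
Proof. by move=> fg; apply: eq_bigr => k _; rewrite fg. Qed.

Lemma malg_lin_ext (f g : {linear {malg rat[K]} -> W}) :
  (forall k, f << k >> = g << k >>) -> f =1 g.
Proof.
move=> fg u; rewrite (monalgE u) !linear_sum; apply: eq_bigr => k _.
have -> : << u@_k *g k >> = u@_k *: << k >> :> {malg rat[K]}.
  by apply/malgP => k'; rewrite mcoeffZ !mcoeffU mulrnAr mulr1.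
by rewrite !linearZ fg.
Qed.

End LinearExtension.

Section LatticeRing.
Variable L : evenLattice.

(* The variable (j, k) stands for b_k(j+1), where (b_k) is the basis of L. *)
Definition var : choiceType := (nat * 'I_(rk L))%type.

(* The pair (b, m) stands for the basis element e_b m of V (x) Q, for m a
   monomial in the variables. *)
Definition bas : choiceType := ('rV[int]_(rk L) * {cmonom var})%type.

Definition VQ (C : doubleCover L) : Type := {malg rat[bas]}.

Variable C : doubleCover L.
HB.instance Definition _ := GRing.Lmodule.on (VQ C).

Definition vb (x : bas) : VQ C := << x >>.

Definition lin (W : lmodType rat) (f : bas -> W) : VQ C -> W := lext f.
HB.instance Definition _ (W : lmodType rat) (f : bas -> W) :=
  GRing.Linear.on (lin f).

Lemma linE (W : lmodType rat) (f : bas -> W) x : lin f (vb x) = f x.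
Proof. exact: lextU. Qed.

Lemma VQ_ext (W : lmodType rat) (f g : VQ C -> W) :
  linear f -> linear g -> (forall x, f (vb x) = g (vb x)) -> f =1 g.
Proof.
move=> lf lg fg.
pose F : {linear VQ C -> W} := HB.pack f (GRing.isLinear.Build rat _ _ _ f lf).
pose G : {linear VQ C -> W} := HB.pack g (GRing.isLinear.Build rat _ _ _ g lg).
exact: (@malg_lin_ext _ _ F G).
Qed.

Definition sgn (s : bool) : rat := (-1) ^+ s.

Definition mulb (x y : bas) : VQ C :=
  sgn (cocyc C x.1 y.1) *: vb (x.1 + y.1, mulcm x.2 y.2).
Definition mulV (u v : VQ C) : VQ C := lin (fun x => lin (mulb x) v) u.
Definition oneV : VQ C := vb (0, onecm var).

Lemma mulVl u : linear (mulV u).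
Proof.
move=> a v w; rewrite /mulV /lin /lext scaler_sumr -big_split /=.
apply: eq_bigr => x _; rewrite -!/(lext _ _) -!/(lin _ _) linearP.
by rewrite scalerDr !scalerA mulrC.
Qed.

Lemma mulVr v : linear (mulV^~ v).
Proof. by move=> a u w; rewrite /mulV linearP. Qed.

Lemma mulVbb x y : mulV (vb x) (vb y) = mulb x y.
Proof. by rewrite /mulV !linE. Qed.

Lemma mulVZl a u v : mulV (a *: u) v = a *: mulV u v.
Proof. by rewrite /mulV linearZ. Qed.
Lemma mulVZr a u v : mulV u (a *: v) = a *: mulV u v.
Proof.
have u0 : mulV u 0 = 0.
  by have := mulVl u (-1) 0 0; rewrite scaler0 addr0 scaleN1r addNr.
by rewrite -[a *: v]addr0 mulVl u0 addr0.
Qed.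

Lemma mulVA : associative mulV.
Proof.
move=> u v w; move: u; apply: VQ_ext.
- by move=> a u u'; rewrite mulVr.
- by move=> a u u'; rewrite !mulVr.
move=> x; move: v; apply: VQ_ext.
- by move=> a u u'; rewrite mulVr mulVl.
- by move=> a u u'; rewrite mulVl mulVr.
move=> y; move: w; apply: VQ_ext.
- by move=> a u u'; rewrite !mulVl.
- by move=> a u u'; rewrite mulVl.
move=> z; rewrite !mulVbb /mulb mulVZl mulVZr !mulVbb /mulb /= !scalerA.
rewrite addrA mulcmA /sgn -!signr_addb; congr (_ *: _).
by rewrite -cocycA.
Qed.

Lemma mul1V : left_id oneV mulV.
Proof.
apply: VQ_ext => [a u v|//|x]; first by rewrite mulVl.
by rewrite mulVbb /mulb cocyc0l scale1r add0r mul0cm; case: x.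
Qed.

Lemma mulV1 : right_id oneV mulV.
Proof.
apply: VQ_ext => [a u v|//|x]; first by rewrite mulVr.
by rewrite mulVbb /mulb cocyc0r scale1r addr0 mulcm0; case: x.
Qed.

Lemma mulVDl : left_distributive mulV +%R.
Proof. by move=> u v w; have := mulVr w 1 u v; rewrite !scale1r. Qed.

Lemma mulVDr : right_distributive mulV +%R.
Proof. by move=> u v w; have := mulVl u 1 v w; rewrite !scale1r. Qed.

Lemma oneV_neq0 : oneV != 0.
Proof. by rewrite /oneV /vb monalgU_eq0 oner_eq0. Qed.

HB.instance Definition _ := GRing.Zmodule_isNzRing.Build (VQ C)
  mulVA mul1V mulV1 mulVDl mulVDr oneV_neq0.
HB.instance Definition _ := GRing.Lmodule_isLalgebra.Build rat (VQ C)
  (fun a u v => esym (mulVZl a u v)).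
HB.instance Definition _ := GRing.Lalgebra_isAlgebra.Build rat (VQ C)
  (fun a u v => esym (mulVZr a u v)).

Lemma VQ_mulbb x y : vb x * vb y = mulb x y :> VQ C.
Proof. exact: mulVbb. Qed.

(* elt s a is the image in Q{\hat L} of the element (-1)^s e_a of \hat L;
   elt false a and elt true a are the two lifts of a. *)
Definition elt (s : bool) (a : vec L) : VQ C := sgn s *: vb (a, onecm var).

Lemma eltM s t a b :
  elt s a * elt t b = elt (s (+) t (+) cocyc C a b) (a + b).
Proof.
rewrite /elt -scalerAl -scalerAr VQ_mulbb /mulb /= !scalerA mulcm0.
by rewrite /sgn !signr_addb.
Qed.

(* pos a j is the element a(j+1) of the symmetric algebra. *)
Definition pos (a : vec L) (j : nat) : VQ C :=
  \sum_k (a 0 k)%:~R *: vb (0, ucm ((j, k) : var)).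

(* The derivation d of V (x) Q with d e_b = de b * e_b and
   d (b_k(j+1)) = dx (j, k), for de b and dx i central. *)
Definition der (de : vec L -> VQ C) (dx : var -> VQ C) : VQ C -> VQ C :=
  lin (fun x => de x.1 * vb x + \sum_(i <- finsupp x.2)
                  (x.2 i)%:R *: (dx i * vb (x.1, divcm x.2 (ucm i)))).

Definition D : VQ C -> VQ C :=
  der (fun b => pos b 0)
      (fun i => (i.1.+1)%:R *: pos (basis i.2) i.1.+1).

Definition Ddiv (i : nat) (u : VQ C) : VQ C := (i`!)%:R^-1 *: iter i D u.

(* The operator a(-(j+1)). *)
Definition neg (a : vec L) (j : nat) : VQ C -> VQ C :=
  der (fun=> 0)
      (fun i => ((j.+1)%:R * (ip a (basis i.2))%:~R *+ (i.1 == j))%:A).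

(* The operator a(j) for any integer j. *)
Definition mode (a : vec L) (j : int) : VQ C -> VQ C :=
  match j with
  | Posz 0 => lin (fun x => (ip a x.1)%:~R *: vb x)
  | Posz j'.+1 => fun v => pos a j' * v
  | Negz j' => neg a j'
  end.

(* The integral form V. *)
Inductive inV : VQ C -> Prop :=
  | inV1 : inV 1
  | inVB u v : inV u -> inV v -> inV (u - v)
  | inVM u v : inV u -> inV v -> inV (u * v)
  | inV_elt s a : inV (elt s a)
  | inV_Ddiv i u : inV u -> inV (Ddiv i u).

Inductive inDV : VQ C -> Prop :=
  | inDV0 : inDV 0
  | inDVD i u w : (0 < i)%N -> inV u -> inDV w -> inDV (Ddiv i u + w).

(* A field is a doubly infinite series in z of operators on V (x) Q: f N is
   the coefficient of z^N. *)
Definition field := int -> VQ C -> VQ C.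

(* Composite of two fields; in all uses below only finitely many terms of the
   sum are nonzero on any given v. *)
Definition fcomp (f g : field) : field :=
  fun N v => \sum_(i \in [set: int]) f (N - i) (g i v).

(* The divided derivative (d/dz)^j / j!. *)
Definition fderiv (j : nat) (f : field) : field :=
  fun N v => ((j`!)%:R^-1 * \prod_(1 <= i < j.+1) (N + i%:Z)%:~R)
             *: f (N + j%:Z) v.

(* The parts sum_(j > 0) a(j) z^(j-1) and sum_(j <= 0) a(j) z^(j-1) of
   a(1)(z). *)
Definition creat (a : vec L) : field :=
  fun N v => if 0 <= N then mode a (N + 1) v else 0.
Definition annih (a : vec L) : field :=
  fun N v => if N < 0 then mode a (N + 1) v else 0.

(* The coefficient of t^q in exp (sum_(i > 0) c_i t^i), and its powers, for
   operators c_i. *)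
Fixpoint oppow (c : nat -> VQ C -> VQ C) (k q : nat) (v : VQ C) : VQ C :=
  if k is k'.+1 then \sum_(1 <= i < q.+1) c i (oppow c k' (q - i) v)
  else if q == 0%N then v else 0.
Definition opexp (c : nat -> VQ C -> VQ C) (q : nat) (v : VQ C) : VQ C :=
  \sum_(k < q.+1) (k`!)%:R^-1 *: oppow c k q v.

Definition expcreat (a : vec L) : field := fun N v =>
  if 0 <= N then opexp (fun j w => j%:R^-1 *: mode a j%:Z w) `|N|%N v else 0.
Definition expannih (a : vec L) : field := fun N v =>
  if N <= 0 then opexp (fun j w => - (j%:R^-1 *: mode a (- j%:Z) w)) `|N|%N v
  else 0.

(* z^(a(0)). *)
Definition zpow (a : vec L) : field :=
  fun N => lin (fun x => if ip a x.1 == N then vb x else 0).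

(* e^a(z), for the lift e_a of a. *)
Definition Yexp (a : vec L) : field := fun N v =>
  elt false a * fcomp (zpow a) (fcomp (expcreat a) (expannih a)) N v.

(* The field of b_k(j+1) u, given the field f of u: as b_k(j+1) is
   D^(j) b_k(1), this is the normally ordered product of
   (d/dz)^j / j! b_k(1)(z) with f. *)
Definition normord (i : var) (f : field) : field := fun N v =>
  fcomp (fderiv i.1 (creat (basis i.2))) f N v
  + fcomp f (fderiv i.1 (annih (basis i.2))) N v.

Definition factors (m : {cmonom var}) : seq var :=
  flatten [seq nseq (m i) i | i <- finsupp m].

Definition Y (u : VQ C) : field := fun N v =>
  lin (fun x => foldr normord (Yexp x.1) (factors x.2) N v) u.

(* u_n v, with u(z) = sum_n u_n z^(-n-1). *)
Definition nprod (u : VQ C) (n : int) (v : VQ C) : VQ C := Y u (- n - 1) v.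


(* The linear maps f below are the linear maps out of
   (V / D^*V) (x) Q = (V (x) Q) / (D^*V (x) Q); the second condition says that
   f takes the bracket [u, v] = u_0 v to the commutator. *)
Record lie_map (A : algType rat) (f : {linear VQ C -> A}) : Prop := LieMap {
  lie_mapD : forall u, inDV u -> f u = 0;
  lie_mapB : forall u v, f (nprod u 0 v) = f u * f v - f v * f u }.

(* U is the universal enveloping algebra of (V / D^*V) (x) Q, with iota u the
   image of the class (u)_0. *)
Record enveloping (U : algType rat) (iota : {linear VQ C -> U}) : Prop :=
  Enveloping {
    env_lie : lie_map iota;
    env_ex : forall (A : algType rat) (f : {linear VQ C -> A}), lie_map f ->
      exists g : {lrmorphism U -> A}, forall u, g (iota u) = f u;
    env_uniq : forall (A : algType rat) (g h : {lrmorphism U -> A}),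
      (forall u, g (iota u) = h (iota u)) -> g =1 h }.

(* A U-module structure on V (x) Q extending the action u |-> u_0. *)
Record zero_action (U : algType rat) (iota : {linear VQ C -> U})
    (act : U -> VQ C -> VQ C) : Prop := ZeroAction {
  act_linl : forall v, linear (act^~ v);
  act_linr : forall a, linear (act a);
  act1 : forall v, act 1 v = v;
  actM : forall a b v, act (a * b) v = act a (act b v);
  act_iota : forall u v, act (iota u) v = nprod u 0 v }.

End LatticeRing.

Section Bialgebra.
Variables H T : algType rat.

(* T is the algebra H (x) H, with tens a b = a (x) b. *)
Record tensor_square (tens : H -> H -> T) : Prop := TensorSquare {
  tens_linl : forall b, linear (tens^~ b);
  tens_linr : forall a, linear (tens a);
  tens_ex : forall (W : lmodType rat) (f : H -> H -> W),
    (forall b, linear (f^~ b)) -> (forall a, linear (f a)) ->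
    exists g : {linear T -> W}, forall a b, g (tens a b) = f a b;
  tens_uniq : forall (W : lmodType rat) (g h : {linear T -> W}),
    (forall a b, g (tens a b) = h (tens a b)) -> g =1 h;
  tens1 : tens 1 1 = 1;
  tensM : forall a b a' b', tens a b * tens a' b' = tens (a * a') (b * b') }.

Definition lifting (tens : H -> H -> T) (Delta : H -> T)
    (a1 : H) (a : nat -> H) : Prop :=
  [/\ a 0%N = 1, a 1%N = a1 &
      forall n, Delta (a n) = \sum_(m < n.+1) tens (a m) (a (n - m)%N)].

(* The coefficient of x^q in exp (sum_(i > 0) c_i x^i), and its powers. *)
Fixpoint serpow (c : nat -> H) (k q : nat) : H :=
  if k is k'.+1 then \sum_(1 <= i < q.+1) c i * serpow c k' (q - i)
  else (q == 0%N)%:R.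
Definition serexp (c : nat -> H) (q : nat) : H :=
  \sum_(k < q.+1) (k`!)%:R^-1 *: serpow c k q.

End Bialgebra.

(* Main.v *)
(* Let W_i be the operator (alpha(1) e^(i gamma))_0, that is the residue at
   z = 0 of alpha(1)(z) F(z)^i, where F(z) = e^gamma(z): as gamma has norm 0,
   the coefficients of F commute with each other, and as alpha is orthogonal to
   gamma they commute with all alpha(j).  On a given element of V only finitely
   many coefficients matter, so F may be replaced by a Laurent polynomial in z
   over a commutative ring I of operators preserving V.

   Up to any given order in x, 1/(1 - x F) is a finite product of factors
   1/(1 - x^d b z^n) with b in I, so that F^m is the sum of d (b z^n)^(m/d)
   over the (d, b z^n) with d dividing m.  Hence sum_i x^i W_i / i is a sum of
   terms sum_k (x^d b)^k alpha(-k n) / k.  Group the terms with n < 0, n = 0 and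
   n > 0 separately.  The exponential of each group preserves V, because
   exp(sum_k alpha(k) t^k / k), exp(sum_k alpha(-k) t^k / k) and
   (1 - t)^(-alpha(0)) have coefficients preserving V, where x^d b may be
   substituted for t.  By the Baker-Campbell-Hausdorff formula the exponential
   of the sum of the groups n < 0 and n > 0 is the product of their
   exponentials and of the exponential of half a central commutator; the latter
   is a product of integral powers of series 1 - x^d b, because (alpha, alpha)
   is even. *)

Require Import Defs.
From mathcomp Require Import all_boot all_order all_algebra.
From mathcomp Require Import finmap zify ring.
From HB Require Import structures.
From mathcomp Require Import boolp classical_sets fsbigop.
From mathcomp.multinomials Require Import monalg.

Set Implicit Arguments.
Unset Strict Implicit.
Unset Printing Implicit Defensive.

Import Order.TTheory GRing.Theory Num.Theory.
Local Open Scope ring_scope.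

(** * Formal power series *)

(** The obstacle is the denominator i. But m |-> F^m is the ghost sequence of a big Witt vector over
    I[z, 1/z]; splitting its Witt coordinates into monomials leaves only sums of (x^d b)^k / k over
    k, which exponentiate without denominators. Integrality is therefore a property of sequences:
    [intseq I p] says that exp(sum_n p_n x^n / n) has coefficients in I, and geometric sequences are
    the basic case to which all others are reduced. Commutative rings I come from bicommutants: the
    operators that preserve V and lie in the bicommutant of a commuting family form a commutative
    subring. Identities between exponentials of noncommuting operators are proved by uniqueness of
    the solution of x f' = p f. Finiteness is handled by bounds R and K on a vector, chosen for the
    order q in x so that the zero modes with i <= q respect them. *)

Definition fps (A : Type) := nat -> A.

HB.instance Definition _ (A : Type) := gen_eqMixin (fps A).
HB.instance Definition _ (A : Type) := gen_choiceMixin (fps A).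

Lemma fpsP (A : Type) (f g : fps A) : (forall n, f n = g n) -> f = g.
Proof. exact: funext. Qed.

Section FpsRing.
Variable A : nzRingType.
Implicit Types f g h : fps A.

Definition fps0 : fps A := fun=> 0.
Definition fpsN f : fps A := fun n => - f n.
Definition fpsD f g : fps A := fun n => f n + g n.

Fact fpsDA : associative fpsD.
Proof. by move=> f g h; apply: fpsP => n; apply: addrA. Qed.
Fact fpsDC : commutative fpsD.
Proof. by move=> f g; apply: fpsP => n; apply: addrC. Qed.
Fact fps0D : left_id fps0 fpsD.
Proof. by move=> f; apply: fpsP => n; apply: add0r. Qed.
Fact fpsND : left_inverse fps0 fpsN fpsD.
Proof. by move=> f; apply: fpsP => n; apply: addNr. Qed.

HB.instance Definition _ :=
  GRing.isZmodule.Build (fps A) fpsDA fpsDC fps0D fpsND.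

Definition fpsM f g : fps A := fun n => \sum_(i < n.+1) f i * g (n - i)%N.
Definition fps1 : fps A := fun n => (n == 0%N)%:R.

Definition ftrunc n f : {poly A} := \poly_(i < n.+1) f i.

Lemma coef_ftrunc n f i : (i <= n)%N -> (ftrunc n f)`_i = f i.
Proof. by rewrite coef_poly ltnS => ->. Qed.

Lemma fpsM_trunc n i f g : (i <= n)%N ->
  fpsM f g i = (ftrunc n f * ftrunc n g)`_i.
Proof.
move=> le; rewrite coefM; apply: eq_bigr => j _.
by rewrite !coef_ftrunc //; have := ltn_ord j; lia.
Qed.

Lemma eq_coefM (p p' q q' : {poly A}) n :
  (forall i, (i <= n)%N -> p`_i = p'`_i) ->
  (forall i, (i <= n)%N -> q`_i = q'`_i) -> (p * q)`_n = (p' * q')`_n.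
Proof.
move=> pp qq; rewrite !coefM; apply: eq_bigr => i _.
by rewrite pp ?qq //; have := ltn_ord i; lia.
Qed.

(** Coefficients up to degree n only see truncations, so this is associativity of polynomials. *)
Fact fpsMA : associative fpsM.
Proof.
move=> f g h; apply: fpsP => n; rewrite !(fpsM_trunc _ _ (leqnn n)).
transitivity ((ftrunc n f * (ftrunc n g * ftrunc n h))`_n).
  by apply: eq_coefM => // i le; rewrite coef_ftrunc // -fpsM_trunc.
rewrite mulrA.
by apply: eq_coefM => // i le; rewrite coef_ftrunc // -fpsM_trunc.
Qed.

Fact fps1M : left_id fps1 fpsM.
Proof.
move=> f; apply: fpsP => n; rewrite /fpsM big_ord_recl /= mul1r subn0.
by rewrite big1 ?addr0 // => i _; rewrite mul0r.
Qed.

Fact fpsM1 : right_id fps1 fpsM.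
Proof.
move=> f; apply: fpsP => n; rewrite /fpsM big_ord_recr /= subnn mulr1.
rewrite big1 ?add0r // => i _; rewrite /fps1.
by rewrite (_ : (n - i == 0)%N = false) ?mulr0 //; have := ltn_ord i; lia.
Qed.

Fact fpsMDl : left_distributive fpsM fpsD.
Proof.
move=> f g h; apply: fpsP => n; rewrite /fpsM /fpsD -big_split /=.
by apply: eq_bigr => i _; rewrite mulrDl.
Qed.

Fact fpsMDr : right_distributive fpsM fpsD.
Proof.
move=> f g h; apply: fpsP => n; rewrite /fpsM /fpsD -big_split /=.
by apply: eq_bigr => i _; rewrite mulrDr.
Qed.

Fact fps1_neq0 : fps1 != fps0.
Proof.
apply/eqP => /(congr1 (fun f : fps A => f 0%N)) /eqP.
by rewrite /fps1 /fps0 oner_eq0.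
Qed.

HB.instance Definition _ := GRing.Zmodule_isNzRing.Build (fps A)
  fpsMA fps1M fpsM1 fpsMDl fpsMDr fps1_neq0.

Lemma fpsME f g n : (f * g) n = \sum_(i < n.+1) f i * g (n - i)%N.
Proof. by []. Qed.
Lemma fpsDE f g n : (f + g) n = f n + g n. Proof. by []. Qed.
Lemma fpsNE f n : (- f) n = - f n. Proof. by []. Qed.
Lemma fpsBE f g n : (f - g) n = f n - g n. Proof. by []. Qed.
Lemma fps1E n : (1 : fps A) n = (n == 0%N)%:R. Proof. by []. Qed.

Lemma fps_sumE (I : Type) (r : seq I) (P : pred I) (F : I -> fps A) n :
  (\sum_(i <- r | P i) F i) n = \sum_(i <- r | P i) F i n.
Proof. by elim/big_rec2 : _ => // i x y _ <-. Qed.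

Lemma fpsMnE f k n : (f *+ k) n = f n *+ k.
Proof. by elim: k => [|k IH]; rewrite ?mulr0n ?mulrS // fpsDE IH. Qed.

Lemma fpsMzE f (z : int) n : (f *~ z) n = f n *~ z.
Proof. by case: z => k; rewrite ?NegzE ?mulrNz ?fpsNE -!pmulrn fpsMnE. Qed.

Lemma fpsM0 f g : (f * g) 0%N = f 0%N * g 0%N.
Proof. by rewrite fpsME big_ord_recl big_ord0 addr0. Qed.

Lemma fpsMrev f g n : (f * g) n = \sum_(i < n.+1) f (n - i)%N * g i.
Proof.
rewrite fpsME (reindex_inj rev_ord_inj) /=; apply: eq_bigr => i _.
by rewrite !subSS subKn // -ltnS.
Qed.

Lemma fps_comm f g : (forall i j, f i * g j = g j * f i) -> f * g = g * f.
Proof.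
move=> fg; apply: fpsP => n; rewrite fpsME fpsMrev.
by apply: eq_bigr => i _; rewrite fg.
Qed.

Definition fpsC (a : A) : fps A := fun n => if n is 0 then a else 0.

Lemma fpsC_M a f n : (fpsC a * f) n = a * f n.
Proof.
rewrite fpsME big_ord_recl /= subn0 big1 ?addr0 // => i _.
by rewrite mul0r.
Qed.

Lemma fpsM_C a f n : (f * fpsC a) n = f n * a.
Proof.
rewrite fpsMrev big_ord_recl /= subn0 big1 ?addr0 // => i _.
by rewrite mulr0.
Qed.

Definition euler f : fps A := fun n => f n *+ n.

Lemma eulerD f g : euler (f + g) = euler f + euler g.
Proof. by apply: fpsP => n; apply: mulrnDl. Qed.

Lemma eulerN f : euler (- f) = - euler f.
Proof. by apply: fpsP => n; apply: mulNrn. Qed.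

Lemma eulerM f g : euler (f * g) = euler f * g + f * euler g.
Proof.
apply: fpsP => n; rewrite /euler fpsDE !fpsME -big_split -sumrMnl /=.
apply: eq_bigr => i _; rewrite mulrnAl mulrnAr -mulrnDr subnKC //.
by have := ltn_ord i; lia.
Qed.

Lemma euler1 : euler 1 = 0.
Proof. by apply: fpsP => -[|n]; rewrite /euler ?mulr0n // mul0rn. Qed.

Lemma fps_pow_coef f k n : f 0%N = 0 -> (n < k)%N -> (f ^+ k) n = 0.
Proof.
move=> f0; elim: k n => // k IH n lt; rewrite exprS fpsME big1 // => i _.
case: (posnP i) => [->|i0]; first by rewrite f0 mul0r.
by rewrite IH ?mulr0 //; have := ltn_ord i; lia.
Qed.

End FpsRing.

Section FpsAlg.
Variable A : algType rat.
Implicit Types f g h : fps A.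

Definition fpsZ (a : rat) f : fps A := fun n => a *: f n.
Fact fpsZA a b f : fpsZ a (fpsZ b f) = fpsZ (a * b) f.
Proof. by apply: fpsP => n; apply: scalerA. Qed.
Fact fps1Z : left_id 1 fpsZ.
Proof. by move=> f; apply: fpsP => n; apply: scale1r. Qed.
Fact fpsZDr : right_distributive fpsZ +%R.
Proof. by move=> a f g; apply: fpsP => n; apply: scalerDr. Qed.
Fact fpsZDl f : {morph fpsZ^~ f : a b / a + b}.
Proof. by move=> a b; apply: fpsP => n; apply: scalerDl. Qed.

HB.instance Definition _ := GRing.Zmodule_isLmodule.Build rat (fps A)
  fpsZA fps1Z fpsZDr fpsZDl.

Fact fpsZAl (a : rat) f g : a *: (f * g) = a *: f * g.
Proof.
apply: fpsP => n; rewrite fpsME /GRing.scale /= /fpsZ /= fpsME scaler_sumr.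
by apply: eq_bigr => i _; rewrite -scalerAl.
Qed.
Fact fpsZAr (a : rat) f g : a *: (f * g) = f * (a *: g).
Proof.
apply: fpsP => n; rewrite fpsME /GRing.scale /= /fpsZ /= fpsME scaler_sumr.
by apply: eq_bigr => i _; rewrite -scalerAr.
Qed.
HB.instance Definition _ := GRing.Lmodule_isLalgebra.Build rat (fps A) fpsZAl.
HB.instance Definition _ := GRing.Lalgebra_isAlgebra.Build rat (fps A) fpsZAr.

Lemma fpsZE a f n : (a *: f) n = a *: f n. Proof. by []. Qed.

Lemma mulrn_inj (x y : A) n : (0 < n)%N -> x *+ n = y *+ n -> x = y.
Proof.
move=> n0 /(congr1 (fun z : A => (n%:R^-1 : rat) *: z)).
by rewrite -!scaler_nat !scalerA mulVf ?scale1r // pnatr_eq0 -lt0n.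
Qed.

(** As p has no constant term, n f_n = sum_i p_i f_(n-i) determines f_n from lower coefficients, n
    being invertible. No commutativity enters, so this is the main tool for comparing exponentials
    of operators. *)
Lemma euler_uniq (p f g : fps A) : p 0%N = 0 -> f 0%N = g 0%N ->
  euler f = p * f -> euler g = p * g -> f = g.
Proof.
move=> p0 fg0 Ef Eg; apply: fpsP; elim/ltn_ind => -[_|n IH]; first exact: fg0.
apply: (@mulrn_inj _ _ n.+1) => //.
have := congr1 (fun h : fps A => h n.+1) Ef.
have := congr1 (fun h : fps A => h n.+1) Eg; rewrite /= /euler => -> ->.
rewrite !fpsME; apply: eq_bigr => i _.
case: (posnP i) => [->|i0]; first by rewrite p0 !mul0r.
by rewrite IH //; lia.
Qed.

Definition dpow (X : A) k : A := (k`!)%:R^-1 *: X ^+ k.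

End FpsAlg.

Section DividedPowers.
Variable B : algType rat.
Implicit Types X Y Z : B.

Lemma dpow0 X : dpow X 0 = 1.
Proof. by rewrite /dpow fact0 invr1 scale1r expr0. Qed.

Lemma factSV n : (n.+1`!)%:R^-1 *+ n.+1 = (n`!)%:R^-1 :> rat.
Proof.
by rewrite -[LHS]mulr_natr factS natrM invfM mulrAC mulVf ?mul1r // pnatr_eq0.
Qed.

Lemma dpowS X n : dpow X n.+1 *+ n.+1 = X * dpow X n.
Proof.
by rewrite /dpow scalerMnl factSV exprS -scalerAr.
Qed.

Lemma dpow_comm X Y Z n : Y * X = X * Y + Z -> Z * X = X * Z ->
  dpow X n.+1 * Y = Y * dpow X n.+1 - Z * dpow X n.
Proof.
move=> YX ZX; have key k : Y * X ^+ k.+1 = X ^+ k.+1 * Y + (Z * X ^+ k) *+ k.+1.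
  elim: k => [|k IH]; first by rewrite expr1 expr0 mulr1 mulr1n YX.
  rewrite exprSr mulrA IH mulrDl -mulrA YX mulrDr mulrnAl -[Z * _ * X]mulrA.
  rewrite -exprSr mulrA -addrA; congr (_ + _).
  have -> : X ^+ k.+1 * Z = Z * X ^+ k.+1 by apply: commr_sym; apply: commrX.
  by rewrite -mulrS.
rewrite /dpow -scalerAl -!scalerAr key scalerDr -scalerMnr scalerMnl factSV.
by rewrite addrK.
Qed.

End DividedPowers.

Lemma big_ord_widen_nz (V : zmodType) (n m : nat) (F : nat -> V) : (n <= m)%N ->
  (forall i, (n <= i < m)%N -> F i = 0) -> \sum_(i < m) F i = \sum_(i < n) F i.
Proof.
move=> nm F0; rewrite -(subnKC nm) big_split_ord /= [X in _ + X]big1 ?addr0 //.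
by move=> i _; apply: F0; have := ltn_ord i; lia.
Qed.

(** * Exponentials in A[[x]] and the Baker-Campbell-Hausdorff formula *)

Section Summation.
Variable A : algType rat.
Implicit Types F G : fps (fps A).

(* The value at t = 1 of a series in t over A[[x]] whose coefficient of t^n is
   divisible by x^(n/2). *)
Definition fsum F : fps A := fun q => \sum_(n < q.*2.+1) F n q.
Definition summable F := forall n q, (q.*2 < n)%N -> F n q = 0.

Lemma summableM F G : summable F -> summable G -> summable (F * G).
Proof.
move=> sF sG n q lt; rewrite fpsME fps_sumE big1 // => i _.
rewrite fpsME big1 // => j _; case: (ltnP j.*2 i) => ij; first by rewrite sF ?mul0r.
by rewrite sG ?mulr0 //; have := ltn_ord j; lia.
Qed.

(** In each degree of x the series in t is a polynomial, and evaluation at the central element 1 is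
    multiplicative. *)
Lemma fsumM F G : summable F -> summable G -> fsum (F * G) = fsum F * fsum G.
Proof.
move=> sF sG; apply: fpsP => q; rewrite /fsum fpsME.
under eq_bigr => n _ do rewrite fpsME fps_sumE.
under eq_bigr => n _ do under eq_bigr => i _ do rewrite fpsME.
under eq_bigr => n _ do rewrite exchange_big /=.
rewrite exchange_big /=; apply: eq_bigr => a _.
have aq : (a <= q)%N by rewrite -ltnS.
pose p : {poly A} := \poly_(i < a.*2.+1) F i a.
pose r : {poly A} := \poly_(i < (q - a).*2.+1) G i (q - a)%N.
have Ep : p.[1] = \sum_(i < a.*2.+1) F i a.
  by rewrite horner_poly; apply: eq_bigr => i _; rewrite expr1n mulr1.
have Er : r.[1] = \sum_(i < (q - a).*2.+1) G i (q - a)%N.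
  by rewrite horner_poly; apply: eq_bigr => i _; rewrite expr1n mulr1.
rewrite -Ep -Er -hornerM_comm; last by rewrite /comm_poly mul1r mulr1.
have sz : (size (p * r)%R <= q.*2.+1)%N.
  apply: leq_trans (size_polyMleq _ _) _.
  have := size_poly a.*2.+1 (fun i => F i a).
  have := size_poly (q - a).*2.+1 (fun i => G i (q - a)%N).
  rewrite -/p -/r; lia.
rewrite (horner_coef_wide _ sz); apply: eq_bigr => n _.
rewrite expr1n mulr1 coefM; apply: eq_bigr => i _; rewrite !coef_poly.
case: ltnP => [_|ia]; last by rewrite (sF i) ?mul0r.
by case: ltnP => [//|ni]; rewrite sG.
Qed.

End Summation.

Section Exponential.
Variable A : algType rat.
Implicit Types X Y Z : fps A.

Definition fexp X : fps A := fun n => \sum_(k < n.+1) dpow X k n.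

Lemma dpow_coef X k n : X 0%N = 0 -> (n < k)%N -> dpow X k n = 0.
Proof. by move=> X0 lt; rewrite /dpow fpsZE fps_pow_coef ?scaler0. Qed.

Lemma fexp_coef0 X : fexp X 0%N = 1.
Proof. by rewrite /fexp big_ord_recl big_ord0 addr0 dpow0. Qed.

Lemma fexp0 : fexp 0 = 1.
Proof.
apply: fpsP => n; rewrite /fexp big_ord_recl dpow0 big1 ?addr0 // => i _.
by rewrite /dpow expr0n scaler0.
Qed.

Lemma serexpE (c : nat -> A) (X : fps A) q :
  X 0%N = 0 -> (forall i, (0 < i <= q)%N -> X i = c i) -> serexp c q = fexp X q.
Proof.
move=> X0 Xc; rewrite /serexp /fexp; apply: eq_bigr => k _.
rewrite /dpow fpsZE; congr (_ *: _).
move: (nat_of_ord k) => {}k; elim: k q Xc => [//|k IH] q Xc.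
rewrite exprS fpsME /= big_ord_recl X0 mul0r add0r big_add1 /= big_mkord.
apply: eq_bigr => i _; rewrite /bump /= add1n Xc; last by have := ltn_ord i; lia.
by rewrite IH // => j le; apply: Xc; have := ltn_ord i; lia.
Qed.

Let texp X : fps (fps A) := fun n => dpow X n.
(** This is exp(t^2 Z). Its coefficient of t^(2k) is divisible by x^k only, whence the bound [q.*2]
    in [summable]. *)
Let t2exp Z : fps (fps A) := fun n => if odd n then 0 else dpow Z n./2.

Let texp_summable X : X 0%N = 0 -> summable (texp X).
Proof. by move=> X0 n q lt; apply: dpow_coef => //; lia. Qed.

Let t2exp_summable X : X 0%N = 0 -> summable (t2exp X).
Proof.
move=> X0 n q lt; rewrite /t2exp; case: ifP => // on.
by apply: dpow_coef => //; lia.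
Qed.

Let fsum_texp X : X 0%N = 0 -> fsum (texp X) = fexp X.
Proof.
move=> X0; apply: fpsP => q; rewrite /fsum /fexp.
rewrite (@big_ord_widen_nz _ q.+1 q.*2.+1 (fun n => texp X n q)) //; first lia.
by move=> i le; apply: dpow_coef => //; lia.
Qed.

Let fsum_t2exp X : fsum (t2exp X) = fexp X.
Proof.
apply: fpsP => q; rewrite /fsum /fexp.
suff gen m : \sum_(n < m.*2.+1) t2exp X n q = \sum_(k < m.+1) dpow X k q by exact: gen.
elim: m => [|m IH]; first by rewrite !big_ord_recl !big_ord0.
rewrite doubleS big_ord_recr big_ord_recr /= IH [RHS]big_ord_recr /= /t2exp /=.
by rewrite negbK odd_double /= doubleK addr0.
Qed.

Definition tmul (X : fps A) : fps (fps A) := fun n => if n == 1%N then X else 0.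
Definition t2mul (X : fps A) : fps (fps A) := fun n => if n == 2%N then X else 0.

Let tmulE X (F : fps (fps A)) n : (tmul X * F) n = if n is n'.+1 then X * F n' else 0.
Proof.
rewrite fpsME big_ord_recl /= mul0r add0r; case: n => [|n]; first by rewrite big_ord0.
rewrite big_ord_recl /= big1 ?addr0 /bump /= ?subSS ?subn0 // => i _.
by rewrite /tmul /= mul0r.
Qed.

Let Mtmul X (F : fps (fps A)) n : (F * tmul X) n = if n is n'.+1 then F n' * X else 0.
Proof.
rewrite fpsMrev big_ord_recl /= mulr0 add0r; case: n => [|n]; first by rewrite big_ord0.
rewrite big_ord_recl /= big1 ?addr0 /bump /= ?subSS ?subn0 // => i _.
by rewrite /tmul /= mulr0.
Qed.

Let t2mulE X (F : fps (fps A)) n : (t2mul X * F) n = if n is n'.+2 then X * F n' else 0.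
Proof.
rewrite fpsME big_ord_recl /= mul0r add0r; case: n => [|n]; first by rewrite big_ord0.
rewrite big_ord_recl /= {1}/t2mul /= mul0r add0r.
case: n => [|n]; first by rewrite big_ord0.
rewrite big_ord_recl /= big1 ?addr0 /bump /= ?subSS ?subn0 // => i _.
by rewrite /t2mul /= mul0r.
Qed.

Let euler_texp X : euler (texp X) = tmul X * texp X.
Proof.
by apply: fpsP => -[|n]; rewrite tmulE /euler ?mulr0n // dpowS.
Qed.

Let euler_t2exp X : euler (t2exp X) = t2mul (X + X) * t2exp X.
Proof.
apply: fpsP => -[|[|n]]; rewrite t2mulE /euler ?mulr0n //.
rewrite /t2exp /= negbK; case: ifP => on; first by rewrite mulr0 mul0rn.
have -> : n.+2 = (n./2.+1 * 2)%N by lia.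
by rewrite mulrnA dpowS mulr2n mulrDl.
Qed.

(** With an auxiliary variable t, the series exp(t(X + Y)) and exp(tX) exp(tY) exp(t^2 Z) satisfy
    the same equation for t d/dt and agree at t = 0; then t is set to 1. *)
Lemma fexp_bch X Y Z : X 0%N = 0 -> Y 0%N = 0 -> Z 0%N = 0 ->
  Y * X = X * Y + (Z + Z) -> Z * X = X * Z -> Z * Y = Y * Z ->
  fexp (X + Y) = fexp X * fexp Y * fexp Z.
Proof.
move=> X0 Y0 Z0 YX ZX ZY.
have XY0 : (X + Y) 0%N = 0 by rewrite fpsDE X0 Y0 addr0.
rewrite -(fsum_texp XY0) -(fsum_texp X0) -(fsum_texp Y0) -(fsum_t2exp Z).
have sXY := summableM (texp_summable X0) (texp_summable Y0).
rewrite -(fsumM (texp_summable X0) (texp_summable Y0)).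
rewrite -(fsumM sXY (t2exp_summable Z0)).
congr fsum; apply: (@euler_uniq _ (tmul (X + Y))) => //.
- by rewrite !fpsM0 /texp /t2exp /= !dpow0 !mulr1.
- exact: euler_texp.
(* Moving tY to the left of exp(tX) costs 2 t^2 Z, which the derivative of exp(t^2 Z)
   compensates. *)
have com : texp X * tmul Y = tmul Y * texp X - t2mul (Z + Z) * texp X.
  apply: fpsP => n; rewrite fpsBE Mtmul tmulE t2mulE.
  case: n => [|[|n]]; rewrite ?subr0 //; first by rewrite /texp !dpow0 mulr1 mul1r.
  by rewrite /texp (dpow_comm _ YX) // mulrDl mulrDr ZX.
have tD : tmul (X + Y) = tmul X + tmul Y.
  by apply: fpsP => n; rewrite fpsDE /tmul; case: ifP => _; rewrite ?addr0.
have cZ (W : fps A) : Z * W = W * Z -> t2mul (Z + Z) * texp W = texp W * t2mul (Z + Z).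
  move=> ZW; have ZZW : W * (Z + Z) = (Z + Z) * W by rewrite mulrDl mulrDr ZW.
  apply: fps_comm => i j; rewrite /t2mul; case: ifP => _; last by rewrite mulr0 mul0r.
  by rewrite /texp /dpow -scalerAl -scalerAr; congr (_ *: _); apply: commrX; rewrite /GRing.comm ZZW.
rewrite !eulerM !euler_texp euler_t2exp tD.
rewrite (mulrA _ (tmul Y)) com (mulrA _ (t2mul _)) -(mulrA (texp X)) -(cZ Y) //.
rewrite (mulrA (texp X)) -(cZ X) // !(mulrDl, mulNr) -!mulrA.
by rewrite -!addrA addNr addr0.
Qed.

Lemma fexpD X Y : X 0%N = 0 -> Y 0%N = 0 -> X * Y = Y * X ->
  fexp (X + Y) = fexp X * fexp Y.
Proof.
move=> X0 Y0 XY; rewrite (@fexp_bch X Y 0) ?fexp0 ?mulr1 //.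
- by rewrite !addr0.
- by rewrite mul0r mulr0.
by rewrite mul0r mulr0.
Qed.

Lemma euler_dpow X k : X * euler X = euler X * X ->
  euler (dpow X k.+1) = euler X * dpow X k.
Proof.
move=> XE; have eX n : euler (X ^+ n.+1) = (euler X * X ^+ n) *+ n.+1.
  elim: n => [|n IH]; first by rewrite expr1 expr0 mulr1 mulr1n.
  rewrite exprS eulerM IH mulrnAr mulrA XE -mulrA -exprS.
  by rewrite [RHS]mulrS.
have eZ a f : euler (a *: f) = a *: euler f :> fps A.
  by apply: fpsP => n; rewrite /euler !fpsZE scalerMnr.
by rewrite /dpow eZ eX -scalerMnr scalerMnl factSV -scalerAr.
Qed.

Lemma euler_fexp X : X 0%N = 0 -> X * euler X = euler X * X ->
  euler (fexp X) = euler X * fexp X.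
Proof.
move=> X0 XE; apply: fpsP => n.
transitivity (\sum_(k < n.+2) euler (dpow X k) n).
  rewrite big_ord_recr /= [X in _ + X]/euler dpow_coef // mul0rn addr0.
  by rewrite /euler /fexp -sumrMnl.
rewrite big_ord_recl dpow0 euler1 add0r.
under eq_bigr => k _ do rewrite euler_dpow // fpsMrev.
rewrite exchange_big /= fpsMrev; apply: eq_bigr => i _; rewrite -mulr_sumr.
congr (_ * _); rewrite /fexp.
rewrite (@big_ord_widen_nz _ i.+1 n.+1 (fun k => dpow X k i)) // => k le.
by apply: dpow_coef => //; lia.
Qed.

End Exponential.

(** * Witt coordinates *)

Section Subring.
Variable B : nzRingType.
Implicit Types (I S G : B -> Prop) (p h : fps B).

Record subring I : Prop := Subring {
  sub1 : I 1;
  subB : forall x y, I x -> I y -> I (x - y);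
  subM : forall x y, I x -> I y -> I (x * y) }.

Definition commuting I := forall x y, I x -> I y -> x * y = y * x.

Variable I : B -> Prop.
Hypothesis sI : subring I.

Lemma sub0 : I 0.
Proof. by rewrite -(subrr 1); apply: subB => //; apply: sub1. Qed.
Lemma subN x : I x -> I (- x).
Proof. by move=> Ix; rewrite -sub0r; apply: subB => //; apply: sub0. Qed.
Lemma subD x y : I x -> I y -> I (x + y).
Proof. by move=> Ix Iy; rewrite -[y]opprK; apply: subB => //; apply: subN. Qed.
Lemma sub_sum (T : Type) (r : seq T) (P : pred T) F :
  (forall i, P i -> I (F i)) -> I (\sum_(i <- r | P i) F i).
Proof. by move=> IF; elim/big_ind: _ => //; [apply: sub0 | apply: subD]. Qed.
Lemma subMn x n : I x -> I (x *+ n).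
Proof.
by move=> Ix; elim: n => [|n IH]; rewrite ?mulr0n ?mulrS; [apply: sub0 | apply: subD].
Qed.
Lemma subX x n : I x -> I (x ^+ n).
Proof.
by move=> Ix; elim: n => [|n IH]; rewrite ?expr0 ?exprS; [apply: sub1 | apply: subM].
Qed.

(* [h] is the exponential of the series with coefficients [p n / n]. *)
Definition newton p h := [/\ p 0%N = 0, h 0%N = 1 & euler h = p * h].

(** For commutative I these are the ghost sequences of big Witt vectors over I, the vector being the
    series h in 1 + x I[[x]]. *)
Definition intseq p := exists2 h, newton p h & forall n, I (h n).

Lemma newton_last p h n : newton p h ->
  p n = h n *+ n - \sum_(i < n) p i * h (n - i)%N.
Proof.
case=> p0 h0 /(congr1 (fun f : fps B => f n)).
by rewrite /euler fpsME big_ord_recr /= subnn h0 mulr1 => ->; rewrite [RHS]addrC addrA addNr add0r.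
Qed.

(** Newton's identities write p_n as an integral polynomial in the h_i, without division. *)
Lemma newton_in p h : newton p h -> (forall n, I (h n)) -> forall n, I (p n).
Proof.
move=> nw Ih; elim/ltn_ind => n IH; rewrite (newton_last n nw).
apply: subB => //; first exact: subMn.
by apply: sub_sum => i _; apply: subM => //; apply: IH.
Qed.

Lemma intseq_in p : intseq p -> forall n, I (p n).
Proof. by case=> h; apply: newton_in. Qed.

Hypothesis cI : commuting I.

Lemma intseq0 : intseq 0.
Proof.
exists 1; last by move=> n; rewrite fps1E; apply: subMn; apply: sub1.
by split=> //; rewrite euler1 mul0r.
Qed.

Lemma intseqD p p' : intseq p -> intseq p' -> intseq (p + p').
Proof.
move=> sp sp'; have Ip := intseq_in sp; have Ip' := intseq_in sp'.
case: sp => h [p0 h0 Eh] Ih; case: sp' => h' [p'0 h'0 Eh'] Ih'.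
exists (h * h'); last first.
  by move=> n; rewrite fpsME; apply: sub_sum => i _; apply: subM.
split; rewrite ?fpsM0 ?fpsDE ?p0 ?p'0 ?h0 ?h'0 ?addr0 ?mulr1 //.
rewrite eulerM Eh Eh' mulrDl !mulrA; congr (_ + _ * _).
by apply: fps_comm => i j; apply: cI.
Qed.

Lemma intseq_sum (T : Type) (r : seq T) (P : pred T) F :
  (forall i, P i -> intseq (F i)) -> intseq (\sum_(i <- r | P i) F i).
Proof. by move=> IF; elim/big_ind: _ => //; [apply: intseq0 | apply: intseqD]. Qed.

(** The ghost sequence of the Witt vector with the single coordinate b in degree d: the
    corresponding h is 1 / (1 - b x^d), which is [ginv d b]. *)
Definition geom d (b : B) : fps B :=
  fun n => if (0 < n)%N && (d %| n)%N then b ^+ (n %/ d) *+ d else 0.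
Let ginv d (b : B) : fps B := fun n => if (d %| n)%N then b ^+ (n %/ d) else 0.
Definition fmono d (b : B) : fps B := fun n => if n == d then b else 0.

Lemma fmonoM d b (f : fps B) n :
  (fmono d b * f) n = if (d <= n)%N then b * f (n - d)%N else 0.
Proof.
rewrite fpsME; case: (leqP d n) => dn.
  have ld : (d < n.+1)%N by [].
  rewrite (bigD1 (Ordinal ld)) //= /fmono eqxx big1 ?addr0 // => i.
  by rewrite -val_eqE /= => /negPf ->; rewrite mul0r.
rewrite big1 // => i _; rewrite /fmono (_ : (i == d :> nat) = false) ?mul0r //.
by have := ltn_ord i; lia.
Qed.

Let ginvK d b : (0 < d)%N -> (1 - fmono d b) * ginv d b = 1.
Proof.
move=> d0; apply: fpsP => n; rewrite mulrBl mul1r fpsBE fmonoM fps1E /ginv.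
case: (leqP d n) => dn.
  rewrite (_ : (n == 0)%N = false); last by lia.
  have -> : (d %| n - d)%N = (d %| n)%N by rewrite -{2}(subnK dn) dvdn_addl.
  case: ifP => [/dvdnP[k kE]|_]; last by rewrite mulr0 subrr.
  rewrite kE mulnK //; case: k kE => [|k] kE; first by move: dn d0; rewrite kE; lia.
  by rewrite mulSn addKn mulnK // exprS subrr.
rewrite subr0; case: (posnP n) => [->|n0]; first by rewrite dvdn0 div0n.
by rewrite gtnNdvd // (_ : (n == 0)%N = false) //; lia.
Qed.

Let geomE d b : (0 < d)%N -> geom d b = fmono d b *+ d * ginv d b.
Proof.
move=> d0; apply: fpsP => n; rewrite mulrnAl.
rewrite fpsMnE fmonoM /geom /ginv; case: (leqP d n) => dn.
  have -> : (d %| n - d)%N = (d %| n)%N by rewrite -{2}(subnK dn) dvdn_addl.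
  rewrite (leq_trans d0 dn) /=.
  case: ifP => [/dvdnP[k kE]|_]; last by rewrite mulr0 mul0rn.
  rewrite kE mulnK //; case: k kE => [|k] kE; first by move: dn d0; rewrite kE; lia.
  by rewrite mulSn addKn mulnK // -exprS.
by rewrite mul0rn; case: (posnP n) => //= n0; rewrite gtnNdvd.
Qed.

Let mono_ginv d b : fmono d b * ginv d b = ginv d b * fmono d b.
Proof.
apply: fps_comm => i j; rewrite /fmono /ginv.
case: ifP => _; last by rewrite mul0r mulr0.
by case: ifP => _; rewrite ?mulr0 ?mul0r // -exprS -exprSr.
Qed.

Lemma euler_fmono d b : euler (fmono d b) = fmono d b *+ d.
Proof.
apply: fpsP => n; rewrite fpsMnE.
by rewrite /euler /fmono; case: eqP => [->//|_]; rewrite !mul0rn.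
Qed.

Let ginvK' d b : (0 < d)%N -> ginv d b * (1 - fmono d b) = 1.
Proof.
by move=> d0; rewrite mulrBr -mono_ginv mulr1 -[X in X - _]mul1r -mulrBl ginvK.
Qed.

Lemma intseq_geom d b : (0 < d)%N -> I b -> intseq (geom d b).
Proof.
move=> d0 Ib; exists (ginv d b); last first.
  by move=> n; rewrite /ginv; case: ifP => _; [apply: subX | apply: sub0].
split; [by [] | by rewrite /ginv dvdn0 div0n | ].
have := congr1 (@euler B) (ginvK b d0).
rewrite euler1 eulerM eulerD eulerN euler1 euler_fmono sub0r mulNr addrC => /eqP.
rewrite subr_eq0 => /eqP /(congr1 (fun x => ginv d b * x)) /=.
rewrite mulrA ginvK' // mul1r => ->; rewrite geomE // mulrA.
congr (_ * _); rewrite mulrnAl mulrnAr; congr (_ *+ _).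
by rewrite mono_ginv.
Qed.

Lemma intseqN_geom d b : (0 < d)%N -> I b -> intseq (- geom d b).
Proof.
move=> d0 Ib; exists (1 - fmono d b); last first.
  move=> n; rewrite fpsBE fps1E; apply: subB => //; first by apply: subMn; apply: sub1.
  by rewrite /fmono; case: ifP => _ //; apply: sub0.
split.
- by rewrite fpsNE /geom oppr0.
- by rewrite fpsBE /fmono; case: d d0 => // d _; rewrite fps1E subr0.
rewrite eulerD eulerN euler1 euler_fmono sub0r geomE // mulNr -mulrA ginvK' //.
by rewrite mulr1.
Qed.

Lemma intseqMz_geom d b (z : int) : (0 < d)%N -> I b -> intseq (geom d b *~ z).
Proof.
move=> d0 Ib; have gen (f : fps B) n : intseq f -> intseq (f *+ n).
  by move=> sf; elim: n => [|n IH]; rewrite ?mulr0n ?mulrS; [apply: intseq0 | apply: intseqD].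
case: z => n; first by rewrite -pmulrn; apply: gen; apply: intseq_geom.
by rewrite NegzE mulrNz -mulNrz -pmulrn; apply: gen; apply: intseqN_geom.
Qed.

(* Witt coordinates of [p] up to degree N: those of degree N + 1 are read off
   newton_last, once the contribution of the previous ones is subtracted. *)
Lemma witt S p : (forall x, S x -> I x) ->
  (forall x, I x -> exists2 s : seq B, (forall y, y \in s -> S y) & x = \sum_(y <- s) y) ->
  intseq p -> forall N, exists2 l : seq (nat * B),
    (forall t, t \in l -> (0 < t.1)%N /\ S t.2) &
    (forall m, (m <= N)%N -> p m = \sum_(t <- l) geom t.1 t.2 m).
Proof.
move=> SI IS ip; elim=> [|N [l lP lE]].
  exists [::] => // m; rewrite leqn0 => /eqP ->; rewrite big_nil.
  by case: ip => h [].
(* The remainder stays integral because each factor found so far has the integral inverse 1 - b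
   x^d. *)
have ip' : intseq (p - \sum_(t <- l) geom t.1 t.2)%R.
  apply: intseqD => //; rewrite -sumrN big_seq; apply: intseq_sum => t /lP[t0 St].
  by apply: intseqN_geom => //; apply: SI.
case: ip' => h nw Ih; have [s sS hE] := IS _ (Ih N.+1).
have qN i : (i <= N)%N -> (p - \sum_(t <- l) geom t.1 t.2) i = 0.
  by move=> le; rewrite fpsBE fps_sumE lE // subrr.
have q0 : \sum_(i < N.+1) (p - \sum_(t <- l) geom t.1 t.2) i * h (N.+1 - i)%N = 0.
  by apply: big1 => i _; rewrite qN ?mul0r // -ltnS.
have := newton_last N.+1 nw; rewrite q0 subr0.
rewrite fpsBE fps_sumE hE => /eqP; rewrite subr_eq => /eqP pN.
(* Splitting h_(N+1) additively is harmless: [geom N.+1 y] vanishes in positive degrees below N + 1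
   and equals (N + 1) y there, so several factors of the same degree simply add up. *)
exists (l ++ [seq (N.+1, y) | y <- s]).
  by move=> t; rewrite mem_cat => /orP[/lP //|/mapP[y /sS Sy ->]].
move=> m le; rewrite big_cat big_map /=; move: le; rewrite leq_eqVlt ltnS.
case/orP => [/eqP ->|le]; last first.
  rewrite lE // [X in _ + X]big1 ?addr0 // => y _; rewrite /geom.
  by case: posnP => //= m0; rewrite gtnNdvd.
rewrite pN addrC -sumrMnl; congr (_ + _); apply: eq_bigr => y _.
by rewrite /geom dvdnn divnn expr1.
Qed.

End Subring.

(** * Polynomials with coefficients in a subring *)

Section PolySubring.
Variables (R : nzRingType).
Implicit Types (I S : R -> Prop).

Definition over I (p : {poly R}) := forall i, I p`_i.
Definition monomial S (p : {poly R}) := exists b i, S b /\ p = b *: 'X^i.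

Lemma over_subring I : subring I -> subring (over I).
Proof.
move=> sI; split=> [i|p q Ip Iq i|p q Ip Iq i].
- by rewrite coef1; apply: subMn => //; apply: sub1.
- by rewrite coefB; apply: subB.
by rewrite coefM; apply: sub_sum => // j _; apply: subM.
Qed.

Lemma over_commuting I : commuting I -> commuting (over I).
Proof.
move=> cI p q Ip Iq; apply/polyP => i; rewrite coefM coefMr.
by apply: eq_bigr => j _; apply: cI.
Qed.

Lemma monomial_over I S : subring I -> (forall x, S x -> I x) ->
  forall p, monomial S p -> over I p.
Proof.
move=> sI SI p [b [i [Sb ->]]] j; rewrite coefZ coefXn mulr_natr.
by apply: subMn => //; apply: SI.
Qed.

Lemma monomial_gen I S :
  (forall x, I x -> exists2 s : seq R, (forall y, y \in s -> S y) & x = \sum_(y <- s) y) ->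
  forall p, over I p ->
  exists2 s : seq {poly R}, (forall y, y \in s -> monomial S y) & p = \sum_(y <- s) y.
Proof.
move=> IS p Ip; suff gen n :
    exists2 s : seq {poly R}, (forall y, y \in s -> monomial S y)
      & \sum_(i < n) p`_i *: 'X^i = \sum_(y <- s) y.
  by have [s sM sE] := gen (size p); exists s => //; rewrite -sE -poly_def coefK.
elim: n => [|n [s sM sE]]; first by exists [::] => //; rewrite big_ord0 big_nil.
have [s' sS' sE'] := IS _ (Ip n).
exists (s ++ [seq y *: 'X^n | y <- s']).
  by move=> y; rewrite mem_cat => /orP[/sM//|/mapP[z /sS' Sz ->]]; exists z, n.
by rewrite big_ord_recr /= sE big_cat big_map /= {1}sE' scaler_suml.
Qed.

Lemma monomialM (a b : R) i j : (a *: 'X^i) * (b *: 'X^j) = (a * b) *: 'X^(i + j).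
Proof.
rewrite exprD -!mul_polyC polyCM -!mulrA; congr (_ * _).
by rewrite !mulrA; congr (_ * _); rewrite -commr_polyXn.
Qed.

Lemma coefM_monomial (p : {poly R}) (b : R) k n :
  (p * (b *: 'X^k))`_n = if (k <= n)%N then p`_(n - k)%N * b else 0.
Proof. by rewrite -mul_polyC mulrA coefMXn ltnNge; case: leqP => //= _; rewrite coefMC. Qed.

Lemma monomialX (b : R) i k : (b *: 'X^i) ^+ k = b ^+ k *: 'X^(i * k).
Proof.
elim: k => [|k IH]; first by rewrite muln0 !expr0 scale1r.
by rewrite exprS IH mulnS exprS monomialM.
Qed.

Lemma ftruncX (F : fps R) n i l : (l <= n)%N ->
  ((\poly_(l < n.+1) F l) ^+ i)`_l = (F ^+ i) l.
Proof.
elim: i l => [|i IH] l ln; first by rewrite !expr0 coef1 fps1E.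
rewrite !exprS coefM fpsME; apply: eq_bigr => k _.
have kl : (k <= l)%N by rewrite -ltnS.
by rewrite coef_poly ltnS (leq_trans kl ln) IH // (leq_trans (leq_subr _ _) ln).
Qed.

End PolySubring.

(** * Commutative rings of operators as bicommutants *)

Section Bicommutant.
Variable A : algType rat.
Implicit Types (G I : A -> Prop) (p h : fps A).

Definition commutes G (w : A) := forall g, G g -> w * g = g * w.
(** For a commuting family G this is a commutative subring. It is closed under rational multiples
    and, by [newton_bicomm], under exponentials, and commutation of a given operator with all of it
    is checked on G. *)
Definition bicomm G (u : A) := forall w, commutes G w -> w * u = u * w.

Lemma bicomm_gen G g : G g -> bicomm G g.
Proof. by move=> Gg w; apply. Qed.

Lemma bicomm_mono G G' u : (forall g, G g -> G' g) -> bicomm G u -> bicomm G' u.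
Proof. by move=> GG Gu w cw; apply: Gu => g /GG; apply: cw. Qed.

Lemma bicomm_subring G : subring (bicomm G).
Proof.
split=> [w _|x y Gx Gy w cw|x y Gx Gy w cw]; first by rewrite mul1r mulr1.
  by rewrite mulrBr mulrBl Gx ?Gy.
by rewrite mulrA Gx // -mulrA Gy // mulrA.
Qed.

Lemma bicomm_commuting G : commuting G -> commuting (bicomm G).
Proof.
move=> cG x y Gx Gy; apply: Gy => g Gg; symmetry; apply: Gx => g' Gg'.
exact: cG.
Qed.

Lemma bicommZ G (a : rat) u : bicomm G u -> bicomm G (a *: u).
Proof. by move=> Gu w cw; rewrite -scalerAl -scalerAr Gu. Qed.

Lemma newton_bicomm G p h : newton p h -> (forall n, bicomm G (p n)) ->
  forall n, bicomm G (h n).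
Proof.
case=> p0 h0 E Gp; elim/ltn_ind => -[_|n IH] w cw; first by rewrite h0 mul1r mulr1.
apply: (@mulrn_inj _ _ _ n.+1) => //; rewrite -mulrnAr -mulrnAl.
rewrite (_ : h n.+1 *+ n.+1 = (p * h) n.+1); last by rewrite -E.
rewrite fpsME big_ord_recl p0 mul0r add0r.
suff H : bicomm G (\sum_(i < n.+1) p (lift ord0 i) * h (n.+1 - lift ord0 i)%N).
  exact: H.
apply: sub_sum; first exact: bicomm_subring.
move=> i _; apply: (subM (bicomm_subring G)) => //.
by apply: IH; rewrite /= /bump; lia.
Qed.

Lemma subring_and I I' : subring I -> subring I' -> subring (fun u => I u /\ I' u).
Proof.
move=> s s'; split; first by split; apply: sub1.
  by move=> x y [? ?] [? ?]; split; apply: subB.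
by move=> x y [? ?] [? ?]; split; apply: subM.
Qed.

End Bicommutant.

(** * Integral exponentials and geometric sequences *)

Section ExpIntegrality.
Variable A : algType rat.
Implicit Types (X : fps A) (I : A -> Prop).

Lemma fexp_agree X X' q : (forall i, (i <= q)%N -> X i = X' i) ->
  fexp X q = fexp X' q.
Proof.
move=> XX; rewrite /fexp; apply: eq_bigr => k _; rewrite /dpow !fpsZE; congr (_ *: _).
move: (nat_of_ord k) => {}k; elim: k q XX => [//|k IH] q XX.
rewrite !exprS !fpsME; apply: eq_bigr => i _; rewrite XX -1?ltnS // IH // => j le.
by apply: XX; have := ltn_ord i; lia.
Qed.

(** The series sum_n p_n x^n / n. In degree 0 the convention 0^-1 = 0 gives the coefficient 0, as
    [fexp] requires. *)
Definition eulerV (p : fps A) : fps A := fun n => n%:R^-1 *: p n.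

Lemma eulerVK (p : fps A) : p 0%N = 0 -> euler (eulerV p) = p.
Proof.
move=> p0; apply: fpsP => -[|n]; rewrite /euler /eulerV ?p0 //.
by rewrite scalerMnl -mulr_natr mulVf ?scale1r // pnatr_eq0.
Qed.

Lemma eulerV0 (p : fps A) : eulerV p 0%N = 0.
Proof. by rewrite /eulerV invr0 scale0r. Qed.

Lemma newton_fexp (p : fps A) : p 0%N = 0 -> (forall i j, p i * p j = p j * p i) ->
  newton p (fexp (eulerV p)).
Proof.
move=> p0 cp; split; rewrite ?fexp_coef0 // euler_fexp ?eulerVK //.
  by rewrite eulerV0.
by apply: fps_comm => i j; rewrite /eulerV -scalerAl -scalerAr cp.
Qed.

Lemma intseq_fexp I (p : fps A) : subring I -> commuting I -> intseq I p ->
  forall q, I (fexp (eulerV p) q).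
Proof.
move=> sI cI ip q; have pI := intseq_in sI ip; case: ip => h [p0 h0 E] Ih.
suff -> : fexp (eulerV p) = h by [].
have [_ ? ?] := newton_fexp p0 (fun i j => cI _ _ (pI i) (pI j)).
by apply: (@euler_uniq _ p) => //; rewrite h0.
Qed.

Lemma eulerVD (p p' : fps A) : eulerV (p + p') = eulerV p + eulerV p'.
Proof. by apply: fpsP => n; apply: scalerDr. Qed.

Lemma fexp_eulerVD (p p' : fps A) : p 0%N = 0 -> p' 0%N = 0 ->
  (forall i j, p i * p' j = p' j * p i) ->
  fexp (eulerV (p + p')) = fexp (eulerV p) * fexp (eulerV p').
Proof.
move=> p0 p'0 cp; rewrite eulerVD fexpD ?eulerV0 //.
by apply: fps_comm => i j; rewrite /eulerV -!scalerAl -!scalerAr cp scalerA mulrC -scalerA.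
Qed.

Lemma fexp_comm X (u : A) : X 0%N = 0 -> (forall i, u * X i = X i * u) ->
  forall n, u * fexp X n = fexp X n * u.
Proof.
move=> X0 cX n; rewrite -fpsC_M -fpsM_C; congr ((_ : fps A) n).
have cXk k : fpsC u * X ^+ k = X ^+ k * fpsC u.
  by apply: commrX; apply: fpsP => i; rewrite fpsC_M fpsM_C cX.
apply: fpsP => i; rewrite fpsC_M fpsM_C /fexp mulr_sumr mulr_suml.
apply: eq_bigr => k _; rewrite /dpow !fpsZE -scalerAl -scalerAr; congr (_ *: _).
by rewrite -fpsC_M cXk fpsM_C.
Qed.

(** This is m times the coefficient of x^m in sum_(k>0) (x^d b)^k phi(k) / k; the constant phi = 1
    gives [geom d b]. *)
Definition gterm d (b : A) (phi : nat -> A) m : A :=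
  if (0 < m)%N && (d %| m)%N then b ^+ (m %/ d) * phi (m %/ d)%N *+ d else 0.

(** With g = gcd(e, n), e divides kn exactly when e/g divides k, so the n-th Frobenius of a
    geometric sequence is g times a geometric one. This is the Witt vector identity F_n V_e = g
    V_(e/g) F_(n/g). *)
Lemma gterm_geom d e (b c : A) n m : (0 < d)%N -> (0 < e)%N -> (0 < n)%N ->
  b * c = c * b ->
  gterm d b (fun k => geom e c (k * n)%N) m =
  geom (d * (e %/ gcdn e n)) (b ^+ (e %/ gcdn e n) * c ^+ (n %/ gcdn e n)) m
    *+ gcdn e n.
Proof.
move=> d0 e0 n0 bc; set g := gcdn e n.
have g0 : (0 < g)%N by rewrite gcdn_gt0 e0.
have [/dvdnP[x xE] /dvdnP[y yE]] : (g %| e)%N /\ (g %| n)%N.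
  by rewrite dvdn_gcdl dvdn_gcdr.
have cop : coprime x y.
  rewrite /coprime -(eqn_pmul2r g0) muln_gcdl -xE -yE mul1n.
  by rewrite -/g.
have x0 : (0 < x)%N by move: e0; rewrite xE; case: (x).
have y0 : (0 < y)%N by move: n0; rewrite yE; case: (y).
have -> : (e %/ g = x)%N by rewrite xE mulnK.
have -> : (n %/ g = y)%N by rewrite yE mulnK.
rewrite /gterm /geom; case: (posnP m) => [->|m0] /=; first by rewrite mul0rn.
case: (boolP (d %| m)%N) => [/dvdnP[k kE]|dm]; last first.
  case: ifP => [dm'|_]; last by rewrite mul0rn.
  by move: dm; rewrite (dvdn_trans _ dm') // dvdn_mulr.
have k0 : (0 < k)%N by move: m0; rewrite kE; case: (k).
rewrite kE mulnK // muln_gt0 k0 n0 /=; rewrite yE xE mulnA dvdn_pmul2r // Gauss_dvdl //.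
rewrite [(k * d)%N]mulnC dvdn_pmul2l //.
case: (boolP (x %| k)%N) => [/dvdnP[r ->]|_]; last by rewrite mulr0 !mul0rn.
have -> : (r * x * y * g %/ (x * g) = r * y)%N.
  by rewrite (_ : _ * g = r * y * (x * g))%N ?mulnK ?muln_gt0 ?x0 //; lia.
have -> : (d * (r * x) %/ (d * x) = r)%N.
  by rewrite (_ : d * _ = r * (d * x))%N ?mulnK ?muln_gt0 ?x0 ?d0 //; lia.
rewrite exprMn_comm; last by apply/commrX/commr_sym/commrX/commr_sym.
rewrite -!exprM [(r * x)%N]mulnC [(r * y)%N]mulnC -!mulrnA.
rewrite mulrnAr -mulrnA; congr (_ * _ *+ _); last by lia.
Qed.

(* The contribution of a pair of geometric sequences to a commutator of
   Heisenberg operators. *)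
Lemma gterm_comm d d' (b b' : A) n n' q (z : rat) :
  (0 < d)%N -> (0 < d')%N -> (0 < n)%N -> (0 < n')%N -> b * b' = b' * b ->
  \sum_(i < q.+1) ((i%:R : rat)^-1 * ((q - i)%N%:R)^-1) *:
     (if [&& (0 < i)%N, (d %| i)%N, (0 < q - i)%N, (d' %| q - i)%N &
             (i %/ d * n == (q - i) %/ d' * n')%N]
      then ((i %/ d * n)%N%:R * z) *: (b ^+ (i %/ d) * b' ^+ ((q - i) %/ d')) *+ d *+ d'
      else 0)
  = (q%:R^-1 * (gcdn n n')%:R * z) *:
    geom ((n' %/ gcdn n n') * d + (n %/ gcdn n n') * d')
         (b ^+ (n' %/ gcdn n n') * b' ^+ (n %/ gcdn n n')) q.
Proof.
move=> d0 d'0 n0 n'0 bb; set g := gcdn n n'.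
have g0 : (0 < g)%N by rewrite gcdn_gt0 n0.
have [/dvdnP[y yE] /dvdnP[x xE]] : (g %| n)%N /\ (g %| n')%N.
  by rewrite dvdn_gcdl dvdn_gcdr.
have cop : coprime y x.
  by rewrite /coprime -(eqn_pmul2r g0) muln_gcdl -xE -yE mul1n -/g.
have x0 : (0 < x)%N by move: n'0; rewrite xE; case: (x).
have y0 : (0 < y)%N by move: n0; rewrite yE; case: (y).
have -> : (n' %/ g = x)%N by rewrite xE mulnK.
have -> : (n %/ g = y)%N by rewrite yE mulnK.
set D := (x * d + y * d')%N; have D0 : (0 < D)%N by rewrite addn_gt0 muln_gt0 x0 d0.
(* A nonzero term has i = k d, q - i = k' d' and k n = k' n'. As x and y are coprime this forces k =
   r x and k' = r y, hence q = r D: at most one i contributes, and one does exactly when D divides q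
   > 0. *)
have par i : [&& (0 < i)%N, (d %| i)%N, (0 < q - i)%N, (d' %| q - i)%N &
             (i %/ d * n == (q - i) %/ d' * n')%N] ->
             exists2 r, (0 < r)%N & (i = r * x * d)%N /\ (q = r * D)%N.
  case/and5P=> i0 /dvdnP[k kE] qi0 /dvdnP[k' k'E]; rewrite k'E kE !mulnK //.
  rewrite yE xE !mulnA eqn_pmul2r // => /eqP E.
  have /dvdnP[r rE] : (x %| k)%N.
    by rewrite -(@Gauss_dvdl _ _ y) 1?coprime_sym // E dvdn_mull.
  exists r; first by move: i0; rewrite kE rE; case: (r).
  split; first by rewrite rE.
  have k'r : (k' = r * y)%N.
    by apply/eqP; rewrite -(eqn_pmul2r x0) -E rE -!mulnA [(x * y)%N]mulnC.
  have qE : (q = k * d + k' * d')%N by rewrite -k'E -kE; lia.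
  by rewrite qE k'r rE /D; lia.
case: (boolP ((0 < q)%N && (D %| q)%N)) => [/andP[q0 /dvdnP[r rE]]|ndv]; last first.
  rewrite /geom (negPf ndv) scaler0 big1 // => i _.
  case: ifP => [/par[r r0 [_ qE]]|_]; last by rewrite scaler0.
  suff H : (0 < q)%N && (D %| q)%N by rewrite H in ndv.
  by apply/andP; split; [have : (0 < r * D)%N by rewrite muln_gt0 r0 D0 | apply/dvdnP; exists r] => //; lia.
have r0 : (0 < r)%N by move: q0; rewrite rE; case: (r).
have iq : (r * x * d < q.+1)%N by rewrite rE /D; lia.
rewrite (bigD1 (Ordinal iq)) //= [X in _ + X]big1 ?addr0; last first.
  move=> i ne; case: ifP => [/par[s s0 [iE qE]]|_]; last by rewrite scaler0.
  move: ne; rewrite -val_eqE /= iE; have : (s * D == r * D)%N by rewrite -qE rE.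
  by rewrite eqn_pmul2r // => /eqP ->; rewrite eqxx.
have qi : (q - r * x * d = r * y * d')%N by rewrite rE /D; lia.
rewrite qi !mulnK // !dvdn_mull // !muln_gt0 r0 x0 y0 d0 d'0 /=.
rewrite (_ : (r * x * n == r * y * n')%N); last by rewrite xE yE; apply/eqP; lia.
rewrite /geom rE muln_gt0 r0 D0 dvdn_mull //= mulnK //.
rewrite exprMn_comm; last by apply/commrX/commr_sym/commrX/commr_sym.
rewrite -!exprM [(x * r)%N]mulnC [(y * r)%N]mulnC.
rewrite -!scaler_nat !scalerA; congr (_ *: _).
rewrite yE /D !(natrM, natrD); field.
by rewrite -!natrM -natrD !pnatr_eq0 -!lt0n -/D D0 r0 d'0 y0 d0 x0.
Qed.

End ExpIntegrality.

Lemma fexp_morph (A B : algType rat) (phi : A -> B) (X : fps A) n :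
  linear phi -> phi 1 = 1 -> (forall x y, phi (x * y) = phi x * phi y) ->
  phi (fexp X n) = fexp ((fun i => phi (X i)) : fps B) n.
Proof.
move=> lphi phi1 phiM; have phi0 : phi 0 = 0.
  by have := lphi (-1) 0 0; rewrite scaler0 addr0 scaleN1r addNr.
have phiD x y : phi (x + y) = phi x + phi y.
  by have := lphi 1 x y; rewrite !scale1r.
have phiZ a x : phi (a *: x) = a *: phi x.
  by have := lphi a x 0; rewrite phi0 !addr0.
rewrite /fexp (big_morph _ phiD phi0); apply: eq_bigr => k _.
rewrite /dpow !fpsZE phiZ; congr (_ *: _).
move: (nat_of_ord k) => {}k; elim: k n => [|k IH] n.
  by rewrite !expr0 !fps1E; case: eqP => _; rewrite ?phi1 ?phi0.
rewrite !exprS !fpsME (big_morph _ phiD phi0); apply: eq_bigr => i _.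
by rewrite phiM IH.
Qed.

(** * Exponentials of residues *)

Section Lift.
Variable A : algType rat.

Lemma gterm_sum d (b : A) (T : Type) (r : seq T) (F : T -> nat -> A) m :
  gterm d b (fun k => \sum_(t <- r) F t k) m = \sum_(t <- r) gterm d b (F t) m.
Proof.
rewrite /gterm; case: ifP => _; last by rewrite big1.
by rewrite mulr_sumr -sumrMnl.
Qed.

Lemma eq_gterm d (b : A) phi psi m :
  (forall k, (0 < k <= m)%N -> phi k = psi k) -> gterm d b phi m = gterm d b psi m.
Proof.
move=> E; rewrite /gterm; case: ifP => // /andP[m0 dm]; rewrite E //.
have d0 := dvdn_gt0 m0 dm; rewrite divn_gt0 // (dvdn_leq m0 dm) /=.
exact: leq_div.
Qed.

Lemma gterm_commute d (b u : A) phi m : u * b = b * u ->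
  (forall k, u * phi k = phi k * u) -> u * gterm d b phi m = gterm d b phi m * u.
Proof.
move=> ub up; rewrite /gterm; case: ifP => _; last by rewrite mulr0 mul0r.
rewrite mulrnAr mulrnAl mulrA; congr (_ *+ _).
by rewrite (_ : u * b ^+ _ = b ^+ (m %/ d) * u) -?mulrA ?up //; apply: commrX.
Qed.

(** An entry t = (d, b, n) contributes sum_(k>0) (x^d b)^k phi(kn) / k, the exponent coming from one
    Witt factor. *)
Definition lser (phi : nat -> A) (L : seq (nat * A * nat)) : fps A :=
  fun m => m%:R^-1 *: \sum_(t <- L) gterm t.1.1 t.1.2 (fun k => phi (k * t.2)%N) m.

Lemma lser0 phi L : lser phi L 0%N = 0.
Proof. by rewrite /lser invr0 scale0r. Qed.

Lemma lser_commute phi L (u : A) m :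
  (forall t, t \in L -> u * t.1.2 = t.1.2 * u) ->
  (forall k, u * phi k = phi k * u) -> u * lser phi L m = lser phi L m * u.
Proof.
move=> uL up; rewrite /lser -scalerAl -scalerAr mulr_sumr mulr_suml.
congr (_ *: _); rewrite !big_seq; apply: eq_bigr => t tL.
by apply: gterm_commute => //; apply: uL.
Qed.

(** Replacing phi by its Witt expansion turns every entry of L into an integer combination of
    geometric sequences, by [gterm_geom]. *)
Lemma lser_int (I : A -> Prop) (phi : fps A) L q :
  subring I -> commuting I -> intseq I phi ->
  (forall t, t \in L -> [/\ (0 < t.1.1)%N, I t.1.2 & (0 < t.2)%N]) ->
  I (fexp (lser phi L) q).
Proof.
(* Up to x^q only phi(kn) with k <= q occurs; the sum of all n bounds each of them. *)
move=> sI cI ip LP; pose M := (q * \sum_(t <- L) t.2)%N.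
have trivI x : I x -> exists2 s : seq A, (forall y, y \in s -> I y) & x = \sum_(y <- s) y.
  by move=> Ix; exists [:: x]; rewrite ?big_seq1 // => y; rewrite inE => /eqP ->.
have [l lP lE] := @witt _ _ sI cI I phi (fun x Ix => Ix) trivI ip M.
pose D (t : nat * A * nat) (r : nat * A) := (t.1.1 * (r.1 %/ gcdn r.1 t.2))%N.
pose u (t : nat * A * nat) (r : nat * A) :=
  t.1.2 ^+ (r.1 %/ gcdn r.1 t.2) * r.2 ^+ (t.2 %/ gcdn r.1 t.2).
pose p : fps A := \sum_(t <- L) \sum_(r <- l) geom (D t r) (u t r) *~ (gcdn r.1 t.2).
have sp : intseq I p.
  rewrite /p big_seq; apply: intseq_sum => // t /LP[t0 It n0].
  rewrite big_seq; apply: intseq_sum => // r /lP[r0 Ir].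
  apply: intseqMz_geom => //.
    by rewrite muln_gt0 t0 divn_gt0 ?gcdn_gt0 ?r0 // dvdn_leq // dvdn_gcdl.
  by apply: subM => //; apply: subX.
rewrite (@fexp_agree _ _ (eulerV p)); first exact: intseq_fexp.
move=> i iq; rewrite /lser; congr (_ *: _); rewrite /p fps_sumE big_seq [RHS]big_seq.
apply: eq_bigr => t tL; have [t0 It n0] := LP _ tL.
rewrite (@eq_gterm _ _ _ (fun k => \sum_(r <- l) geom r.1 r.2 (k * t.2)%N)); last first.
  move=> k /andP[k0 ki]; rewrite lE // /M leq_mul //; first exact: leq_trans iq.
  by rewrite (big_rem t tL) leq_addr.
rewrite gterm_sum fps_sumE big_seq [RHS]big_seq; apply: eq_bigr => r /lP[r0 Ir].
by rewrite gterm_geom // ?fpsMzE -?pmulrn //; apply: cI.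
Qed.

(** Only equal modes k n = k' n' fail to commute. By [gterm_comm] each pair of entries then
    contributes 2h gcd(n, n') times a geometric sequence, so half of the commutator is [eulerV p]
    with p an integer combination of such sequences. *)
Lemma lser_comm (phi psi : nat -> A) (h : int) L L' :
  (forall k k', psi k * phi k' = phi k' * psi k + (if k == k' then (k%:R * (2 * h%:~R))%:A else 0)) ->
  (forall t k, t \in L \/ t \in L' -> t.1.2 * phi k = phi k * t.1.2) ->
  (forall t k, t \in L \/ t \in L' -> t.1.2 * psi k = psi k * t.1.2) ->
  (forall t t', t \in L -> t' \in L' -> t.1.2 * t'.1.2 = t'.1.2 * t.1.2) ->
  (forall t, t \in L \/ t \in L' -> (0 < t.1.1)%N /\ (0 < t.2)%N) ->
  exists p : fps A,
    lser psi L * lser phi L' = lser phi L' * lser psi L +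
      (eulerV p + eulerV p) /\
    (forall I, subring I -> commuting I -> (forall t, t \in L \/ t \in L' -> I t.1.2) -> intseq I p).
Proof.
move=> heis cphi cpsi cL LP.
pose D (t t' : nat * A * nat) := (t'.2 %/ gcdn t.2 t'.2 * t.1.1 + t.2 %/ gcdn t.2 t'.2 * t'.1.1)%N.
pose u (t t' : nat * A * nat) := t.1.2 ^+ (t'.2 %/ gcdn t.2 t'.2) * t'.1.2 ^+ (t.2 %/ gcdn t.2 t'.2).
pose p : fps A := \sum_(t <- L) \sum_(t' <- L') geom (D t t') (u t t') *~ ((gcdn t.2 t'.2)%:Z * h).
exists p; split; last first.
  move=> I sI cI LI; rewrite /p big_seq; apply: intseq_sum => // t tL.
  rewrite big_seq; apply: intseq_sum => // t' tL'.
  have [t0 n0] := LP t (or_introl tL); have [t0' n0'] := LP t' (or_intror tL').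
  apply: intseqMz_geom => //.
    rewrite addn_gt0 muln_gt0 t0 andbT divn_gt0 ?gcdn_gt0 ?n0 //.
    by rewrite dvdn_leq ?dvdn_gcdr.
  by apply: subM => //; apply: subX => //; apply: LI; [left|right].
apply/eqP; rewrite addrC -subr_eq; apply/eqP; apply: fpsP => q.
rewrite fpsBE fpsME fpsMrev -sumrB fpsDE.
transitivity (\sum_(t <- L) \sum_(t' <- L')
   (q%:R^-1 * (gcdn t.2 t'.2)%:R * (2 * h%:~R)) *: geom (D t t') (u t t') q); last first.
  rewrite -scalerDr /p fps_sumE -big_split scaler_sumr /=; apply: eq_bigr => t _.
  rewrite fps_sumE -big_split scaler_sumr /=; apply: eq_bigr => t' _.
  rewrite fpsMzE -scaler_int -scalerDl scalerA; congr (_ *: _).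
  by rewrite intrM -pmulrn; ring.
under eq_bigr => i _.
  rewrite /lser -!scalerAl -!scalerAr !scalerA [X in _ - X *: _]mulrC -scalerBr.
  rewrite mulr_suml mulr_sumr -sumrB scaler_sumr.
  under eq_bigr => t _ do rewrite mulr_sumr mulr_suml -sumrB scaler_sumr.
  over.
rewrite exchange_big /= !big_seq; apply: eq_bigr => t tL.
rewrite exchange_big /= !big_seq; apply: eq_bigr => t' tL'.
have [t0 n0] := LP t (or_introl tL); have [t0' n0'] := LP t' (or_intror tL').
rewrite -gterm_comm //; last exact: cL.
apply: eq_bigr => i _; congr (_ *: _); rewrite /gterm.
case: posnP => [_|i0] /=; first by rewrite mul0r mulr0 subrr.
case: (t.1.1 %| i)%N => /=; last by rewrite mul0r mulr0 subrr.
case: posnP => [_|i0'] /=; first by rewrite mul0r mulr0 subrr.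
case: (t'.1.1 %| q - i)%N => /=; last by rewrite mul0r mulr0 subrr.
set k := (i %/ _)%N; set k' := ((q - i) %/ _)%N.
rewrite !(mulrnAl, mulrnAr) -!mulrnA [(t.1.1 * _)%N]mulnC -mulrnBl.
set b := t.1.2; set b' := t'.1.2.
have b1 j : b' ^+ k' * phi j = phi j * b' ^+ k'.
  by apply: commr_sym; apply: commrX; symmetry; apply: cphi; right.
have b2 j : b' ^+ k' * psi j = psi j * b' ^+ k'.
  by apply: commr_sym; apply: commrX; symmetry; apply: cpsi; right.
have b3 j : b ^+ k * phi j = phi j * b ^+ k.
  by apply: commr_sym; apply: commrX; symmetry; apply: cphi; left.
have b4 : b ^+ k * b' ^+ k' = b' ^+ k' * b ^+ k.
  by apply: commrX; apply: commr_sym; apply: commrX; symmetry; apply: cL.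
rewrite mulrA -(mulrA (b ^+ k)) -b2 !mulrA -(mulrA (_ * _) (psi _)) heis mulrDr.
have -> : b' ^+ k' * phi (k' * t'.2)%N * b ^+ k * psi (k * t.2)%N =
          b ^+ k * b' ^+ k' * (phi (k' * t'.2)%N * psi (k * t.2)%N).
  by rewrite -(mulrA (b' ^+ k')) -b3 !mulrA b4.
rewrite addrC addKr; case: eqP => _; last by rewrite mulr0 mul0rn.
rewrite -scalerAr mulr1; congr (_ *: _ *+ _).
by rewrite -[RHS]mulr_natr natrM; ring.
Qed.

End Lift.

(** * Exponentials of residues for abstract Heisenberg operators *)

Section VertexExponential.
Variables (A : algType rat) (Int : A -> Prop) (al : int -> A) (h n0 : int).
Variable f : {poly {poly A}}.
Hypotheses (sInt : subring Int)
  (heis : forall i j, al i * al j =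
     al j * al i + (if i + j == 0 then ((- i)%:~R * (2 * h%:~R))%:A else 0))
  (ipos : exists2 g, newton (fun n => if n is 0 then 0 else al n%:Z) g & forall n, Int (g n))
  (ineg : exists2 g, newton (fun n => if n is 0 then 0 else al (- n%:Z)) g & forall n, Int (g n))
  (izero : exists2 g, newton (fun n => if n is 0 then 0 else al 0) g & forall n, Int (g n))
  (fI : forall l j, Int f`_l`_j)
  (fC : forall l j l' j', f`_l`_j * f`_l'`_j' = f`_l'`_j' * f`_l`_j)
  (fal : forall l j i, f`_l`_j * al i = al i * f`_l`_j).

(* For f = sum f_lj z^(n0 + l - j), this is Res_z al(z) f(z)^m when F = f^m,
   where al(z) = sum_i al i z^(i-1). *)
Definition theta N m (F : {poly {poly A}}) : A :=
  \sum_(l < N) \sum_(j < N) F`_l`_j * al (- (n0 * m%:Z + l%:Z - j%:Z)).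

(** Creation and annihilation operators do not commute with each other, so each group of terms of
    the exponent gets its own commutative ring [IG G], with the coefficients of f common to all. *)
Let G0 x := exists l j, x = f`_l`_j.
Let Gpos x := G0 x \/ exists m, x = al (Posz m.+1).
Let Gneg x := G0 x \/ exists m, x = al (- Posz m.+1).
Let Gzero x := G0 x \/ x = al 0.
Let IG G u := Int u /\ bicomm G u.
Let I0 := IG G0.

Let cG0 : commuting G0.
Proof. by move=> _ _ [l [j ->]] [l' [j' ->]]; apply: fC. Qed.

Let bal u i : bicomm G0 u -> u * al i = al i * u.
Proof. by move=> bu; symmetry; apply: bu => _ [l [j ->]]; symmetry; apply: fal. Qed.

Let cGpos : commuting Gpos.
Proof.
move=> x y [gx|[m ->]] [gy|[m' ->]].
- exact: cG0.
- by apply: bal; apply: bicomm_gen.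
- by symmetry; apply: bal; apply: bicomm_gen.
by rewrite heis (_ : _ == 0 = false) ?addr0 //; lia.
Qed.

Let cGneg : commuting Gneg.
Proof.
move=> x y [gx|[m ->]] [gy|[m' ->]].
- exact: cG0.
- by apply: bal; apply: bicomm_gen.
- by symmetry; apply: bal; apply: bicomm_gen.
by rewrite heis (_ : _ == 0 = false) ?addr0 //; lia.
Qed.

Let cGzero : commuting Gzero.
Proof.
move=> x y [gx|->] [gy|->] //; first exact: cG0.
  by apply: bal; apply: bicomm_gen.
by symmetry; apply: bal; apply: bicomm_gen.
Qed.

Let sI G : subring (IG G).
Proof. exact: subring_and (bicomm_subring G). Qed.

Let cI G : commuting G -> commuting (IG G).
Proof. by move=> cG x y [_ ?] [_ ?]; apply: (bicomm_commuting cG). Qed.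

Lemma theta_sum N m (T : eqType) (r : seq T) F :
  theta N m (\sum_(t <- r) F t) = \sum_(t <- r) theta N m (F t).
Proof.
rewrite /theta [RHS]exchange_big /=; apply: eq_bigr => l _.
rewrite [RHS]exchange_big /=; apply: eq_bigr => j _.
by rewrite !coef_sum mulr_suml.
Qed.

Lemma theta_monomial N m (c : A) i k : (i < N)%N -> (k < N)%N ->
  theta N m ((c *: 'X^k) *: 'X^i) = c * al (- (n0 * m%:Z + i%:Z - k%:Z)).
Proof.
move=> iN kN; rewrite /theta (bigD1 (Ordinal iN)) //= [X in _ + X]big1 ?addr0.
  rewrite (bigD1 (Ordinal kN)) //= [X in _ + X]big1 ?addr0.
    by rewrite !coefZ !coefXn !eqxx !mulr1 coefZ coefXn eqxx mulr1.
  move=> j; rewrite -val_eqE /= => /negPf ne.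
  by rewrite coefZ coefXn eqxx mulr1 coefZ coefXn ne mulr0 mul0r.
move=> l; rewrite -val_eqE /= => /negPf ne; apply: big1 => j _.
by rewrite coefZ coefXn ne mulr0 coef0 mul0r.
Qed.

(** The powers f^m form the sequence [geom 1 f], which is expanded in Witt coordinates that are
    monomials over I0. An entry (d, c, n) of L stands for the factor 1 / (1 - x^d c z^n). *)
Lemma theta_witt Q : exists L : seq (nat * A * int), exists N0,
  (forall t, t \in L -> (0 < t.1.1)%N /\ I0 t.1.2) /\
  (forall N m, (N0 <= N)%N -> (0 < m <= Q)%N -> theta N m (f ^+ m) =
     \sum_(t <- L) gterm t.1.1 t.1.2 (fun k => al (- (t.2 * k%:Z))) m).
Proof.
have trivI x : I0 x -> exists2 s : seq A, (forall y, y \in s -> I0 y) & x = \sum_(y <- s) y.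
  by move=> Ix; exists [:: x]; rewrite ?big_seq1 // => y; rewrite inE => /eqP ->.
have s1 := over_subring (sI G0); have s2 := over_subring s1.
have c2 := over_commuting (over_commuting (cI cG0)).
have gf : intseq (over (over I0)) (geom 1 f).
  apply: intseq_geom => // l j; split; first exact: fI.
  by apply: bicomm_gen; exists l, j.
have SI := monomial_over s1 (monomial_over (sI G0) (fun x Ix => Ix)).
have IS := monomial_gen (monomial_gen trivI).
have [l lP lE] := witt s2 c2 SI IS gf Q.
suff [L [N0 [LP LE]]] : exists L : seq (nat * A * int), exists N0,
  (forall t, t \in L -> (0 < t.1.1)%N /\ I0 t.1.2) /\
  (forall N m, (N0 <= N)%N -> (0 < m <= Q)%N ->
   \sum_(t <- l) theta N m (geom t.1 t.2 m) =
     \sum_(t <- L) gterm t.1.1 t.1.2 (fun k => al (- (t.2 * k%:Z))) m).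
  exists L, N0; split=> // N m NN mQ; rewrite -(LE N m) // -theta_sum.
  case/andP: mQ => m0 mQ; rewrite -lE // /geom m0 dvd1n divn1.
  by [].
elim: l lP {lE} => [|[d p] l IH] lP.
  by exists [::], 0%N; split=> // N m _ _; rewrite !big_nil.
have [t tl|L [N0 [LP LE]]] := IH; first by apply: lP; rewrite inE tl orbT.
have /= [d0 [_ [i [[c [k [Ic ->]]] ->]]]] := lP (d, p) (mem_head _ _).
(* As m = r d, the prefactor z^(n0 m) is the r-th power of z^(n0 d). The bound on N leaves room for
   the exponents of r-th powers, r <= Q. *)
exists ((d, c, n0 * d%:Z + i%:Z - k%:Z) :: L), (maxn N0 (maxn i k * Q).+1).
split=> [t|N m]; first by rewrite inE => /orP[/eqP ->//|/LP].
rewrite geq_max => /andP[NN NQ] mQ; rewrite !big_cons LE //; congr (_ + _).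
rewrite /= /gterm /geom; case/andP: mQ => m0 mQ; rewrite m0 /=.
case: ifP => [/dvdnP[r rE]|_]; last first.
  by rewrite /theta big1 // => ? _; rewrite big1 // => ? _; rewrite !coef0 mul0r.
rewrite rE mulnK // !monomialX.
have -> : (c ^+ r *: 'X^(k * r)) *: 'X^(i * r) *+ d =
          ((c ^+ r *+ d) *: 'X^(k * r)) *: 'X^(i * r) :> {poly {poly A}}.
  by rewrite -!scalerMnl.
have rQ : (r <= Q)%N by apply: leq_trans mQ; rewrite rE leq_pmulr.
have lt j : (j <= maxn i k)%N -> (j * r < N)%N.
  by move=> jm; apply: leq_trans NQ; rewrite ltnS leq_mul.
rewrite theta_monomial ?lt ?leq_maxl ?leq_maxr // mulrnAl; congr (_ * al _ *+ _).
lia.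
Qed.

Lemma vertex_exp_int Q : exists N0, forall N q, (N0 <= N)%N -> (q <= Q)%N ->
  Int (serexp (fun i => i%:R^-1 *: theta N i (f ^+ i)) q).
Proof.
have [L [N0 [LP LE]]] := theta_witt Q; exists N0 => N q NN qQ.
pose conv (t : nat * A * int) := (t.1, `|t.2|%N).
(* The residue pairs z^n with the mode -n, so negative powers of z go with the creation operators
   [ap] and positive ones with the annihilation operators [am]. *)
pose Lm := [seq conv t | t <- L & t.2 < 0].
pose Lp := [seq conv t | t <- L & 0 < t.2].
(* The mode 0 does not depend on k; the multiplier 1 stands in for n = 0 because [lser_int] asks for
   a positive one. *)
pose Lz := [seq (t.1, 1%N) | t <- L & t.2 == 0].
pose az : fps A := fun n => if n is 0 then 0 else al 0.
pose ap : fps A := fun n => if n is 0 then 0 else al n%:Z.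
pose am : fps A := fun n => if n is 0 then 0 else al (- n%:Z).
have memL (P : pred (nat * A * int)) t : t \in [seq conv t | t <- L & P t] ->
    exists2 t', P t' & [/\ t = conv t', (0 < t.1.1)%N & I0 t.1.2].
  case/mapP => t'; rewrite mem_filter => /andP[Pt /LP[? ?]] ->.
  by exists t'.
have LmP t : t \in Lm -> [/\ (0 < t.1.1)%N, I0 t.1.2 & (0 < t.2)%N].
  by case/memL => t' lt [-> ? ?]; split=> //; rewrite absz_gt0 lt_eqF.
have LpP t : t \in Lp -> [/\ (0 < t.1.1)%N, I0 t.1.2 & (0 < t.2)%N].
  by case/memL => t' lt [-> ? ?]; split=> //; rewrite absz_gt0 gt_eqF.
pose X := lser ap Lm; pose Y := lser am Lp; pose W := lser az Lz.
have XYE : serexp (fun i => i%:R^-1 *: theta N i (f ^+ i)) q = fexp (X + Y + W) q.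
  apply: serexpE; first by rewrite !fpsDE /X /Y /W !lser0 !addr0.
  move=> i /andP[i0 iq]; rewrite LE ?i0 ?(leq_trans iq) // !fpsDE /X /Y /W /lser -!scalerDr.
  congr (_ *: _); rewrite !big_map !big_filter.
  rewrite (big_mkcond (fun t : nat * A * int => t.2 < 0)).
  rewrite (big_mkcond (fun t : nat * A * int => 0 < t.2)).
  rewrite (big_mkcond (fun t : nat * A * int => t.2 == 0)) -!big_split /=.
  apply: eq_bigr => t _; case: (ltgtP t.2 0) => [lt|lt|->]; rewrite ?addr0 ?add0r.
  - apply: eq_gterm => k /andP[k0 _]; have E : t.2 = - `|t.2|%N%:Z by rewrite ltz0_abs ?opprK.
    rewrite [in RHS]E mulNr opprK.
    rewrite -PoszM [(_ * k)%N]mulnC /ap; have : (0 < k * `|t.2|)%N by rewrite muln_gt0 k0 absz_gt0 lt_eqF.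
    by case: (k * `|t.2|)%N.
  - apply: eq_gterm => k /andP[k0 _]; have E : t.2 = `|t.2|%N%:Z by rewrite gtz0_abs.
    rewrite [in RHS]E.
    rewrite -PoszM [(_ * k)%N]mulnC /am; have : (0 < k * `|t.2|)%N by rewrite muln_gt0 k0 absz_gt0 gt_eqF.
    by case: (k * `|t.2|)%N.
  by apply: eq_gterm => k /andP[k0 _]; rewrite mul0r oppr0 muln1; case: k k0.
have iX : forall i, Int (fexp X i).
  move=> i; have [g nw gI] := ipos.
  have [] // : IG Gpos (fexp X i).
  apply: (@lser_int A (IG Gpos) ap Lm i (sI Gpos) (cI cGpos)).
    exists g => // n; split=> //; apply: newton_bicomm nw _ n => -[|n].
      by apply: sub0; apply: bicomm_subring.
    by apply: bicomm_gen; right; exists n.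
  move=> t /LmP[? [? ?] ?]; split=> //; split=> //.
  by apply: bicomm_mono (_ : bicomm G0 _) => // ? ?; left.
have iY : forall i, Int (fexp Y i).
  move=> i; have [g nw gI] := ineg.
  have [] // : IG Gneg (fexp Y i).
  apply: (@lser_int A (IG Gneg) am Lp i (sI Gneg) (cI cGneg)).
    exists g => // n; split=> //; apply: newton_bicomm nw _ n => -[|n].
      by apply: sub0; apply: bicomm_subring.
    by apply: bicomm_gen; right; exists n.
  move=> t /LpP[? [? ?] ?]; split=> //; split=> //.
  by apply: bicomm_mono (_ : bicomm G0 _) => // ? ?; left.
have LzP t : t \in Lz -> [/\ (0 < t.1.1)%N, I0 t.1.2 & (0 < t.2)%N].
  by case/mapP => t'; rewrite mem_filter => /andP[_ /LP[? ?]] ->.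
have iW : forall i, Int (fexp W i).
  move=> i; have [g nw gI] := izero.
  have [] // : IG Gzero (fexp W i).
  apply: (@lser_int A (IG Gzero) az Lz i (sI Gzero) (cI cGzero)).
    exists g => // n; split=> //; apply: newton_bicomm nw _ n => -[|n].
      by apply: sub0; apply: bicomm_subring.
    by apply: bicomm_gen; right.
  move=> t /LzP[? [? ?] ?]; split=> //; split=> //.
  by apply: bicomm_mono (_ : bicomm G0 _) => // ? ?; left.
have cap u k : bicomm G0 u -> u * ap k = ap k * u.
  by case: k => [_|k]; [rewrite mulr0 mul0r | apply: bal].
have cam u k : bicomm G0 u -> u * am k = am k * u.
  by case: k => [_|k]; [rewrite mulr0 mul0r | apply: bal].
have LL t : t \in Lp \/ t \in Lm -> [/\ (0 < t.1.1)%N, I0 t.1.2 & (0 < t.2)%N].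
  by case; [apply: LpP | apply: LmP].
have cX u i : bicomm G0 u -> u * X i = X i * u.
  move=> bu; apply: lser_commute => [t /LmP[_ [_ bt] _]|k]; last exact: cap.
  exact: bicomm_commuting cG0 _ _ bu bt.
have cY u i : bicomm G0 u -> u * Y i = Y i * u.
  move=> bu; apply: lser_commute => [t /LpP[_ [_ bt] _]|k]; last exact: cam.
  exact: bicomm_commuting cG0 _ _ bu bt.
have [|t k /LL[_ [_ bt] _]|t k /LL[_ [_ bt] _]|t t' /LpP[_ [_ bt] _] /LmP[_ [_ bt'] _]|t /LL[]//|p [YX ip]] :=
  @lser_comm A ap am h Lp Lm.
- move=> [|k] [|k']; rewrite /ap /am; [by rewrite /= ?(mulr0, mul0r, mulr0n, scale0r, addr0) | by rewrite /= ?(mulr0, mul0r, mulr0n, scale0r, addr0) | by rewrite /= ?(mulr0, mul0r, mulr0n, scale0r, addr0) | ].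
  by rewrite heis eqSS opprK (_ : (_ == 0) = (k == k')) //; lia.
- exact: cap.
- exact: cam.
- exact: bicomm_commuting cG0 _ _ bt bt'.
have {}ip : intseq I0 p.
  by apply: ip (sI G0) (cI cG0) _ => t /LL[].
have bZ i : bicomm G0 (eulerV p i).
  by apply: bicommZ; have [] := intseq_in (sI G0) ip i.
have iZ i : Int (fexp (eulerV p) i).
  by have [] := intseq_fexp (sI G0) (cI cG0) ip i.
(* The zero modes commute with the two other groups and split off first; [fexp_bch] then separates
   creation from annihilation. *)
rewrite XYE fexpD; first last.
- apply: fps_comm => i j; apply: lser_commute => [t /LzP[_ [_ bt] _]|k].
    by rewrite fpsDE mulrDl mulrDr -cX // -cY.
  case: k => [|k]; first by rewrite mulr0 mul0r.
  have c0 z : al z * al 0 = al 0 * al z.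
    by rewrite heis; case: eqP => [zE|_]; rewrite ?addr0 // (_ : z = 0) ?oppr0 ?mul0r ?scale0r ?addr0 //; lia.
  rewrite fpsDE mulrDl mulrDr; congr (_ + _); symmetry; apply: lser_commute => [t tL|[|n]].
  - by symmetry; have [_ [_ bt] _] := LmP t tL; apply: bal.
  - by rewrite mulr0 mul0r.
  - by rewrite -c0.
  - by symmetry; have [_ [_ bt] _] := LpP t tL; apply: bal.
  - by rewrite mulr0 mul0r.
  by rewrite -c0.
- by rewrite /W lser0.
- by rewrite fpsDE /X /Y !lser0 addr0.
rewrite (fexp_bch _ _ _ YX) ?/X ?/Y ?lser0 //; first last.
- by apply: fps_comm => i j; apply: cY.
- by apply: fps_comm => i j; apply: cX.
- by rewrite /eulerV invr0 scale0r.
have iM (F G : fps A) : (forall i, Int (F i)) -> (forall i, Int (G i)) -> forall i, Int ((F * G) i).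
  by move=> iF iG i; rewrite fpsME; apply: sub_sum => // j _; apply: subM.
exact: (iM _ _ (iM _ _ (iM _ _ iX iY) iZ) iW).
Qed.

End VertexExponential.

(** * Linear endomorphisms *)

Section Endo.
Variable B : algType rat.

(** Bundling linearity makes operators on V (x) Q a Q-algebra, to which the abstract results on
    exponentials apply. *)
Record endo := Endo { efun :> B -> B; endo_lin : linear efun }.
HB.instance Definition _ := gen_eqMixin endo.
HB.instance Definition _ := gen_choiceMixin endo.
Implicit Types f g : endo.

Lemma endoP f g : f =1 g -> f = g.
Proof.
case: f g => f lf [g lg] /= /funext fg; rewrite fg in lf *.
by congr Endo; apply: Prop_irrelevance.
Qed.

Lemma endoD f u v : f (u + v) = f u + f v.
Proof. by have := endo_lin f 1 u v; rewrite !scale1r. Qed.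
Lemma endo_0 f : f 0 = 0.
Proof. by apply: (@addrI _ (f 0)); rewrite -endoD !addr0. Qed.
Lemma endoZ f a u : f (a *: u) = a *: f u.
Proof. by have := endo_lin f a u 0; rewrite endo_0 !addr0. Qed.
Lemma endo_sum f (T : Type) (r : seq T) (P : pred T) F :
  f (\sum_(i <- r | P i) F i) = \sum_(i <- r | P i) f (F i).
Proof. exact: (big_morph _ (endoD f) (endo_0 f)). Qed.

Lemma endoMnr f u n : f (u *+ n) = f u *+ n.
Proof. by rewrite -!scaler_nat endoZ. Qed.

Fact endo0_lin : linear (fun _ : B => 0 : B).
Proof. by move=> a u v; rewrite scaler0 addr0. Qed.
Fact endoN_lin f : linear (fun v : B => - f v).
Proof. by move=> a u v; rewrite endo_lin opprD scalerN. Qed.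
Fact endoD_lin f g : linear (fun v : B => f v + g v).
Proof. by move=> a u v; rewrite !endo_lin scalerDr addrACA. Qed.
Fact endoM_lin f g : linear (fun v : B => f (g v)).
Proof. by move=> a u v; rewrite !endo_lin. Qed.
Fact endo1_lin : linear (fun v : B => v).
Proof. by []. Qed.
Fact endoZ_lin a f : linear (fun v : B => a *: f v).
Proof. by move=> b u v; rewrite endo_lin scalerDr !scalerA mulrC. Qed.
Fact lmul_lin u : linear (fun v : B => u * v).
Proof. by move=> a v w; rewrite mulrDr scalerAr. Qed.

Definition endo0 := Endo endo0_lin.
Definition endo_opp f := Endo (endoN_lin f).
Definition endo_add f g := Endo (endoD_lin f g).
Definition endo_mul f g := Endo (endoM_lin f g).
Definition endo1 := Endo endo1_lin.
Definition endo_scale a f := Endo (endoZ_lin a f).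
Definition lmul u := Endo (lmul_lin u).

Fact endo_addA : associative endo_add.
Proof. by move=> f g h; apply: endoP => v; apply: addrA. Qed.
Fact endo_addC : commutative endo_add.
Proof. by move=> f g; apply: endoP => v; apply: addrC. Qed.
Fact endo_add0 : left_id endo0 endo_add.
Proof. by move=> f; apply: endoP => v; apply: add0r. Qed.
Fact endo_addN : left_inverse endo0 endo_opp endo_add.
Proof. by move=> f; apply: endoP => v; apply: addNr. Qed.
HB.instance Definition _ :=
  GRing.isZmodule.Build endo endo_addA endo_addC endo_add0 endo_addN.

Fact endo_mulA : associative endo_mul.
Proof. by move=> f g h; apply: endoP. Qed.
Fact endo_mul1 : left_id endo1 endo_mul.
Proof. by move=> f; apply: endoP. Qed.
Fact endo_1mul : right_id endo1 endo_mul.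
Proof. by move=> f; apply: endoP. Qed.
Fact endo_mulDl : left_distributive endo_mul +%R.
Proof. by move=> f g h; apply: endoP. Qed.
Fact endo_mulDr : right_distributive endo_mul +%R.
Proof. by move=> f g h; apply: endoP => v; apply: endoD. Qed.
Fact endo1_neq0 : endo1 != 0.
Proof.
apply/eqP => /(congr1 (fun f : endo => f 1)) /= /eqP.
by rewrite oner_eq0.
Qed.
HB.instance Definition _ := GRing.Zmodule_isNzRing.Build endo
  endo_mulA endo_mul1 endo_1mul endo_mulDl endo_mulDr endo1_neq0.

Fact endo_scaleA a b f : endo_scale a (endo_scale b f) = endo_scale (a * b) f.
Proof. by apply: endoP => v; apply: scalerA. Qed.
Fact endo_scale1 : left_id 1 endo_scale.
Proof. by move=> f; apply: endoP => v; apply: scale1r. Qed.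
Fact endo_scaleDr : right_distributive endo_scale +%R.
Proof. by move=> a f g; apply: endoP => v; apply: scalerDr. Qed.
Fact endo_scaleDl f : {morph endo_scale^~ f : a b / a + b}.
Proof. by move=> a b; apply: endoP => v; apply: scalerDl. Qed.
HB.instance Definition _ := GRing.Zmodule_isLmodule.Build rat endo
  endo_scaleA endo_scale1 endo_scaleDr endo_scaleDl.
Fact endo_scaleAl (a : rat) f g : a *: (f * g) = a *: f * g.
Proof. by apply: endoP. Qed.
HB.instance Definition _ := GRing.Lmodule_isLalgebra.Build rat endo endo_scaleAl.
Fact endo_scaleAr (a : rat) f g : a *: (f * g) = f * (a *: g).
Proof. by apply: endoP => v; rewrite [RHS]endoZ. Qed.
HB.instance Definition _ := GRing.Lalgebra_isAlgebra.Build rat endo endo_scaleAr.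

Lemma endoME f g v : (f * g) v = f (g v). Proof. by []. Qed.
Lemma endoDE f g v : (f + g) v = f v + g v. Proof. by []. Qed.
Lemma endoNE f v : (- f) v = - f v. Proof. by []. Qed.
Lemma endoBE f g v : (f - g) v = f v - g v. Proof. by []. Qed.
Lemma endoZE a f v : (a *: f) v = a *: f v. Proof. by []. Qed.
Lemma endo0E v : (0 : endo) v = 0. Proof. by []. Qed.
Lemma endo1E v : (1 : endo) v = v. Proof. by []. Qed.
Lemma endo_sumE (T : Type) (r : seq T) (P : pred T) (F : T -> endo) v :
  (\sum_(i <- r | P i) F i) v = \sum_(i <- r | P i) F i v.
Proof. by elim/big_rec2: _ => // i x y _ <-. Qed.
Lemma endoMnE f n v : (f *+ n) v = f v *+ n.
Proof. by elim: n => [|n IH]; rewrite ?mulr0n ?mulrS // endoDE IH. Qed.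

Lemma lmulE u v : lmul u v = u * v. Proof. by []. Qed.
Lemma lmul1 : lmul 1 = 1.
Proof. by apply: endoP => v; apply: mul1r. Qed.
Lemma lmulM u v : lmul (u * v) = lmul u * lmul v.
Proof. by apply: endoP => w; rewrite endoME !lmulE mulrA. Qed.
Lemma lmulD u v : lmul (u + v) = lmul u + lmul v.
Proof. by apply: endoP => w; rewrite endoDE !lmulE mulrDl. Qed.
Lemma lmul0 : lmul 0 = 0.
Proof. by apply: endoP => w; rewrite lmulE mul0r. Qed.
Lemma lmulZ a u : lmul (a *: u) = a *: lmul u.
Proof. by apply: endoP => w; rewrite endoZE !lmulE scalerAl. Qed.
Lemma lmul_sum (T : Type) (r : seq T) (P : pred T) F :
  lmul (\sum_(i <- r | P i) F i) = \sum_(i <- r | P i) lmul (F i).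
Proof. exact: (big_morph _ lmulD lmul0). Qed.
Lemma lmulMn u n : lmul (u *+ n) = lmul u *+ n.
Proof. by elim: n => [|n IH]; rewrite ?mulr0n ?lmul0 // !mulrS lmulD IH. Qed.
Lemma lmulX u n : lmul (u ^+ n) = lmul u ^+ n.
Proof. by elim: n => [|n IH]; rewrite ?expr0 ?lmul1 // !exprS lmulM IH. Qed.

Definition derivation f := forall u v, f (u * v) = f u * v + u * f v.

(** An exponential of derivations is multiplicative: as series of operators, G composed with
    multiplication by u and multiplication by G u composed with G solve the same equation. *)
Lemma hasse_schmidt (N G : fps endo) : N 0%N = 0 -> G 0%N = 1 ->
  euler G = N * G -> (forall n, derivation (N n)) ->
  forall n u v, G n (u * v) = \sum_(i < n.+1) G i u * G (n - i)%N v.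
Proof.
move=> N0 G0 EG dN n u v; pose H : fps endo := fun n => lmul (G n u).
have E : G * fpsC (lmul u) = H * G.
  apply: (@euler_uniq _ N) => //.
  - by rewrite !fpsM0 /H G0 mulr1 mul1r.
  - rewrite eulerM EG mulrA [X in _ + _ * X](_ : _ = 0) ?mulr0 ?addr0 //.
    by apply: fpsP => -[|k]; rewrite /euler ?mulr0n //= mul0rn.
  rewrite eulerM EG [RHS]mulrA [H * (N * G)]mulrA -mulrDl; congr (_ * _).
  apply: fpsP => k; rewrite fpsDE fpsMrev fpsME -[X in X + _](_ : lmul ((N * G) k u) = _).
    rewrite fpsME endo_sumE lmul_sum -big_split; apply: eq_bigr => i _.
    by apply: endoP => w; rewrite /H endoDE !endoME !lmulE dN.
  by rewrite -EG /euler /H endoMnE lmulMn.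
have := congr1 (fun F : fps endo => F n v) E.
by rewrite /= fpsM_C endoME lmulE => ->; rewrite fpsME endo_sumE.
Qed.

End Endo.

(** * The operators on V *)

Section Form.
Variable L : evenLattice.
Implicit Types a b c : vec L.

Lemma ipDl a b c : ip (a + b) c = ip a c + ip b c.
Proof. by rewrite /ip /gramform !mulmxDl !mxE. Qed.
Lemma ip0l a : ip 0 a = 0.
Proof. by rewrite /ip /gramform !mul0mx mxE. Qed.
Lemma ipC a b : ip a b = ip b a.
Proof. exact: gram_sym. Qed.
Lemma ipDr a b c : ip a (b + c) = ip a b + ip a c.
Proof. by rewrite ipC ipDl !(ipC _ a). Qed.
Lemma ip0r a : ip a 0 = 0.
Proof. by rewrite ipC ip0l. Qed.
Lemma ipMnl a b n : ip (a *+ n) b = ip a b *+ n.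
Proof. by elim: n => [|n IH]; rewrite ?mulr0n ?ip0l // !mulrS ipDl IH. Qed.
Lemma ip_sumr a : ip a =1 fun b => \sum_k b 0 k * ip a (basis k).
Proof.
move=> b; rewrite {1}(row_sum_delta b) (big_morph _ (ipDr a) (ip0r a)).
by apply: eq_bigr => k _; rewrite /ip /gramform linearZ -scalemxAr mxE.
Qed.

End Form.

(* An abstract V (x) Q: unfolding the monoid algebra VQ C is expensive. *)
Record model (L : evenLattice) (C : doubleCover L) := Model {
  carrier :> algType rat;
  bm : vec L -> cmonom (var L) -> carrier;
  der_op : (vec L -> carrier) -> (var L -> carrier) -> endo carrier;
  diag : (vec L -> rat) -> endo carrier;
  bm_mul : forall a m b m',
    bm a m * bm b m' = sgn (cocyc C a b) *: bm (a + b) (mulcm m m');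
  bm_id : bm 0 (onecm (var L)) = 1;
  bm_ext : forall f g : endo carrier,
    (forall b m, f (bm b m) = g (bm b m)) -> f = g;
  der_bm : forall de dx b m, der_op de dx (bm b m) = de b * bm b m +
    \sum_(i <- finsupp m) (m i)%:R *: (dx i * bm b (divcm m (ucm i)));
  diag_bm : forall phi b m, diag phi (bm b m) = phi b *: bm b m }.

Section ModelTheory.
Variables (L : evenLattice) (C : doubleCover L) (M : model C).
Implicit Types (u v w : M) (a b c : vec L) (i : var L) (m : cmonom (var L)).

Definition X i : M := bm M 0 (ucm i).
Definition E b : M := bm M b (onecm (var L)).

Definition central u := forall v, u * v = v * u.

Lemma centralD u v : central u -> central v -> central (u + v).
Proof. by move=> cu cv w; rewrite mulrDl mulrDr cu cv. Qed.
Lemma centralZ (x : rat) u : central u -> central (x *: u).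
Proof. by move=> cu w; rewrite -scalerAl cu scalerAr. Qed.
Lemma central0 : central 0.
Proof. by move=> w; rewrite mul0r mulr0. Qed.
Lemma central1 : central 1.
Proof. by move=> w; rewrite mul1r mulr1. Qed.
Lemma central_sum (I : Type) (r : seq I) (P : pred I) (F : I -> M) :
  (forall x, P x -> central (F x)) -> central (\sum_(x <- r | P x) F x).
Proof. by move=> cF; elim/big_ind: _ => //; [apply: central0 | apply: centralD]. Qed.
Lemma mulrCAc z u v : central z -> u * (z * v) = z * (u * v).
Proof. by move=> cz; rewrite mulrA -cz -mulrA. Qed.

Lemma X_mul i b m : X i * bm M b m = bm M b (mulcm (ucm i) m).
Proof. by rewrite bm_mul cocyc0l scale1r add0r. Qed.

Fact rmul_lin u : linear (fun v : M => v * u).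
Proof. by move=> x v w; rewrite mulrDl scalerAl. Qed.
Definition rmul u : endo M := Endo (rmul_lin u).
Lemma rmulE u v : rmul u v = v * u. Proof. by []. Qed.

Lemma X_central i : central (X i).
Proof.
move=> v; rewrite -lmulE -rmulE; congr (efun _ v); apply: bm_ext => b m.
by rewrite lmulE rmulE X_mul bm_mul cocyc0r scale1r addr0 mulcmC.
Qed.

Lemma E_mul a b : E a * E b = sgn (cocyc C a b) *: E (a + b).
Proof. by rewrite bm_mul mul0cm. Qed.

Lemma E0 : E 0 = 1. Proof. exact: bm_id. Qed.

Lemma cmonom_split m : m = onecm (var L) \/ exists i m', m = mulcm (ucm i) m'.
Proof.
case: (boolP (finsupp m == fset0)) => [/eqP s0|/fset0Pn [i im]].
  left; apply/eqP/cmP => i; rewrite onecmE; apply/eqP.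
  by rewrite -[m i == 0%N]negbK cmE_neq0 s0.
right; exists i, (divcm m (ucm i)); apply/eqP/cmP => j.
rewrite mulcmE divcmE ucmE; case: eqP => [<-|_] /=; last by rewrite add0n subn0.
by rewrite subnKC // lt0n cmE_neq0.
Qed.

(** Induction on the degree of a monomial. An identity of operators thereby becomes a check on the
    e_b and on one multiplication by a variable. *)
Lemma endo_ext (f g : endo M) : (forall b, f (E b) = g (E b)) ->
  (forall i u, f u = g u -> f (X i * u) = g (X i * u)) -> f = g.
Proof.
move=> fgE fgX; apply: bm_ext => b m.
move: {2}(mdeg m) (erefl (mdeg m)) => n; elim: n m => [|n IH] m mn.
  by have -> : m = onecm (var L); [apply: mdeg_eq0I | apply: fgE].
case: (cmonom_split m) => [->|[i [m' E']]]; first exact: fgE.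
rewrite E' -X_mul; apply: fgX; apply: IH.
have dM : mdeg (mulcm (ucm i) m') = (mdeg (ucm i) + mdeg m')%N := mdegM _ _.
by move: mn; rewrite E' dM mdegU => -[].
Qed.

Lemma diag_E phi b : diag M phi (E b) = phi b *: E b.
Proof. exact: diag_bm. Qed.

Lemma diag_X phi i u : diag M phi (X i * u) = X i * diag M phi u.
Proof.
rewrite -![X i * _]lmulE -!endoME; congr (efun _ u); apply: bm_ext => b m.
by rewrite !endoME !lmulE diag_bm X_mul diag_bm -scalerAr X_mul.
Qed.

Section Derivations.
Variables (de : vec L -> M) (dx : var L -> M).
Notation der := (der_op de dx).

Lemma der_E b : der (E b) = de b * E b.
Proof.
rewrite der_bm (_ : finsupp _ = fset0) ?big_seq_fset0 ?addr0 //.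
exact: mdom1.
Qed.

Hypotheses (dec : forall b, central (de b)) (dxc : forall i, central (dx i)).

(** The exponent of X_j in X_i m is that in m, plus 1 when j = i; the two parts of the resulting sum
    are the two terms of the product rule. *)
Lemma der_X i u : der (X i * u) = dx i * u + X i * der u.
Proof.
suff : der * lmul (X i) = lmul (dx i) + lmul (X i) * der.
  by move=> /(congr1 (fun f : endo M => f u)).
apply: bm_ext => b m; rewrite endoDE !endoME !lmulE X_mul !der_bm.
set mi := mulcm (ucm i) m.
have smi : (finsupp m `<=` finsupp mi)%fset.
  by rewrite (mdomD (ucm i) m) fsubsetUr.
have imi : i \in finsupp mi.
  by rewrite (mdomD (ucm i) m) mdomU !inE eqxx.
have -> : \sum_(j <- finsupp m) (m j)%:R *: (dx j * bm M b (divcm m (ucm j))) =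
   \sum_(j <- finsupp mi) (m j)%:R *: (dx j * bm M b (divcm m (ucm j))).
  apply: big_fset_incl => // j _; rewrite -cmE_neq0 negbK => /eqP ->.
  by rewrite scale0r.
rewrite mulrDr (mulrCAc _ _ (dec _)) X_mul -/mi addrCA; congr (_ + _).
have -> : \sum_(j <- finsupp mi) (mi j)%:R *: (dx j * bm M b (divcm mi (ucm j))) =
  \sum_(j <- finsupp mi) ((i == j)%:R *: (dx j * bm M b (divcm mi (ucm j)))) +
  \sum_(j <- finsupp mi) ((m j)%:R *: (dx j * bm M b (divcm mi (ucm j)))).
  rewrite -big_split; apply: eq_bigr => j _ /=.
  by rewrite /mi mulcmE ucmE natrD scalerDl.
congr (_ + _).
  rewrite (big_fsetD1 i) //= eqxx scale1r big1_fset ?addr0.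
    congr (_ * bm _ _ _); apply/eqP/cmP => j.
    by rewrite divcmE mulcmE addKn.
  by move=> j; rewrite !inE eq_sym => /andP[/negPf -> _] _; rewrite scale0r.
rewrite mulr_sumr; apply: eq_bigr => j _; rewrite -scalerAr (mulrCAc _ _ (dxc _)) X_mul.
case: (posnP (m j)) => [->|mj]; first by rewrite !scale0r.
congr (_ *: (_ * bm _ _ _)); apply/eqP/cmP => k.
rewrite mulcmE !divcmE mulcmE -addnBA //.
by rewrite ucmE; case: eqP => // <-.
Qed.

Hypothesis deD : forall a b, de (a + b) = de a + de b.

(** Additivity of [de] makes the rule compatible with e_a e_b being e_(a+b) up to sign; the
    variables are handled by [der_X]. *)
Lemma der_derivation : derivation der.
Proof.
move=> u v; suff : der * rmul v = rmul v * der + rmul (der v).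
  by move=> /(congr1 (fun f : endo M => f u)).
apply: endo_ext => [a|i {}u]; rewrite !endoDE !endoME !rmulE; last first.
  by move=> Hu; rewrite -mulrA !der_X Hu mulrDl mulrDr -!mulrA addrA.
suff : der * lmul (E a) = lmul (der (E a)) + lmul (E a) * der.
  by move=> /(congr1 (fun f : endo M => f v)).
apply: endo_ext => [b|i {}v]; rewrite !endoDE !endoME !lmulE.
  rewrite E_mul endoZ !der_E deD -!mulrA E_mul [E a * (de b * _)]mulrCAc // E_mul.
  by rewrite mulrDl scalerDr -!scalerAr.
move=> Hv; rewrite [E a * (X i * v)]mulrCAc; last exact: X_central.
rewrite !der_X Hv !mulrDr [E a * (dx i * v)]mulrCAc //.
rewrite [E a * (X i * _)]mulrCAc; last exact: X_central.
by rewrite [der _ * (X i * v)]mulrCAc 1?addrCA //; apply: X_central.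
Qed.

End Derivations.

Definition pos_m a j : M := \sum_k (a 0 k)%:~R *: X (j, k).

Lemma pos_central a j : central (pos_m a j).
Proof. by apply: central_sum => k _; apply: centralZ; apply: X_central. Qed.

Lemma posD a b j : pos_m (a + b) j = pos_m a j + pos_m b j.
Proof.
by rewrite /pos_m -big_split; apply: eq_bigr => k _; rewrite mxE intrD scalerDl.
Qed.

Lemma pos0 j : pos_m 0 j = 0.
Proof. by rewrite /pos_m big1 // => k _; rewrite mxE scale0r. Qed.

Lemma pos_basis k j : pos_m (basis k) j = X (j, k).
Proof.
rewrite /pos_m (bigD1 k) //= mxE !eqxx scale1r big1 ?addr0 // => l ne.
by rewrite mxE (negPf ne) andbF scale0r.
Qed.

Definition DE : endo M := der_op (fun b => pos_m b 0)
  (fun i => (i.1.+1)%:R *: pos_m (basis i.2) i.1.+1).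

Let Dx_central i : central ((i.1.+1)%:R *: pos_m (basis i.2) i.1.+1).
Proof. by apply: centralZ; apply: pos_central. Qed.

Lemma DE_derivation : derivation DE.
Proof.
apply: der_derivation => [b|i|a b]; first exact: pos_central.
  exact: Dx_central.
exact: posD.
Qed.

Lemma DE_E b : DE (E b) = pos_m b 0 * E b.
Proof. exact: der_E. Qed.

Lemma DE_1 : DE 1 = 0.
Proof. by rewrite -E0 DE_E pos0 mul0r. Qed.

Lemma DE_pos a j : DE (pos_m a j) = pos_m a j.+1 *+ j.+1.
Proof.
rewrite /pos_m endo_sum -sumrMnl; apply: eq_bigr => k _.
rewrite endoZ -[X (j, k)]mulr1 /DE der_X -/DE => [|b|i]; last 2 first.
- exact: pos_central.
- exact: Dx_central.
by rewrite DE_1 mulr0 addr0 mulr1 pos_basis /= scaler_nat scalerMnr.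
Qed.

Definition negx a j i : M := ((j.+1)%:R * (ip a (basis i.2))%:~R *+ (i.1 == j))%:A.

Lemma negx_central a j i : central (negx a j i).
Proof. by apply: centralZ; apply: central1. Qed.

Definition negE a j : endo M := der_op (fun=> 0) (negx a j).

Lemma negE_E a j b : negE a j (E b) = 0.
Proof. by rewrite der_E mul0r. Qed.

Lemma negE_derivation a j : derivation (negE a j).
Proof.
apply: der_derivation => [b|i|b c]; rewrite ?addr0 //; first exact: central0.
exact: negx_central.
Qed.

Lemma negE_X a j i u : negE a j (X i * u) = negx a j i * u + X i * negE a j u.
Proof. by apply: der_X => *; [apply: central0 | apply: negx_central]. Qed.

Lemma negE_1 a j : negE a j 1 = 0.
Proof. by rewrite -E0 negE_E. Qed.

Lemma negE_pos a j b k :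
  negE a j (pos_m b k) = ((j.+1)%:R * (ip a b)%:~R *+ (k == j))%:A.
Proof.
rewrite ip_sumr rmorph_sum mulr_sumr -sumrMnl scaler_suml.
rewrite /pos_m endo_sum; apply: eq_bigr => l _.
rewrite endoZ -[X _]mulr1 negE_X negE_1 mulr0 addr0 mulr1.
by rewrite /negx scalerA mulrnAr rmorphM /= mulrCA.
Qed.

Lemma negE_posM a j b k u : negE a j (pos_m b k * u) =
  ((j.+1)%:R * (ip a b)%:~R *+ (k == j)) *: u + pos_m b k * negE a j u.
Proof. by rewrite negE_derivation negE_pos -scalerAl mul1r. Qed.

Lemma negED a b j : negE (a + b) j = negE a j + negE b j.
Proof.
apply: endo_ext => [c|i u Hu]; first by rewrite endoDE !negE_E addr0.
rewrite endoDE !negE_X Hu endoDE mulrDr addrACA -mulrDl; congr (_ * _ + _).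
by rewrite /negx ipDl intrD mulrDr mulrnDl scalerDl.
Qed.

Lemma negE0 j : negE 0 j = 0.
Proof. by apply: (addrI (negE 0 j)); rewrite -negED !addr0. Qed.

Lemma negEN a j : negE (- a) j = - negE a j.
Proof. by apply/eqP; rewrite -addr_eq0 -negED addNr negE0. Qed.

Lemma negE_comm a (i : nat) b j : negE a i * negE b j = negE b j * negE a i.
Proof.
apply: endo_ext => [c|k u]; first by rewrite !endoME !negE_E !endo_0.
rewrite !endoME !negE_X !endoD !negE_X => ->.
by rewrite /negx -!scalerAl !mul1r !endoZ addrCA addrA.
Qed.

Lemma diag_negE phi a j : diag M phi * negE a j = negE a j * diag M phi.
Proof.
apply: endo_ext => [c|k u]; rewrite !endoME.
  by rewrite negE_E endo_0 diag_E endoZ negE_E scaler0.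
move=> H; rewrite negE_X endoD !diag_X negE_X H.
by rewrite /negx -!scalerAl !mul1r endoZ.
Qed.

End ModelTheory.

(** * The exponential factors of e^a(z) *)

Section ModelExp.
Variables (L : evenLattice) (C : doubleCover L) (M : model C).
Implicit Types (u v w : M) (a b c : vec L).

Definition pser a : fps M := fun n => if n is n'.+1 then pos_m M a n' else 0.
(** The creation factor of e^a(z). With the a(n) as power sums its coefficients h_n are complete
    symmetric functions, and [dE_E] identifies h_n e^a with the divided derivative of order n of
    e^a. *)
Definition hser a : fps M := fexp (eulerV (pser a)).
Definition nser a : fps (endo M) := fun n => if n is n'.+1 then - negE M a n' else 0.
(** The annihilation factor of e^a(z), as a series in 1/z; its minus sign is part of [nser]. *)
Definition gser a : fps (endo M) := fexp (eulerV (nser a)).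

Lemma nserS a n : nser a n.+1 = - negE M a n. Proof. by []. Qed.

Lemma pser_central a n : central (pser a n).
Proof. by case: n => [|n]; [apply: central0 | apply: pos_central]. Qed.

Lemma hser_newton a : newton (pser a) (hser a).
Proof. by apply: newton_fexp => // i j; apply: pser_central. Qed.

Lemma hser_central a n : central (hser a n).
Proof.
by move=> v; rewrite fexp_comm ?eulerV0 // => i; rewrite /eulerV -scalerAl -scalerAr pser_central.
Qed.

Lemma nser_comm a i b j : nser a i * nser b j = nser b j * nser a i.
Proof.
case: i j => [|i] [|j]; rewrite /= ?mulr0 ?mul0r //.
by rewrite !mulrNN negE_comm.
Qed.

Lemma gser_newton a : newton (nser a) (gser a).
Proof. by apply: newton_fexp => // i j; apply: nser_comm. Qed.

Lemma hserD a b : hser (a + b) = hser a * hser b.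
Proof.
have E : pser (a + b) = pser a + pser b.
  by apply: fpsP => -[|i]; rewrite fpsDE /= ?addr0 //; apply: posD.
rewrite /hser E; apply: fexp_eulerVD => [||i j]; [by []|by []|].
exact: pser_central.
Qed.

Lemma hser0 : hser 0 = 1.
Proof.
rewrite /hser (_ : eulerV _ = 0) ?fexp0 //; apply: fpsP => -[|i].
  by rewrite eulerV0.
by rewrite /eulerV /= pos0 scaler0.
Qed.

Lemma hserMn a n : hser (a *+ n) = hser a ^+ n.
Proof.
by elim: n => [|n IH]; [exact: hser0 | rewrite mulrS hserD IH exprS].
Qed.

Lemma gserD a b : gser (a + b) = gser a * gser b.
Proof.
have E : nser (a + b) = nser a + nser b.
  by apply: fpsP => -[|i]; rewrite fpsDE /= ?addr0 // negED opprD.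
rewrite /gser E; apply: fexp_eulerVD => [||i j]; [by []|by []|].
exact: nser_comm.
Qed.

Lemma gser0 : gser 0 = 1.
Proof.
rewrite /gser (_ : eulerV _ = 0) ?fexp0 //; apply: fpsP => -[|i].
  by rewrite eulerV0.
by rewrite /eulerV /= negE0 oppr0 scaler0.
Qed.

Lemma gserMn a n : gser (a *+ n) = gser a ^+ n.
Proof.
by elim: n => [|n IH]; [exact: gser0 | rewrite mulrS gserD IH exprS].
Qed.

Definition dE i : endo M := (i`!)%:R^-1 *: DE M ^+ i.

Lemma dE_dpow i : dE i = dpow (DE M) i. Proof. by []. Qed.

Lemma dE_leibniz n u v : dE n (u * v) = \sum_(i < n.+1) dE i u * dE (n - i)%N v.
Proof.
apply: (@hasse_schmidt _ (fmono 1 (DE M)) dE) => //.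
- exact: dpow0.
- apply: fpsP => k; rewrite fmonoM; case: k => [|k]; rewrite /euler ?mulr0n //.
  by rewrite /= subSS subn0 dE_dpow dpowS.
move=> k; rewrite /fmono; case: ifP => _; first exact: DE_derivation.
by move=> x y; rewrite !endo0E mul0r mulr0 addr0.
Qed.

Lemma dE_dE i j u : dE i (dE j u) = dE (i + j) u *+ 'C(i + j, i).
Proof.
rewrite -endoME -endoMnE; congr (efun _ u).
rewrite /dE -scalerAl -scalerAr scalerA -exprD scalerMnl; congr (_ *: _).
apply: (mulfI (_ : (i`! * j`!)%:R != 0 :> rat)).
  by rewrite pnatr_eq0 -lt0n muln_gt0 !fact_gt0.
have i0 : (i`!)%:R != 0 :> rat by rewrite pnatr_eq0 -lt0n fact_gt0.
have j0 : (j`!)%:R != 0 :> rat by rewrite pnatr_eq0 -lt0n fact_gt0.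
have ij0 : ((i + j)`!)%:R != 0 :> rat by rewrite pnatr_eq0 -lt0n fact_gt0.
have := bin_fact (leq_addr j i); rewrite addKn => /(congr1 (fun n => n%:R : rat)).
rewrite !natrM => E; transitivity (1 : rat); first by field; rewrite i0 j0.
by rewrite -[_^-1 *+ _]mulr_natr mulrCA [X in _ * X]mulrC E mulVf.
Qed.

(** The recursion behind [dE_E]. Let Q_n = b(n+1), so that (Q H)_n = (n+1) h_(n+1); the claim
    becomes D H = (Q - Q_0) H. Both sides satisfy x f' = (D P) H + P f, so their difference solves
    the homogeneous equation with initial value 0. *)
Lemma DE_hser b n : DE M (hser b n) + pos_m M b 0 * hser b n = hser b n.+1 *+ n.+1.
Proof.
have [_ h0 EH] := hser_newton b; set H := hser b in h0 EH *; set P := pser b in EH *.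
pose Q : fps M := pos_m M b.
have dH k : H k.+1 *+ k.+1 = (Q * H) k.
  rewrite -[LHS]/(euler H k.+1) EH fpsME big_ord_recl mul0r add0r fpsME.
  by apply: eq_bigr => i _; rewrite /= /bump /= subSS.
pose DH : fps M := fun k => DE M (H k).
pose K : fps M := (Q - fpsC (Q 0%N)) * H.
have cP (F : fps M) : F * P = P * F.
  by apply: fps_comm => i j; rewrite pser_central.
suff E : DH = K.
  by rewrite dH -[DE M _]/(DH n) E /K mulrBl fpsBE fpsC_M subrK.
apply/eqP; rewrite -subr_eq0; apply/eqP; apply: (@euler_uniq _ P) => //.
- rewrite fpsBE /K fpsM0 fpsBE subrr mul0r subr0 /DH h0.
  exact: DE_1.
- rewrite eulerD eulerN mulrBr.
  have EQ : euler (Q - fpsC (Q 0%N)) = (fun k => DE M (P k)) :> fps M.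
    apply: fpsP => -[|k]; rewrite /euler fpsBE /= ?subrr ?mul0rn ?endo_0 //.
    by rewrite subr0 DE_pos.
  have -> : euler K = ((fun k => DE M (P k)) : fps M) * H + P * K.
    by rewrite /K eulerM EQ EH !mulrA cP.
  have -> : euler DH = ((fun k => DE M (P k)) : fps M) * H + P * DH.
    apply: fpsP => k; rewrite /euler /DH -endoMnr -[H k *+ k]/(euler H k) EH.
    rewrite fpsDE !fpsME endo_sum -big_split; apply: eq_bigr => i _.
    exact: DE_derivation.
  by rewrite opprD addrACA subrr add0r.
by rewrite mulr0; apply: fpsP => k; rewrite /euler mul0rn.
Qed.

Lemma dE_E n b : dE n (E M b) = hser b n * E M b.
Proof.
have [_ h0 _] := hser_newton b.
elim: n => [|n IH]; first by rewrite dE_dpow dpow0 h0 mul1r.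
apply: (@mulrn_inj _ _ _ n.+1) => //; rewrite -mulrnAl -DE_hser -endoMnE.
rewrite dE_dpow dpowS endoME -dE_dpow IH DE_derivation DE_E mulrDl; congr (_ + _).
by rewrite mulrA; congr (_ * _); rewrite pos_central.
Qed.

(** The derivation a(-(j+1)) sends the exponent sum_n c(n) x^n / n to (a, c) x^(j+1), hence
    multiplies the exponential by that scalar series. The proof again compares two solutions of one
    equation. *)
Lemma negE_hser a j c l : negE M a j (hser c l) =
  if (j < l)%N then (ip a c)%:~R *: hser c (l - j.+1)%N else 0.
Proof.
have [p0 h0 EH] := hser_newton c; set H := hser c in h0 EH *; set P := pser c in p0 EH *.
pose NH : fps M := fun k => negE M a j (H k).
pose z : fps M := fmono j.+1 ((ip a c)%:~R)%:A.
have zE k : (z * H) k = if (j < k)%N then (ip a c)%:~R *: H (k - j.+1)%N else 0.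
  by rewrite fmonoM; case: ifP => // _; rewrite -scalerAl mul1r.
rewrite -zE; suff -> : z * H = NH by [].
apply/esym/eqP; rewrite -subr_eq0; apply/eqP; apply: (@euler_uniq _ P) => //.
- by rewrite fpsBE zE subr0 /NH h0; apply: negE_1.
- rewrite eulerD eulerN mulrBr.
  have cz : P * z = z * P by apply: fps_comm => i k; apply: pser_central.
  have -> : euler (z * H) = z *+ j.+1 * H + P * (z * H).
    by rewrite eulerM EH euler_fmono mulrA -cz -mulrA.
  have -> : euler NH = z *+ j.+1 * H + P * NH.
    apply: fpsP => k; rewrite /euler /NH -endoMnr -[H k *+ k]/(euler H k) EH.
    rewrite fpsDE !fpsME endo_sum -big_split; apply: eq_bigr => i _.
    rewrite negE_derivation; congr (_ * _ + _); rewrite fpsMnE /z /fmono.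
    case: (nat_of_ord i) => [|i']; first by rewrite p0 endo_0 mul0rn.
    rewrite /P /= negE_pos eqSS; case: eqP => _; last by rewrite mulr0n scale0r mul0rn.
    by rewrite mulr1n scalerMnl mulr_natl.
  by rewrite opprD addrACA subrr add0r.
by rewrite mulr0; apply: fpsP => k; rewrite /euler mul0rn.
Qed.

Lemma gser_E a n b : gser a n (E M b) = if n == 0%N then E M b else 0.
Proof.
have [p0 h0 EG] := gser_newton a; elim/ltn_ind: n => -[_|n IH]; first by rewrite h0.
apply: (@mulrn_inj _ _ _ n.+1) => //; rewrite mul0rn -endoMnE.
rewrite -[_ *+ n.+1]/(euler (gser a) n.+1) EG fpsME endo_sumE big1 // => i _.
rewrite endoME; case: (posnP i) => [->|i0]; first by rewrite p0.
rewrite IH; last by have := ltn_ord i; lia.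
case: ifP => _; last by rewrite endo_0.
by case: (nat_of_ord i) i0 => // k _; rewrite nserS endoNE negE_E oppr0.
Qed.

Lemma gser_derivation a n u v :
  gser a n (u * v) = \sum_(i < n.+1) gser a i u * gser a (n - i)%N v.
Proof.
have [p0 g0 EG] := gser_newton a; apply: (hasse_schmidt p0 g0 EG) => -[|k] x y.
  by rewrite !endo0E mul0r mulr0 addr0.
by rewrite nserS !endoNE negE_derivation opprD mulNr mulrN.
Qed.

(** By [negE_hser], exp(-sum_n a(-n) y^n / n) multiplies the series of c in x by (1 - xy)^(a, c). So
    kappa lists the coefficients of (1 - t)^(a, c), which are integers; this is why [gser] preserves
    V. *)
Lemma gser_hser a c : exists kappa : nat -> int, forall n l,
  gser a n (hser c l) = if (n <= l)%N then hser c (l - n)%N *~ kappa n else 0.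
Proof.
pose I (x : rat) := exists z : int, x = z%:~R.
have sI : subring I.
  split; first by exists 1.
    by move=> _ _ [x ->] [y ->]; exists (x - y); rewrite intrB.
  by move=> _ _ [x ->] [y ->]; exists (x * y); rewrite intrM.
have cI : commuting I by move=> x y _ _; apply: mulrC.
have := @intseqMz_geom _ _ sI cI 1 1 (- ip a c) isT (sub1 sI).
case=> h [q0 h0 Eh] /choice[kappa kE]; exists kappa.
have [p0 g0 EG] := gser_newton a.
have key n l : gser a n (hser c l) = h n *: (if (n <= l)%N then hser c (l - n)%N else 0).
  elim/ltn_ind: n => -[_|n IH]; first by rewrite g0 h0 scale1r subn0.
  apply: (@mulrn_inj _ _ _ n.+1) => //; rewrite -endoMnE scalerMnl.
  rewrite -[_ *+ n.+1]/(euler (gser a) n.+1) EG -[h _ *+ _]/(euler h n.+1) Eh.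
  rewrite !fpsME endo_sumE scaler_suml; apply: eq_bigr => i _; rewrite endoME.
  case: (posnP i) => [->|i0]; first by rewrite p0 q0 mul0r scale0r.
  rewrite IH; last by have := ltn_ord i; lia.
  case: (nat_of_ord i) i0 (ltn_ord i) => // k _ kn.
  rewrite endoZ fpsMzE /geom dvd1n divn1 expr1n subSS nserS endoNE /=.
  rewrite mulr1n mulrC -scalerA; congr (_ *: _).
  rewrite mulrNz scaleNr; congr (- _).
  case: (ltnP n l) => nl; last first.
    rewrite scaler0; case: ifP => nk; last by rewrite endo_0.
    by rewrite negE_hser (_ : (k < _)%N = false) //; lia.
  rewrite (_ : (n - k <= l)%N = true); last by lia.
  rewrite negE_hser (_ : (k < _)%N = true); last by lia.
  by congr (_ *: hser c _); lia.
move=> n l; rewrite key kE; case: ifP => _; last by rewrite scaler0.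
by rewrite scaler_int.
Qed.

Lemma lmul_hser a n : lmul (hser a n) = fexp (fun i => lmul (eulerV (pser a) i)) n.
Proof.
have lin_lmul : linear (@lmul M) by move=> x u v; rewrite lmulD lmulZ.
exact: (@fexp_morph _ _ (@lmul M) (eulerV (pser a)) n lin_lmul (lmul1 M) (@lmulM M)).
Qed.

Lemma comm_hser (f : endo M) a n :
  (forall j, f * lmul (pos_m M a j) = lmul (pos_m M a j) * f) ->
  f * lmul (hser a n) = lmul (hser a n) * f.
Proof.
move=> cf; rewrite lmul_hser; apply: fexp_comm => [|i]; first by rewrite eulerV0 lmul0.
rewrite /eulerV lmulZ -scalerAl -scalerAr; congr (_ *: _).
by case: i => [|i]; [rewrite /= lmul0 mulr0 mul0r | apply: cf].
Qed.

Lemma comm_gser (f : endo M) a n :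
  (forall j, f * negE M a j = negE M a j * f) -> f * gser a n = gser a n * f.
Proof.
move=> cf; apply: fexp_comm => [|i]; first by rewrite eulerV0.
rewrite /eulerV -scalerAl -scalerAr; congr (_ *: _).
by case: i => [|i]; [rewrite mulr0 mul0r | rewrite nserS mulrN mulNr cf].
Qed.

Lemma diag_pos phi a j : diag M phi * lmul (pos_m M a j) = lmul (pos_m M a j) * diag M phi.
Proof.
apply: endoP => u; rewrite !endoME !lmulE /pos_m !mulr_suml endo_sum.
by apply: eq_bigr => k _; rewrite -!scalerAl endoZ diag_X.
Qed.

Lemma diag_hser phi a n : diag M phi * lmul (hser a n) = lmul (hser a n) * diag M phi.
Proof. by apply: comm_hser => j; apply: diag_pos. Qed.

Lemma diag_gser phi a n : diag M phi * gser a n = gser a n * diag M phi.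
Proof. by apply: comm_gser => j; apply: diag_negE. Qed.

End ModelExp.

(** * A spanning set of V and operators that preserve V *)

Section IntegralForm.
Variables (L : evenLattice) (C : doubleCover L) (M : model C).
Implicit Types (u v w : M) (a b c : vec L).

Definition elt_m s a : M := sgn s *: E M a.

Inductive intV : M -> Prop :=
  | intV1 : intV 1
  | intVB u v : intV u -> intV v -> intV (u - v)
  | intVM u v : intV u -> intV v -> intV (u * v)
  | intV_elt s a : intV (elt_m s a)
  | intV_dE i u : intV u -> intV (dE M i u).

(** Products of coefficients h_l(c) with a lift of b, of total degree J. By [hmon_intV] and
    [intV_span] they span V over the integers, so integrality of an operator is checked on them. *)
Inductive hmon b : nat -> M -> Prop :=
  | hmon_elt s : hmon b 0 (elt_m s b)
  | hmon_h l c J u : hmon b J u -> hmon b (l + J) (hser M c l * u).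

Inductive hspan b J : M -> Prop :=
  | hspan0 : hspan b J 0
  | hspanD u v : hmon b J u -> hspan b J v -> hspan b J (u + v).

Inductive span : M -> Prop :=
  | span0 : span 0
  | spanD b J u v : hmon b J u -> span v -> span (u + v).

Lemma elt_mM s t a b :
  elt_m s a * elt_m t b = elt_m (s (+) t (+) cocyc C a b) (a + b).
Proof.
rewrite /elt_m -scalerAl -scalerAr E_mul !scalerA.
by rewrite /sgn !signr_addb.
Qed.

Lemma elt_mN s a : elt_m (~~ s) a = - elt_m s a.
Proof. by rewrite /elt_m /sgn signrN scaleNr. Qed.

Lemma elt_mV c : elt_m (cocyc C (- c) c) (- c) * elt_m false c = 1.
Proof.
by rewrite elt_mM addNr addbF addbb /elt_m /sgn expr0 scale1r E0.
Qed.

(** The sign selects the lift of -c inverse to e_c. Written this way, the coefficients of [hser] are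
    visibly in V. *)
Lemma hser_elt c l :
  hser M c l = elt_m (cocyc C (- c) c) (- c) * dE M l (elt_m false c).
Proof.
rewrite {2}/elt_m endoZ dE_E scalerAr -/(elt_m _ _) mulrCAc; last exact: hser_central.
by rewrite elt_mV mulr1.
Qed.

Lemma intV_0 : intV 0. Proof. by rewrite -(subrr 1); apply: intVB; apply: intV1. Qed.
Lemma intV_N u : intV u -> intV (- u).
Proof. by move=> iu; rewrite -sub0r; apply: intVB => //; apply: intV_0. Qed.
Lemma intV_D u v : intV u -> intV v -> intV (u + v).
Proof. by move=> iu iv; rewrite -[v]opprK; apply: intVB => //; apply: intV_N. Qed.

Lemma intV_hser c l : intV (hser M c l).
Proof. by rewrite hser_elt; apply: intVM; [|apply: intV_dE]; apply: intV_elt. Qed.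

Lemma hmon_intV b J u : hmon b J u -> intV u.
Proof.
elim=> [s|l c J' u' _ IH]; first exact: intV_elt.
by apply: intVM => //; apply: intV_hser.
Qed.

Lemma hspan_intV b J u : hspan b J u -> intV u.
Proof.
elim=> [|u' v' /hmon_intV iu _ iv]; first exact: intV_0.
exact: intV_D.
Qed.

Lemma hmonN b J u : hmon b J u -> hmon b J (- u).
Proof.
elim=> [s|l c J' u' _ IH]; first by rewrite -elt_mN; apply: hmon_elt.
by rewrite -mulrN; apply: hmon_h.
Qed.

Lemma hspan_mon b J u : hmon b J u -> hspan b J u.
Proof. by move=> mu; rewrite -[u]addr0; apply: hspanD => //; apply: hspan0. Qed.
Lemma hspan_D b J u v : hspan b J u -> hspan b J v -> hspan b J (u + v).
Proof.
move=> su sv; elim: su => [|u' v' mu _ IH]; first by rewrite add0r.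
by rewrite -addrA; apply: hspanD.
Qed.
Lemma hspan_N b J u : hspan b J u -> hspan b J (- u).
Proof.
elim=> [|u' v' mu _ IH]; first by rewrite oppr0; apply: hspan0.
by rewrite opprD; apply: hspanD => //; apply: hmonN.
Qed.
Lemma hspan_Mz b J u (z : int) : hspan b J u -> hspan b J (u *~ z).
Proof.
move=> su; have gen n : hspan b J (u *+ n).
  by elim: n => [|n IH]; rewrite ?mulr0n ?mulrS; [apply: hspan0 | apply: hspan_D].
by case: z => n; rewrite ?NegzE ?mulrNz -pmulrn; [|apply: hspan_N].
Qed.
Lemma hspan_h b J l c u : hspan b J u -> hspan b (l + J) (hser M c l * u).
Proof.
elim=> [|u' v' mu _ IH]; first by rewrite mulr0; apply: hspan0.
by rewrite mulrDr; apply: hspanD => //; apply: hmon_h.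
Qed.
Lemma hspan_sum b J (T : Type) (r : seq T) (P : pred T) F :
  (forall i, P i -> hspan b J (F i)) -> hspan b J (\sum_(i <- r | P i) F i).
Proof. by move=> sF; elim/big_ind: _ => //; [apply: hspan0 | apply: hspan_D]. Qed.

Lemma span_mon b J u : hmon b J u -> span u.
Proof. by move=> mu; rewrite -[u]addr0; apply: (spanD mu); apply: span0. Qed.
Lemma span_D u v : span u -> span v -> span (u + v).
Proof.
move=> su sv; elim: su => [|b J u' v' mu _ IH]; first by rewrite add0r.
by rewrite -addrA; apply: (spanD mu).
Qed.
Lemma span_N u : span u -> span (- u).
Proof.
elim=> [|b J u' v' mu _ IH]; first by rewrite oppr0; apply: span0.
by rewrite opprD; apply: (spanD (hmonN mu)).
Qed.
Lemma span_Mn u n : span u -> span (u *+ n).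
Proof.
by move=> su; elim: n => [|n IH]; rewrite ?mulr0n ?mulrS; [apply: span0 | apply: span_D].
Qed.
Lemma span_sum (T : Type) (r : seq T) (P : pred T) F :
  (forall i, P i -> span (F i)) -> span (\sum_(i <- r | P i) F i).
Proof. by move=> sF; elim/big_ind: _ => //; [apply: span0 | apply: span_D]. Qed.

Lemma hmonM b J u b' J' u' : hmon b J u -> hmon b' J' u' ->
  hmon (b + b') (J + J') (u * u').
Proof.
move=> mu mu'; elim: mu => [s|l c K v _ IH]; last first.
  by rewrite -mulrA -addnA; apply: hmon_h.
elim: mu' => [t|l c K v _ IH]; first by rewrite elt_mM; apply: hmon_elt.
by rewrite mulrCAc ?add0n; [apply: hmon_h; move: IH; rewrite add0n | apply: hser_central].
Qed.

Lemma spanM u v : span u -> span v -> span (u * v).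
Proof.
move=> su sv; elim: su => [|b J u' v' mu _ IH]; first by rewrite mul0r; apply: span0.
rewrite mulrDl; apply: span_D => //; elim: sv => [|b' J' u'' v'' mu' _ IH'].
  by rewrite mulr0; apply: span0.
by rewrite mulrDr; apply: span_D => //; apply: span_mon (hmonM mu mu').
Qed.

Lemma span_hser_elt c l s b : span (hser M c l * elt_m s b).
Proof. exact: span_mon (hmon_h _ _ (hmon_elt _ _)). Qed.

Lemma dE_elt s b n : dE M n (elt_m s b) = hser M b n * elt_m s b.
Proof. by rewrite /elt_m endoZ dE_E scalerAr. Qed.

Lemma span_dE_elt s b n i : span (dE M i (dE M n (elt_m s b))).
Proof. by rewrite dE_dE dE_elt; apply: span_Mn; apply: span_hser_elt. Qed.

(** By the Leibniz rule only the factors h_l(c) matter. They are products of e^(-c) and a divided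
    derivative of e^c, and a composite of divided derivatives is an integer multiple of one. *)
Lemma span_dE i u : span u -> span (dE M i u).
Proof.
elim=> [|b J u' v' mu _ IH]; first by rewrite endo_0; apply: span0.
rewrite endoD; apply: span_D => // {IH v'}.
elim: mu i => [s|l c K v _ IH] i; first by rewrite dE_elt; apply: span_hser_elt.
rewrite dE_leibniz; apply: span_sum => j _; apply: spanM => //.
rewrite hser_elt dE_leibniz; apply: span_sum => k _; apply: spanM.
  by rewrite dE_elt; apply: span_hser_elt.
exact: span_dE_elt.
Qed.

Lemma intV_span u : intV u -> span u.
Proof.
elim=> [|u' v' _ su _ sv|u' v' _ su _ sv|s a|i u' _ su].
- have -> : 1 = elt_m false 0 by rewrite /elt_m /sgn expr0 scale1r E0.
  exact: span_mon (hmon_elt _ _).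
- by apply: span_D => //; apply: span_N.
- exact: spanM.
- exact: span_mon (hmon_elt _ _).
exact: span_dE.
Qed.

Definition int_endo (f : endo M) := forall u, intV u -> intV (f u).

Lemma int_endo_subring : subring int_endo.
Proof.
split=> [u //|f g If Ig u iu|f g If Ig u iu].
  by rewrite endoBE; apply: intVB; [apply: If | apply: Ig].
by rewrite endoME; apply: If; apply: Ig.
Qed.

Lemma int_endo_mon (f : endo M) :
  (forall b J u, hmon b J u -> intV (f u)) -> int_endo f.
Proof.
move=> If u /intV_span; elim=> [|b J v w mv _ IH]; first by rewrite endo_0; apply: intV_0.
by rewrite endoD; apply: intV_D => //; apply: If mv.
Qed.

Lemma int_endo_lmul u : intV u -> int_endo (lmul u).
Proof. by move=> iu v iv; apply: intVM. Qed.

(** Besides integrality this keeps the degree: such an operator kills everything of degree below j,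
    which is the source of all bounds on annihilation operators. *)
Definition lowers j (f : endo M) := forall b J u, hspan b J u ->
  ((j <= J)%N -> hspan b (J - j) (f u)) /\ ((J < j)%N -> f u = 0).

Lemma lowers_mon j (f : endo M) : (forall b J u, hmon b J u ->
  ((j <= J)%N -> hspan b (J - j) (f u)) /\ ((J < j)%N -> f u = 0)) -> lowers j f.
Proof.
move=> If b J u; elim=> [|v w mv _ [IH1 IH2]].
  by rewrite endo_0; split=> // _; apply: hspan0.
have [H1 H2] := If _ _ _ mv; rewrite endoD; split=> le.
  by apply: hspan_D; [apply: H1 | apply: IH1].
by rewrite H2 // IH2 // addr0.
Qed.

Lemma lowers0 j : lowers j 0.
Proof. by move=> b J u _; rewrite endo0E; split=> // _; apply: hspan0. Qed.

Lemma lowers1 : lowers 0 1.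
Proof. by move=> b J u su; rewrite endo1E subn0; split. Qed.

Lemma lowersD j f g : lowers j f -> lowers j g -> lowers j (f + g).
Proof.
move=> lf lg b J u su; have [f1 f2] := lf _ _ _ su; have [g1 g2] := lg _ _ _ su.
rewrite endoDE; split=> le; first by apply: hspan_D; [apply: f1 | apply: g1].
by rewrite f2 // g2 // addr0.
Qed.

Lemma lowersM i j f g : lowers i f -> lowers j g -> lowers (i + j) (f * g).
Proof.
move=> lf lg b J u su; have [g1 g2] := lg _ _ _ su; rewrite endoME.
case: (leqP j J) => jJ; last by rewrite g2 // endo_0; split=> // _; apply: hspan0.
have [f1 f2] := lf _ _ _ (g1 jJ); split=> le.
  by rewrite (_ : J - (i + j) = J - j - i)%N; [apply: f1; lia | lia].
by apply: f2; lia.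
Qed.

Lemma lowers_sum j (T : Type) (r : seq T) (P : pred T) F :
  (forall i, P i -> lowers j (F i)) -> lowers j (\sum_(i <- r | P i) F i).
Proof. by move=> sF; elim/big_ind: _ => //; [apply: lowers0 | apply: lowersD]. Qed.

Lemma gser_lowers a n : lowers n (gser M a n).
Proof.
apply: lowers_mon => b J u mu; elim: mu n => [s|l c K v mv IH] n.
  rewrite /elt_m endoZ gser_E; case: n => [|n]; split=> //=.
    by move=> _; apply: hspan_mon; apply: hmon_elt.
  by move=> _; rewrite scaler0.
have [kappa kE] := gser_hser M a c; rewrite gser_derivation; split=> le.
  apply: hspan_sum => i _; rewrite kE; case: ifP => il; last by rewrite mul0r; apply: hspan0.
  rewrite mulrzAl; apply: hspan_Mz; have [H1 H2] := IH (n - i)%N.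
  case: (leqP (n - i) K) => nK; last by rewrite H2 // mulr0; apply: hspan0.
  rewrite (_ : l + K - n = (l - i) + (K - (n - i)))%N; last by have := ltn_ord i; lia.
  by apply: hspan_h; apply: H1.
apply: big1 => i _; rewrite kE; case: ifP => il; last by rewrite mul0r.
by have [_ ->] := IH (n - i)%N; rewrite ?mulr0 //; lia.
Qed.

Lemma negE_lowers a j : lowers j.+1 (negE M a j).
Proof.
apply: lowers_mon => b J u mu; elim: mu => [s|l c K v mv [IH1 IH2]].
  by rewrite /elt_m endoZ negE_E scaler0; split=> // _; apply: hspan0.
rewrite negE_derivation negE_hser; split=> le; last first.
  have jl : (j < l)%N = false by lia.
  by rewrite jl mul0r add0r IH2; [rewrite mulr0 | lia].
apply: hspan_D.
  case: ifP => jl; last by rewrite mul0r; apply: hspan0.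
  rewrite scaler_int mulrzAl; apply: hspan_Mz.
  rewrite (_ : l + K - j.+1 = (l - j.+1) + K)%N; last by lia.
  by apply: hspan_h; apply: hspan_mon.
case: (leqP j.+1 K) => jK; last by rewrite IH2 // mulr0; apply: hspan0.
rewrite (_ : l + K - j.+1 = l + (K - j.+1))%N; last by lia.
by apply: hspan_h; apply: IH1.
Qed.

Lemma gser_int a n : int_endo (gser M a n).
Proof.
apply: int_endo_mon => b J u /hspan_mon su; have [H1 H2] := gser_lowers a n su.
case: (leqP n J) => nJ; last by rewrite H2 //; apply: intV_0.
exact: hspan_intV (H1 nJ).
Qed.

Lemma diag_mon phi b J u : hmon b J u -> diag M phi u = phi b *: u.
Proof.
elim=> [s|l c K v _ IH]; first by rewrite /elt_m endoZ diag_E !scalerA mulrC.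
rewrite -lmulE -endoME diag_hser endoME IH lmulE -scalerAr.
by [].
Qed.

End IntegralForm.

(** * Finitely supported sums over the integers *)

Section FiniteSums.
Variable V : zmodType.

Lemma fsum_inj (F : int -> V) (phi : nat -> int) n : injective phi ->
  (forall i, (forall m, (m < n)%N -> i <> phi m) -> F i = 0) ->
  \sum_(i \in [set: int]) F i = \sum_(m < n) F (phi m).
Proof.
move=> iphi F0; rewrite (@fsbigE _ _ _ _ _ (map phi (iota 0 n))) //.
- rewrite big_map -(big_mkord xpredT (fun m => F (phi m))) /index_iota subn0.
  by apply: eq_bigl => i; rewrite in_setT.
- by rewrite map_inj_uniq // iota_uniq.
move=> i _ /negP ni; apply: F0 => m mn E; apply: ni; rewrite E.
by apply: map_f; rewrite mem_iota.
Qed.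

(** Passes from a sum over powers of z in the window [-B, B) to a sum over the index of [hser]; B
    must be large enough for the window to contain the support. *)
Lemma sum_shift (S : nat -> V) (c : int) B n :
  (forall l, (n <= l)%N -> S l = 0) -> (`|c| + n <= B)%N ->
  \sum_(k < B + B) (let p := k%:Z - B%:Z + c in if 0 <= p then S `|p|%N else 0)
    = \sum_(l < n) S l.
Proof.
move=> S0 cB; pose d := `|B%:Z - c|%N; have dE : d%:Z = B%:Z - c by lia.
have -> : (B + B = d + (n + (B + B - d - n)))%N by lia.
rewrite big_split_ord /= big1 ?add0r; last first.
  by move=> k _; rewrite /= ifF //; have := ltn_ord k; lia.
rewrite big_split_ord /= [X in _ + X]big1 ?addr0; last first.
  by move=> k _; case: ifP => // _; apply: S0; lia.
by apply: eq_bigr => l _; rewrite ifT; [congr S; lia | lia].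
Qed.

(** Joins the two halves of a normally ordered product into one sum. *)
Lemma sum_fold (S : int -> V) B :
  \sum_(m < B) S (- m.+1%:Z) + \sum_(m < B) S m%:Z = \sum_(k < B + B) S (k%:Z - B%:Z).
Proof.
rewrite big_split_ord /=; congr (_ + _); last first.
  by apply: eq_bigr => m _; congr S; lia.
rewrite (reindex_inj rev_ord_inj) /=; apply: eq_bigr => m _; congr S.
by have := ltn_ord m; lia.
Qed.

End FiniteSums.

(** * Fields on the model *)

Section ModelFields.
Variables (L : evenLattice) (C : doubleCover L) (M : model C).
Implicit Types (u v w : M) (a b c : vec L).

(* The fields of Defs over a model, with opexp expressed by hser and gser. *)
Definition mfield := int -> M -> M.

Definition mcomp (f g : mfield) : mfield :=
  fun N v => \sum_(i \in [set: int]) f (N - i) (g i v).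

Definition mo a (j : int) : endo M :=
  match j with
  | Posz 0 => diag M (fun b => (ip a b)%:~R)
  | Posz j'.+1 => lmul (pos_m M a j')
  | Negz j' => negE M a j'
  end.

Definition mcreat a : mfield := fun N v => if 0 <= N then mo a (N + 1) v else 0.
Definition mannih a : mfield := fun N v => if N < 0 then mo a (N + 1) v else 0.
Definition mexpcreat a : mfield := fun N v => if 0 <= N then hser M a `|N|%N * v else 0.
Definition mexpannih a : mfield := fun N v => if N <= 0 then gser M a `|N|%N v else 0.
Definition zproj a (N : int) : endo M := diag M (fun b => (ip a b == N)%:R).
Definition mYexp a : mfield := fun N v =>
  elt_m M false a * mcomp (fun n => zproj a n) (mcomp (mexpcreat a) (mexpannih a)) N v.
Definition mnormord k (f : mfield) : mfield := fun N v =>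
  mcomp (mcreat (basis k)) f N v + mcomp f (mannih (basis k)) N v.

Lemma diagM phi psi : diag M phi * diag M psi = diag M (fun b => phi b * psi b).
Proof.
apply: bm_ext => b m; rewrite endoME !diag_bm endoZ diag_bm scalerA.
by rewrite mulrC.
Qed.

Lemma eq_diag phi psi : phi =1 psi -> diag M phi = diag M psi.
Proof. by move=> /funext ->. Qed.

Lemma diag_lmul_elt phi s a : (forall b, phi (a + b) = phi b) ->
  diag M phi * lmul (elt_m M s a) = lmul (elt_m M s a) * diag M phi.
Proof.
move=> pa; apply: endo_ext => [b|i u]; rewrite !endoME !lmulE.
  by rewrite diag_E -scalerAr /elt_m -!scalerAl E_mul !endoZ diag_E pa !scalerA; congr (_ *: _); ring.
move=> H; rewrite mulrCAc; last exact: X_central.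
rewrite !diag_X H [RHS]mulrCAc //.
exact: X_central.
Qed.

Lemma negE_lmul_elt a j s c :
  negE M a j * lmul (elt_m M s c) = lmul (elt_m M s c) * negE M a j.
Proof.
apply: endoP => u; rewrite !endoME !lmulE negE_derivation /elt_m endoZ negE_E.
by rewrite scaler0 mul0r add0r.
Qed.

Lemma negE_lmul_pos a j c k : negE M a j * lmul (pos_m M c k) =
  lmul (pos_m M c k) * negE M a j + ((j.+1)%:R * (ip a c)%:~R *+ (k == j))%:A.
Proof.
by apply: endoP => u; rewrite endoDE !endoME !lmulE negE_posM addrC.
Qed.

Lemma mo_linear (c : 'I_(rk L) -> vec L) (x : 'I_(rk L) -> int) a j :
  (forall b, ip a b = \sum_k x k * ip (c k) b) ->
  (forall n, pos_m M a n = \sum_k (x k)%:~R *: pos_m M (c k) n) ->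
  mo a j = \sum_k (x k)%:~R *: mo (c k) j.
Proof.
move=> ipa posa; case: j => [[|j]|j] /=.
- apply: bm_ext => b m; rewrite endo_sumE diag_bm ipa rmorph_sum scaler_suml.
  by apply: eq_bigr => k _; rewrite endoZE diag_bm scalerA rmorphM.
- by rewrite posa lmul_sum; apply: eq_bigr => k _; rewrite lmulZ.
apply: endo_ext => [b|i u Hu]; rewrite endo_sumE.
  by rewrite negE_E big1 // => k _; rewrite endoZE negE_E scaler0.
rewrite negE_X Hu endo_sumE mulr_sumr.
under [RHS]eq_bigr => k _ do rewrite endoZE negE_X scalerDr.
rewrite big_split /=; congr (_ + _); last first.
  by apply: eq_bigr => k _; rewrite scalerAr.
under [RHS]eq_bigr => k _ do rewrite scalerAl.
rewrite -mulr_suml; congr (_ * _); rewrite /negx ipa rmorph_sum mulr_sumr -sumrMnl.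
rewrite scaler_suml; apply: eq_bigr => k _.
by rewrite scalerA mulrnAr rmorphM /= mulrCA.
Qed.

Lemma mo_basis a j : mo a j = \sum_k (a 0 k)%:~R *: mo (basis k) j.
Proof.
apply: mo_linear => [b|n]; last first.
  by rewrite /pos_m; apply: eq_bigr => k _; rewrite -[in RHS]/(pos_m M _ _) pos_basis.
rewrite ipC ip_sumr; apply: eq_bigr => k _; by rewrite ipC.
Qed.

End ModelFields.

(** * The field of e^gamma *)

Section Dynamics.
Variables (L : evenLattice) (C : doubleCover L) (M : model C).
Variables (alpha gamma : vec L) (s : bool).
Hypotheses (gg : ip gamma gamma = 0) (ag : ip alpha gamma = 0).
Implicit Types (u v w : M) (a b c : vec L).

Notation al := (mo M alpha).
Definition egamma : endo M := lmul (elt_m M s gamma).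

Lemma mul_negE_pos a j c k : ip a c = 0 ->
  negE M a j * lmul (pos_m M c k) = lmul (pos_m M c k) * negE M a j.
Proof. by move=> ac; rewrite negE_lmul_pos ac mulr0 mul0rn scale0r addr0. Qed.

Lemma mul_gser_pos a j c k : ip a c = 0 ->
  gser M a j * lmul (pos_m M c k) = lmul (pos_m M c k) * gser M a j.
Proof. by move=> ac; symmetry; apply: comm_gser => i; rewrite mul_negE_pos. Qed.

(** The components of the fields of the e^(i gamma). The condition on phi makes [diag] commute with
    e^gamma; it holds for the projections by (gamma, b) and for alpha(0), as gamma is orthogonal to
    gamma and to alpha. *)
Inductive gamma_op : endo M -> Prop :=
  | gop_h i n : gamma_op (lmul (hser M (gamma *+ i) n))
  | gop_g i n : gamma_op (gser M (gamma *+ i) n)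
  | gop_d phi : (forall b, phi (gamma + b) = phi b) -> gamma_op (diag M phi)
  | gop_e : gamma_op egamma.

Lemma ipMg b i : ip b gamma = 0 -> ip b (gamma *+ i) = 0.
Proof. by move=> bg; rewrite ipC ipMnl ipC bg mul0rn. Qed.

Lemma ipgg i j : ip (gamma *+ i) (gamma *+ j) = 0.
Proof. by rewrite ipMg // ipMnl gg mul0rn. Qed.

Lemma gamma_op_comm : commuting gamma_op.
Proof.
have hl a n u : lmul (hser M a n) * lmul u = lmul u * lmul (hser M a n).
  by rewrite -!lmulM hser_central.
have hg i n j m : lmul (hser M (gamma *+ i) n) * gser M (gamma *+ j) m =
    gser M (gamma *+ j) m * lmul (hser M (gamma *+ i) n).
  by symmetry; apply: comm_hser => k; apply: mul_gser_pos; apply: ipgg.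
have ge j m : gser M (gamma *+ j) m * egamma = egamma * gser M (gamma *+ j) m.
  by symmetry; apply: comm_gser => k; rewrite negE_lmul_elt.
have gd j m phi : gser M (gamma *+ j) m * diag M phi = diag M phi * gser M (gamma *+ j) m.
  by rewrite diag_gser.
move=> x y [i n|i n|phi pg|] [j m|j m|psi qg|].
- exact: hl.
- exact: hg.
- by rewrite diag_hser.
- exact: hl.
- by rewrite hg.
- apply: comm_gser => k; symmetry; apply: comm_gser => l; exact: negE_comm.
- exact: gd.
- exact: ge.
- exact: diag_hser.
- by rewrite gd.
- by rewrite !diagM; apply: eq_diag => b; rewrite mulrC.
- exact: diag_lmul_elt.
- by rewrite /egamma hl.
- by rewrite ge.
- by symmetry; apply: diag_lmul_elt.
by [].
Qed.

Lemma gamma_op_al f j : gamma_op f -> f * al j = al j * f.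
Proof.
case: j => [[|j]|j] gf.
- apply: gamma_op_comm => //; apply: gop_d => b.
  by rewrite ipDr ag add0r.
- have pl u : lmul (pos_m M alpha j) * lmul u = lmul u * lmul (pos_m M alpha j).
    by rewrite -!lmulM pos_central.
  case: gf => [i n|i n|phi pg|] /=.
  + by rewrite pl.
  + by apply: mul_gser_pos; rewrite ipC ipMg.
  + exact: diag_pos.
  by rewrite /egamma pl.
case: gf => [i n|i n|phi pg|] /=.
- symmetry; apply: comm_hser => k; apply: mul_negE_pos; exact: ipMg.
- symmetry; apply: comm_gser => k; exact: negE_comm.
- exact: diag_negE.
by rewrite -negE_lmul_elt.
Qed.

Lemma heis_mo a (h : int) i j : ip a a = 2 * h -> mo M a i * mo M a j =
  mo M a j * mo M a i + (if i + j == 0 then ((- i)%:~R * (2 * h%:~R))%:A else 0).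
Proof.
move=> aa; have dd := fun phi psi => diagM M phi psi.
case: i j => [[|i]|i] [[|j]|j] /=.
- by rewrite oppr0 mul0r scale0r addr0.
- by rewrite addr0 diag_pos.
- by rewrite addr0 diag_negE.
- by rewrite addr0 diag_pos.
- by rewrite addr0 -!lmulM pos_central.
- rewrite negE_lmul_pos aa -addrA -[LHS]addr0; congr (_ + _).
  have -> : (Posz i.+1 + Negz j == 0) = (i == j) by rewrite NegzE; lia.
  case: eqP => [->|_]; last by rewrite mulr0n scale0r addr0.
  by rewrite mulr1n -scalerDl intrM mulrNz mulNr addrN scale0r.
- by rewrite addr0 diag_negE.
- rewrite negE_lmul_pos aa; congr (_ + _).
  have -> : (Negz i + Posz j.+1 == 0) = (j == i) by rewrite NegzE; lia.
  case: eqP => [_|_]; last by rewrite mulr0n scale0r.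
  by rewrite mulr1n NegzE opprK intrM.
by rewrite addr0 negE_comm.
Qed.

Lemma al_pos : exists2 g, newton (fun n => if n is 0 then 0 else al n%:Z) g &
  forall n, int_endo (g n).
Proof.
exists (fun n => lmul (hser M alpha n)); last first.
  by move=> n; apply: int_endo_lmul; apply: intV_hser.
have [p0 h0 Eh] := hser_newton M alpha; split=> //; first by rewrite h0 lmul1.
apply: fpsP => n; rewrite /euler -lmulMn -[_ *+ n]/(euler (hser M alpha) n) Eh.
rewrite !fpsME lmul_sum; apply: eq_bigr => i _; rewrite lmulM; congr (_ * _).
by case: (nat_of_ord i) => [|k] /=; rewrite ?lmul0.
Qed.

Lemma al_neg : exists2 g, newton (fun n => if n is 0 then 0 else al (- n%:Z)) g &
  forall n, int_endo (g n).
Proof.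
exists (gser M (- alpha)) => [|n]; last exact: gser_int.
have [p0 g0 Eg] := gser_newton M (- alpha); split=> //; rewrite Eg; congr (_ * _).
by apply: fpsP => -[|n] //=; rewrite negEN opprK.
Qed.

(** On the part of degree b the series g acts as (1 - t)^(-(alpha, b)), whose coefficients are
    integers. *)
Lemma al_zero : exists2 g, newton (fun n => if n is 0 then 0 else al 0) g &
  forall n, int_endo (g n).
Proof.
pose I (x : rat) := exists z : int, x = z%:~R.
have sI : subring I.
  split; first by exists 1.
    by move=> _ _ [x ->] [y ->]; exists (x - y); rewrite intrB.
  by move=> _ _ [x ->] [y ->]; exists (x * y); rewrite intrM.
have cI : commuting I by move=> x y _ _; apply: mulrC.
have /choice[k kP] : forall z : int, exists h : fps rat,
    newton (geom 1 (1 : rat) *~ z) h /\ forall n, I (h n).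
  move=> z; have [h nw Ih] := @intseqMz_geom _ _ sI cI 1 1 z isT (sub1 sI).
  by exists h.
exists (fun n => diag M (fun b => k (ip alpha b) n)) => [|n]; last first.
  apply: int_endo_mon => b J u mu; rewrite (diag_mon _ mu).
  have [_ Ik] := kP (ip alpha b); have [z ->] := Ik n; rewrite scaler_int.
  exact: hspan_intV (hspan_Mz z (hspan_mon mu)).
split=> //.
  apply: bm_ext => b m; have [[_ h0 _] _] := kP (ip alpha b).
  by rewrite diag_bm h0 scale1r.
apply: fpsP => n; apply: bm_ext => b m; have [[p0 _ Eh] _] := kP (ip alpha b).
rewrite /euler endoMnE diag_bm scalerMnl -[_ *+ n]/(euler (k (ip alpha b)) n) Eh.
rewrite !fpsME endo_sumE scaler_suml; apply: eq_bigr => i _; rewrite endoME diag_bm endoZ.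
case: (nat_of_ord i) => [|i'] /=; first by rewrite p0 mul0r scale0r scaler0.
rewrite diag_bm fpsMzE /geom dvd1n divn1 expr1n mulr1n scalerA mulrC.
by [].
Qed.

Lemma zproj_int a N : int_endo (zproj M a N).
Proof.
apply: int_endo_mon => b J u mu; rewrite /zproj (diag_mon _ mu).
case: eqP => _; rewrite ?scale1r ?scale0r; last exact: intV_0.
exact: hmon_intV mu.
Qed.

Section Truncation.
Variables R Mh : nat.

Definition Gp : {poly endo M} := \poly_(j < R.+1) gser M gamma j.
Definition Hp : {poly endo M} := \poly_(l < Mh.+1) lmul (hser M gamma l).
(** On the vectors considered gamma(0) takes values in [-R, R]; the shift by R makes the exponent of
    z a natural number and is undone by n0 = -R in [theta]. *)
Definition Zn (m : nat) : endo M := zproj M gamma (m%:Z - R%:Z).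
Definition Zp : {poly endo M} := \poly_(m < (R + R).+1) Zn m.
Definition HZ : {poly endo M} := egamma%:P * Hp * Zp.
(* z^R e^gamma(z), truncated to Laurent polynomials: the first variable is z,
   the second one 1/z. *)
Definition fgamma : {poly {poly endo M}} := map_poly polyC HZ * Gp%:P.

Let I f := int_endo f /\ bicomm gamma_op f.
Let sI : subring I := subring_and (int_endo_subring M) (bicomm_subring gamma_op).

Let I_gop f : int_endo f -> gamma_op f -> I f.
Proof. by move=> fi fg; split=> //; apply: bicomm_gen. Qed.

Lemma zproj_gop N : gamma_op (zproj M gamma N).
Proof. by apply: gop_d => b; rewrite ipDr gg add0r. Qed.

Let I_h l : I (lmul (hser M gamma l)).
Proof.
apply: I_gop; first by apply: int_endo_lmul; apply: intV_hser.
exact: (gop_h 1).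
Qed.

Let I_g l : I (gser M gamma l).
Proof. by apply: I_gop; [apply: gser_int | exact: (gop_g 1)]. Qed.

Let I_e : I egamma.
Proof. by apply: I_gop; [apply: int_endo_lmul; apply: intV_elt | exact: gop_e]. Qed.

Let I_Z N : I (zproj M gamma N).
Proof. by apply: I_gop; [apply: zproj_int | apply: zproj_gop]. Qed.

Let over_poly n (F : nat -> endo M) : (forall i, I (F i)) -> over I (\poly_(i < n) F i).
Proof. by move=> IF i; rewrite coef_poly; case: ifP => _ //; apply: sub0. Qed.

Lemma HZ_over : over I HZ.
Proof.
have so := over_subring sI.
apply: (subM so); last by apply: over_poly => i; apply: I_Z.
apply: (subM so); last exact: over_poly.
by move=> i; rewrite coefC; case: ifP => _ //; apply: sub0.
Qed.

Lemma coef_fgammaX i l j : (fgamma ^+ i)`_l`_j = (HZ ^+ i)`_l * (Gp ^+ i)`_j.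
Proof.
have cI : commuting (bicomm gamma_op) := bicomm_commuting gamma_op_comm.
have cHG : map_poly polyC HZ * Gp%:P = Gp%:P * map_poly polyC HZ :> {poly {poly endo M}}.
  apply/polyP => k; rewrite coefMC coefCM coef_map /=.
  apply/polyP => n; rewrite coefCM coefMC; apply: cI; first by have [] := HZ_over k.
  by have [] := over_poly R.+1 I_g n.
rewrite /fgamma exprMn_comm // -rmorphXn /= -rmorphXn /= coefMC coef_map /=.
by rewrite coefCM.
Qed.

Lemma fgamma_exp_int (h : int) Q : ip alpha alpha = 2 * h ->
  exists N0, forall N q, (N0 <= N)%N -> (q <= Q)%N ->
  int_endo (serexp (fun i => i%:R^-1 *: theta al (- R%:Z) N i (fgamma ^+ i)) q).
Proof.
move=> aa; have fI l j : I fgamma`_l`_j.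
  rewrite -[fgamma]expr1 coef_fgammaX !expr1.
  exact: (subM sI (HZ_over l) (over_poly R.+1 I_g j)).
apply: (@vertex_exp_int _ _ al h) => //.
- exact: int_endo_subring.
- by move=> i j; apply: heis_mo.
- exact: al_pos.
- exact: al_neg.
- exact: al_zero.
- by move=> l j; have [] := fI l j.
- move=> l j l' j'; have [_ b] := fI l j; have [_ b'] := fI l' j'.
  exact: bicomm_commuting gamma_op_comm _ _ b b'.
move=> l j i; have [_ bf] := fI l j; symmetry; apply: bf => g gop.
by symmetry; apply: gamma_op_al.
Qed.

End Truncation.
End Dynamics.

(** * The zero modes *)

Section ZeroMode.
Variables (L : evenLattice) (C : doubleCover L) (M : model C).
Variables (alpha gamma : vec L) (s : bool).
Hypotheses (gg : ip gamma gamma = 0) (ag : ip alpha gamma = 0).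
Implicit Types (u v w : M) (a b c : vec L).

Notation al := (mo M alpha).
Notation gop := (@gamma_op L C M gamma s).
Notation eg := (@egamma L C M gamma s).

(** The sign between (e^gamma)^i and the chosen lift of i gamma, which is the lift that [mYexp]
    uses. *)
Fixpoint sgi (i : nat) : bool :=
  if i is i'.+1 then s (+) sgi i' (+) cocyc C gamma (gamma *+ i') else false.

Lemma elt_mX i : elt_m M s gamma ^+ i = elt_m M (sgi i) (gamma *+ i).
Proof.
elim: i => [|i IH]; last by rewrite exprS IH elt_mM mulrS.
by rewrite expr0 mulr0n /elt_m /sgn expr0 scale1r E0.
Qed.

Lemma egammaX i : eg ^+ i = sgn (sgi i) *: lmul (elt_m M false (gamma *+ i)).
Proof.
by rewrite -lmulX elt_mX -lmulZ /elt_m scalerA /sgn expr0 mulr1.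
Qed.

(* The action of (alpha(1) e^(i gamma))_0. *)
Definition zmode i : M -> M := fun v =>
  \sum_k (alpha 0 k)%:~R *:
    (sgn (sgi i) *: mnormord k (mYexp (gamma *+ i)) (- 1) v).

Section Bounds.
Variables R K : nat.
Hypothesis RK : (R <= K)%N.

Notation Zn := (@Zn L C M gamma R).
Notation Gp := (@Gp L C M gamma R).

Definition zsum : endo M := \sum_(m < (R + R).+1) Zn m.

(* On these vectors e^(i gamma)(z) and alpha(1)(z) have finitely many nonzero
   terms, within bounds stable under the operators of e^(i gamma)(z). *)
Record bounded u : Prop := Bounded {
  bnd_g : forall i j, (R < j)%N -> gser M (gamma *+ i) j u = 0;
  bnd_G : forall i j, (R < j)%N -> (Gp ^+ i)`_j u = 0;
  bnd_z : zsum u = u;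
  bnd_al : forall j, (K <= j)%N -> negE M alpha j u = 0;
  bnd_neg : exists R', forall c j, (R' <= j)%N -> negE M c j u = 0 }.

Lemma bounded0 : bounded 0.
Proof. by split=> [i j _|i j _||j _|]; rewrite ?endo_0 //; exists 0%N => c j _; rewrite endo_0. Qed.

Lemma boundedD u v : bounded u -> bounded v -> bounded (u + v).
Proof.
case=> u1 u2 u3 u4 [r u5] [v1 v2 v3 v4 [r' v5]]; split=> [i j lt|i j lt||j lt|].
- by rewrite endoD u1 ?v1 ?addr0.
- by rewrite endoD u2 ?v2 ?addr0.
- by rewrite endoD u3 v3.
- by rewrite endoD u4 ?v4 ?addr0.
exists (r + r')%N => c j le; rewrite endoD u5 ?v5 ?addr0 //; lia.
Qed.

Lemma boundedZ (x : rat) u : bounded u -> bounded (x *: u).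
Proof.
case=> u1 u2 u3 u4 [r u5]; split=> [i j lt|i j lt||j lt|].
- by rewrite endoZ u1 ?scaler0.
- by rewrite endoZ u2 ?scaler0.
- by rewrite endoZ u3.
- by rewrite endoZ u4 ?scaler0.
by exists r => c j le; rewrite endoZ u5 ?scaler0.
Qed.

Lemma bounded_sum (T : Type) (r : seq T) (P : pred T) F :
  (forall i, P i -> bounded (F i)) -> bounded (\sum_(i <- r | P i) F i).
Proof. by move=> bF; elim/big_ind: _ => //; [apply: bounded0 | apply: boundedD]. Qed.

Lemma Gp_gop i j : bicomm gop (Gp ^+ i)`_j.
Proof.
have sB := bicomm_subring gop; have so := over_subring sB.
suff oG : over (bicomm gop) Gp by apply: (subX so).
move=> k; rewrite coef_poly; case: ifP => _; last exact: sub0.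
by apply: bicomm_gen; apply: (@gop_g _ _ M gamma s 1).
Qed.

Lemma zsum_gop : bicomm gop zsum.
Proof.
apply: sub_sum => [|m _]; first exact: bicomm_subring.
by apply: bicomm_gen; apply: zproj_gop.
Qed.

(** Beyond degree R the coefficients of the power of the truncation need not be those of [gser];
    they still lower the degree by j, so they vanish on vectors of degree at most R. *)
Lemma Gp_lowers i j : lowers j ((Gp ^+ i)`_j).
Proof.
elim: i j => [|i IH] j.
  by rewrite expr0 coef1; case: j => [|j]; [apply: lowers1 | apply: lowers0].
rewrite exprS coefM; apply: lowers_sum => k _.
have kj : (k <= j)%N by rewrite -ltnS.
have lk : lowers k Gp`_k.
  by rewrite coef_poly; case: ifP => _; [exact: gser_lowers | exact: lowers0].
by have := lowersM lk (IH (j - k)%N); rewrite subnKC.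
Qed.

Lemma bounded_mon b J u : hmon b J u -> (J <= R)%N -> (`|ip gamma b| <= R)%N -> bounded u.
Proof.
move=> mu JR bR; have su := hspan_mon mu; split=> [i j lt|i j lt||j lt|].
- by have [_ ->] := @gser_lowers L C M (gamma *+ i) j b J u su; rewrite // (leq_ltn_trans JR).
- by have [_ ->] := @Gp_lowers i j b J u su; rewrite // (leq_ltn_trans JR).
- rewrite /zsum endo_sumE.
  have lb : (absz (ip gamma b + R%:Z)%R < (R + R).+1)%N by lia.
  rewrite (bigD1 (Ordinal lb)) //= /zproj (diag_mon _ mu) big1 ?addr0.
    by rewrite (_ : _ == _ = true) ?scale1r //; lia.
  move=> m; rewrite -val_eqE /= => ne; rewrite /zproj (diag_mon _ mu).
  by rewrite (_ : _ == _ = false) ?scale0r //; lia.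
- by have [_ ->] := @negE_lowers L C M alpha j b J u su; rewrite // ltnS; lia.
exists J => c j le; have [_ ->] // := @negE_lowers L C M c j b J u su.
Qed.

Lemma comm_bounded (f : endo M) u : commutes gop f -> bounded u ->
  [/\ forall i j, (R < j)%N -> gser M (gamma *+ i) j (f u) = 0,
      forall i j, (R < j)%N -> (Gp ^+ i)`_j (f u) = 0 & zsum (f u) = f u].
Proof.
move=> cf [u1 u2 u3 _ _]; split=> [i j lt|i j lt|].
- by rewrite -endoME -cf ?endoME ?u1 ?endo_0 //; apply: gop_g.
- by rewrite -endoME -(Gp_gop i j cf) endoME u2 ?endo_0.
by rewrite -endoME -(zsum_gop cf) endoME u3.
Qed.

Lemma bounded_gop (f : endo M) u : gop f -> bounded u -> bounded (f u).
Proof.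
move=> gf bu; have [f1 f2 f3] : [/\ _, _ & _] :=
  comm_bounded (fun g g1 => gamma_op_comm gg gf g1) bu.
split=> // [j lt|].
  by rewrite -endoME -(gamma_op_al gg ag (Negz j) gf) endoME (bnd_al bu) // endo_0.
case: (bnd_neg bu) => r u5.
case: gf => [i n|i n|phi pg|].
- exists (r + n)%N => c j le; rewrite lmulE negE_derivation negE_hser u5 ?mulr0; last lia.
  by rewrite (_ : (j < n)%N = false) ?mul0r ?addr0 //; lia.
- exists r => c j le; rewrite -endoME (comm_gser _ (fun k => negE_comm M _ _ _ _)).
  by rewrite endoME u5 ?endo_0.
- by exists r => c j le; rewrite -endoME -diag_negE endoME u5 ?endo_0.
by exists r => c j le; rewrite -endoME negE_lmul_elt endoME u5 ?endo_0.
Qed.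

Lemma bounded_gopX (f : endo M) i u : gop f -> bounded u -> bounded ((f ^+ i) u).
Proof.
move=> gf bu; elim: i => [|i IH]; first by rewrite expr0.
by rewrite exprS endoME; apply: bounded_gop.
Qed.

(** A nonzero (alpha, alpha) does no harm: alpha(x) commutes with alpha(-(j+1)) when x <= K <= j.
    The zero modes use such x beyond R, so K is a bound of its own. *)
Lemma bounded_al (x : int) u : x <= K%:Z -> bounded u -> bounded (al x u).
Proof.
case: x => [[|x]|x] xK bu.
- by apply: bounded_gop => //; apply: gop_d => b; rewrite ipDr ag add0r.
- have [f1 f2 f3] := comm_bounded (f := al x.+1) (fun g gop => esym (gamma_op_al gg ag _ gop)) bu.
  split=> // [j lt|].
    rewrite negE_posM (bnd_al bu) // mulr0 addr0 (_ : (x == j) = false) ?mulr0n ?scale0r //.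
    by lia.
  case: (bnd_neg bu) => r u5; exists (r + x.+1)%N => c j le.
  rewrite negE_posM u5 ?mulr0 ?addr0; last lia.
  by rewrite (_ : (x == j) = false) ?mulr0n ?scale0r //; lia.
have [f1 f2 f3] := comm_bounded (f := al (Negz x)) (fun g gop => esym (gamma_op_al gg ag _ gop)) bu.
split=> // [j lt|].
  by rewrite -endoME negE_comm endoME (bnd_al bu) ?endo_0.
case: (bnd_neg bu) => r u5; exists r => c j le.
by rewrite -endoME negE_comm endoME u5 ?endo_0.
Qed.

Lemma al_kill (x : int) u : bounded u -> (K%:Z < x)%R -> al (- x) u = 0.
Proof.
move=> bu Kx; have [n xE] : exists n : nat, x = n.+1%:Z by exists (absz x).-1; lia.
by rewrite xE -NegzE (bnd_al bu) //; move: Kx; rewrite xE; lia.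
Qed.

Definition hg_part i (k : int) (j : nat) : endo M :=
  if 0 <= k + j%:Z
  then lmul (hser M (gamma *+ i) `|(k + j%:Z)%R|%N) * gser M (gamma *+ i) j else 0.

(** The coefficient of z^N in the field of (e^gamma)^i, as it acts on bounded vectors: on the image
    of [Zn m] the factor z^(i gamma(0)) is z^(i(m - R)). *)
Definition Yend i (N : int) : endo M := eg ^+ i *
  \sum_(m < (R + R).+1) \sum_(j < R.+1) hg_part i (N - i%:Z * (m%:Z - R%:Z)) j * Zn m.

Lemma hg_part_gop i k j : bicomm gop (hg_part i k j).
Proof.
have sB := bicomm_subring gop; rewrite /hg_part; case: ifP => _; last exact: (sub0 sB).
by apply: (subM sB); apply: bicomm_gen; [apply: gop_h | apply: gop_g].
Qed.

Lemma Yend_gop i N : bicomm gop (Yend i N).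
Proof.
have sB := bicomm_subring gop; apply: (subM sB).
  by apply: (subX sB); apply: bicomm_gen; apply: gop_e.
apply: (sub_sum sB) => m _; apply: (sub_sum sB) => j _; apply: (subM sB).
  exact: hg_part_gop.
by apply: bicomm_gen; apply: zproj_gop.
Qed.

Lemma mexp_inner i k u : (forall j, (R < j)%N -> gser M (gamma *+ i) j u = 0) ->
  mcomp (mexpcreat (gamma *+ i)) (mexpannih (gamma *+ i)) k u =
  (\sum_(j < R.+1) hg_part i k j) u.
Proof.
move=> u0; rewrite /mcomp (@fsum_inj _ _ (fun j => - j%:Z) R.+1); last 2 first.
- by move=> j j' /oppr_inj [].
- move=> p np; rewrite /mexpannih; case: ifP => p0; last first.
    by rewrite /mexpcreat mulr0 if_same.
  rewrite u0; first by rewrite /mexpcreat mulr0 if_same.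
  rewrite ltnNge; apply/negP => pR; apply: (np `|p|%N) => //; lia.
rewrite endo_sumE; apply: eq_bigr => j _.
rewrite /mexpannih (_ : - j%:Z <= 0) ?oppr_le0 // abszN absz_nat /mexpcreat opprK /hg_part.
by case: ifP.
Qed.

Lemma zproj_zsum i (N : int) : zproj M (gamma *+ i) N * zsum =
  \sum_(m < (R + R).+1) (i%:Z * (m%:Z - R%:Z) == N)%:R *: Zn m.
Proof.
rewrite /zsum mulr_sumr; apply: eq_bigr => m _; rewrite /zproj diagM.
apply: bm_ext => b k; rewrite endoZE !diag_bm scalerA; congr (_ *: _).
rewrite ipMnl; case: (ip gamma b =P _) => [->|_]; last by rewrite !mulr0.
by rewrite !mulr1 -[_ *+ i]mulr_natl natz.
Qed.

Lemma zproj_i_gop i N : gop (zproj M (gamma *+ i) N).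
Proof. by apply: gop_d => b; rewrite ipDr ipMnl gg mul0rn add0r. Qed.

Lemma mYexp_bounded i N u : (0 < i)%N ->
  (forall j, (R < j)%N -> gser M (gamma *+ i) j u = 0) -> zsum u = u ->
  mYexp (gamma *+ i) N u = sgn (sgi i) *: Yend i N u.
Proof.
move=> i0 ug uz; have i1 : i%:Z != 0 by lia.
rewrite /Yend egammaX -endoZE -!scalerAl scalerA.
rewrite (_ : sgn _ * sgn _ = 1) ?scale1r; last by rewrite /sgn -expr2 sqrr_sign.
rewrite endoME lmulE /mYexp; congr (_ * _); rewrite [LHS]/mcomp.
pose G p : endo M := \sum_(j < R.+1) hg_part i p j.
have FE p : zproj M (gamma *+ i) (N - p)
      (mcomp (mexpcreat (gamma *+ i)) (mexpannih (gamma *+ i)) p u) =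
   \sum_(m < (R + R).+1) (i%:Z * (m%:Z - R%:Z) == N - p)%:R *: G p (Zn m u).
  rewrite mexp_inner // -/(G p).
  have cG : zproj M (gamma *+ i) (N - p) * G p = G p * zproj M (gamma *+ i) (N - p).
    have : bicomm gop (G p).
      by apply: (sub_sum (bicomm_subring gop)) => j _; apply: hg_part_gop.
    by apply=> g; apply: gamma_op_comm => //; apply: zproj_i_gop.
  transitivity ((zproj M (gamma *+ i) (N - p) * G p * zsum) u); first by rewrite !endoME uz.
  rewrite cG -mulrA zproj_zsum endoME [X in efun (G p) X]endo_sumE endo_sum.
  by apply: eq_bigr => m _; rewrite endoZE endoZ.
(* As i > 0, distinct m give distinct exponents, so the sum over all exponents is a sum over m. *)
rewrite (@fsum_inj _ _ (fun m => N - i%:Z * (m%:Z - R%:Z)) (R + R).+1); last 2 first.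
- by move=> m m' /addrI /oppr_inj /(mulfI i1) /addIr [].
- move=> p np; rewrite FE big1 // => m _; case: eqP => [E|_]; last by rewrite scale0r.
  by case: (np m) => //; rewrite E opprB addrCA subrr addr0.
rewrite endo_sumE; apply: eq_bigr => m _; rewrite FE (bigD1 m) //= big1 ?addr0.
  rewrite opprB addrCA subrr addr0 eqxx scale1r -endoME mulr_suml !endo_sumE.
  by apply: eq_bigr => j _.
move=> m' ne; rewrite (_ : _ == _ = false) ?scale0r //; apply/negP => /eqP.
rewrite opprB addrCA subrr addr0 => E; move: ne; rewrite -val_eqE /=.
by move: E => /(mulfI i1) /addIr [->]; rewrite eqxx.
Qed.

Lemma Yend_eq0 i (N : int) : N < - (i * R + R)%N%:Z -> Yend i N = 0.
Proof.
move=> lt; rewrite /Yend big1 ?mulr0 // => m _; apply: big1 => j _.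
rewrite /hg_part ifF ?mul0r //; apply: negbTE; rewrite -ltNge.
have iR : i%:Z * (m%:Z - R%:Z) >= - (i * R)%N%:Z by rewrite PoszM; nia.
by have := ltn_ord j; lia.
Qed.

(** Meant for modes of basis vectors, which need not be orthogonal to gamma: [bounded] may be lost,
    but the two conditions that [mYexp_bounded] asks for survive modes of index at most 0. *)
Lemma commute_op (f : endo M) : (exists phi, f = diag M phi) \/ (exists c j, f = negE M c j) ->
  forall u, bounded u ->
  (forall i j, (R < j)%N -> gser M (gamma *+ i) j (f u) = 0) /\ zsum (f u) = f u.
Proof.
move=> fP u bu.
have fg i j : f * gser M (gamma *+ i) j = gser M (gamma *+ i) j * f.
  by case: fP => [[phi ->]|[c [k ->]]]; apply: comm_gser => n; [apply: diag_negE | apply: negE_comm].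
have fz : f * zsum = zsum * f.
  rewrite /zsum mulr_sumr mulr_suml; apply: eq_bigr => m _.
  case: fP => [[phi ->]|[c [k ->]]]; last by rewrite diag_negE.
  by rewrite !diagM; apply: eq_diag => b; rewrite mulrC.
split=> [i j lt|]; last by rewrite -endoME -fz endoME (bnd_z bu).
by rewrite -endoME -fg endoME (bnd_g bu) // endo_0.
Qed.

(** Normal ordering disappears because alpha commutes with the field of e^(i gamma). Single basis
    vectors need not, so the order is changed only after summation over k. *)
Lemma zmode_bounded i u : (0 < i)%N -> bounded u ->
  exists B0, forall B, (B0 <= B)%N ->
  zmode i u = \sum_(p < B + B) Yend i (p%:Z - B%:Z) (al (- (p%:Z - B%:Z)) u).
Proof.
move=> i0 bu; case: (bnd_neg bu) => R' uR'.
(* The field has no power of z below -(iR + R), and annihilation operators beyond R' kill u. *)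
exists (i * R + R + R'.+1)%N => B BB.
have moP k m : (forall i j, (R < j)%N -> gser M (gamma *+ i) j (mo M (basis k) (- m%:Z) u) = 0)
    /\ zsum (mo M (basis k) (- m%:Z) u) = mo M (basis k) (- m%:Z) u.
  apply: (@commute_op (mo M (basis k) (- m%:Z))) => //.
  by case: m => [|m]; [left; eexists | right; exists (basis k), m].
have nE k : mnormord k (mYexp (gamma *+ i)) (- 1) u = sgn (sgi i) *:
    (\sum_(m < B) mo M (basis k) m.+1%:Z (Yend i (- m.+1%:Z) u) +
     \sum_(m < B) Yend i m%:Z (mo M (basis k) (- m%:Z) u)).
  rewrite /mnormord scalerDr; congr (_ + _); rewrite /mcomp scaler_sumr.
    rewrite (@fsum_inj _ _ (fun m => - m.+1%:Z) B); last 2 first.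
    - by move=> m m' /oppr_inj [].
    - move=> p np; rewrite /mcreat; case: ifP => // p0.
      rewrite (mYexp_bounded _ i0 (bnd_g bu i) (bnd_z bu)) Yend_eq0 ?endo0E ?scaler0 ?endo_0 //.
      rewrite ltNge; apply/negP => pB; apply: (np (absz p).-1); lia.
    apply: eq_bigr => m _; rewrite /mcreat (_ : 0 <= _ = true); last by lia.
    rewrite (mYexp_bounded _ i0 (bnd_g bu i) (bnd_z bu)) endoZ; congr (_ *: mo _ _ _ _).
    by lia.
  rewrite (@fsum_inj _ _ (fun m => - m.+1%:Z) B); last 2 first.
  - by move=> m m' /oppr_inj [].
  - move=> p np; have Y0 N : mYexp (gamma *+ i) N (0 : M) = 0.
      rewrite (mYexp_bounded _ i0 (bnd_g bounded0 i) (bnd_z bounded0)).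
      by rewrite endo_0 scaler0.
    rewrite /mannih; case: ifP => p0; last exact: Y0.
    have [n pE] : exists n : nat, p + 1 = - n%:Z by exists (absz (p + 1)); lia.
    rewrite pE; case: n pE => [|n] pE.
      by case: (np 0%N); [lia | lia].
    by rewrite -NegzE /= uR' ?Y0 //; case: (leqP R' n) => // nR; case: (np n.+1); lia.
  apply: eq_bigr => m _; rewrite /mannih (_ : _ < 0 = true); last by lia.
  have -> : - m.+1%:Z + 1 = - m%:Z by lia.
  have -> : - 1 - - m.+1%:Z = m%:Z by lia.
  by have [g1 z1] := moP k m; rewrite (mYexp_bounded _ i0 (g1 i) z1).
rewrite -(sum_fold (fun p => Yend i p (al (- p) u))) -big_split /zmode.
have ss : sgn (sgi i) * sgn (sgi i) = 1 by rewrite /sgn -expr2 sqrr_sign.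
transitivity (\sum_k \sum_(m < B) ((alpha 0 k)%:~R *: mo M (basis k) m.+1%:Z (Yend i (- m.+1%:Z) u) +
  Yend i m%:Z ((alpha 0 k)%:~R *: mo M (basis k) (- m%:Z) u))).
  apply: eq_bigr => k _; rewrite nE scalerA ss scale1r -big_split scaler_sumr.
  by apply: eq_bigr => m _; rewrite scalerDr endoZ.
rewrite exchange_big; apply: eq_bigr => m _; rewrite big_split; congr (_ + _).
  transitivity ((al m.+1%:Z * Yend i (- m.+1%:Z)) u).
    rewrite endoME mo_basis [RHS]endo_sumE.
    by apply: eq_bigr => k _; rewrite endoZE.
  have c : al m.+1%:Z * Yend i (- m.+1%:Z) = Yend i (- m.+1%:Z) * al m.+1%:Z.
    by apply: (Yend_gop i) => g gopg; rewrite (gamma_op_al gg ag _ gopg).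
  by rewrite c endoME opprK.
rewrite -endo_sum mo_basis [X in _ = efun _ X]endo_sumE.
by congr (efun _ _); apply: eq_bigr => k _; rewrite endoZE.
Qed.

End Bounds.
End ZeroMode.

(** * The zero mode as the residue of a Laurent polynomial *)

Section ZeroModeExp.
Variables (L : evenLattice) (C : doubleCover L) (M : model C).
Variables (alpha gamma : vec L) (s : bool).
Hypotheses (gg : ip gamma gamma = 0) (ag : ip alpha gamma = 0).
Implicit Types (u v w : M) (a b c : vec L).

Notation al := (mo M alpha).
Notation gop := (@gamma_op L C M gamma s).
Notation eg := (@egamma L C M gamma s).

Lemma lmul_hserX i :
  ((fun n => lmul (hser M gamma n)) : fps (endo M)) ^+ i = fun n => lmul (hser M (gamma *+ i) n).
Proof.
apply: fpsP => n; rewrite hserMn; elim: i n => [|i IH] n.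
  by rewrite !expr0 !fps1E; case: eqP => _; rewrite ?lmul1 ?lmul0.
rewrite !exprS !fpsME lmul_sum; apply: eq_bigr => k _.
by rewrite IH lmulM.
Qed.

Section Fixed.
Variables R K Mh i : nat.
Hypotheses (i0 : (0 < i)%N) (RK : (R <= K)%N) (KM : (K + i * R + R <= Mh)%N).

Notation Zn := (@Zn L C M gamma R).
Notation bnd := (bounded alpha gamma R K).

Definition zterm (m j l : nat) u : M :=
  (eg ^+ i * lmul (hser M (gamma *+ i) l) * Zn m * gser M (gamma *+ i) j)
    (al (- (i%:Z * (m%:Z - R%:Z) + l%:Z - j%:Z)) u).

(** Here i(m - R) + l - j >= l - iR - R > K, and alpha(-n) kills bounded vectors for n > K. The
    lower bound on [Mh] serves this purpose. *)
Lemma zterm0 m j l u : bnd u -> (m < (R + R).+1)%N -> (j < R.+1)%N ->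
  (Mh < l)%N -> zterm m j l u = 0.
Proof.
move=> bu mR jR lM; rewrite /zterm (al_kill gg ag RK bu) ?endo_0 //.
have iR : i%:Z * (m%:Z - R%:Z) >= - (i * R)%N%:Z by rewrite PoszM; nia.
lia.
Qed.

Lemma zmode_zterm u : bnd u -> zmode alpha gamma s i u =
  \sum_(m < (R + R).+1) \sum_(j < R.+1) \sum_(l < Mh.+1) zterm m j l u.
Proof.
move=> bu; have [B0 E] := zmode_bounded s gg ag RK i0 bu.
pose B := (B0 + i * R + R + R + Mh.+1)%N; rewrite (E B); last by rewrite /B; lia.
rewrite /Yend; under eq_bigr => p _.
  rewrite endoME endo_sumE endo_sum.
  under eq_bigr => m _ do rewrite endo_sumE endo_sum.
  over.
rewrite exchange_big; apply: eq_bigr => m _; rewrite exchange_big; apply: eq_bigr => j _.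
pose c := j%:Z - i%:Z * (m%:Z - R%:Z).
have iR : `|i%:Z * (m%:Z - R%:Z)| <= (i * R)%N%:Z.
  by rewrite PoszM; have := ltn_ord m; nia.
rewrite -(@sum_shift _ (fun l => zterm m j l u) c B Mh.+1); last 2 first.
- by move=> l Ml; apply: zterm0.
- by have := ltn_ord j; rewrite /B /c; lia.
apply: eq_bigr => p _ /=; rewrite /hg_part.
have -> : p%:Z - B%:Z - i%:Z * (m%:Z - R%:Z) + j%:Z = p%:Z - B%:Z + c by rewrite /c; lia.
case: ifP => q0; last by rewrite endo0E endo_0.
have gz : gser M (gamma *+ i) j * Zn m = Zn m * gser M (gamma *+ i) j.
  by rewrite /Zn /zproj diag_gser.
transitivity ((eg ^+ i * lmul (hser M (gamma *+ i) `|(p%:Z - B%:Z + c)%R|%N) *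
  (gser M (gamma *+ i) j * Zn m)) (al (- (p%:Z - B%:Z)) u)); first by rewrite !endoME.
rewrite gz mulrA /zterm; congr (efun _ (efun (al _) u)).
by rewrite /c in q0 *; lia.
Qed.

Lemma HpX l : (l <= Mh)%N -> (Hp M gamma Mh ^+ i)`_l = lmul (hser M (gamma *+ i) l).
Proof. by move=> lM; rewrite (ftruncX (fun n => lmul (hser M gamma n))) // lmul_hserX. Qed.

Lemma GpX j : (j <= R)%N -> (Gp M gamma R ^+ i)`_j = gser M (gamma *+ i) j.
Proof. by move=> jR; rewrite (ftruncX (gser M gamma)) // gserMn. Qed.

Lemma ZnM m m' : Zn m * Zn m' = if m == m' then Zn m else 0.
Proof.
apply: bm_ext => b k; rewrite /Zn /zproj diagM diag_bm.
case: (m =P m') => [->|ne]; first by rewrite diag_bm; case: eqP; rewrite ?mulr1 ?mulr0.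
rewrite endo0E (_ : _ * _ = 0) ?scale0r //.
case: eqP => [e1|_]; last by rewrite mul0r.
by case: eqP => [e2|_]; [case: ne; lia | rewrite mulr0].
Qed.

(** The [Zn m] are orthogonal idempotents. They need not add up to 1, so the exponent i must be
    positive. *)
Lemma ZpX : Zp M gamma R ^+ i = \sum_(m < (R + R).+1) Zn m *: 'X^(i * m).
Proof.
case: i i0 => // k _; elim: k => [|k IH].
  by rewrite expr1 /Zp poly_def; apply: eq_bigr => m _; rewrite mul1n.
rewrite exprSr IH /Zp poly_def mulr_suml; apply: eq_bigr => m _.
rewrite mulr_sumr (bigD1 m) //= big1 ?addr0.
  by rewrite monomialM ZnM eqxx; congr (_ *: 'X^_); rewrite [in RHS]mulSn addnC.
move=> m' ne; rewrite monomialM ZnM (_ : _ == _ = false) ?scale0r //.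
by apply/negbTE; rewrite eq_sym.
Qed.

Lemma HZX L' : (HZ M gamma s R Mh ^+ i)`_L' = \sum_(m < (R + R).+1)
  if (i * m <= L')%N then eg ^+ i * (Hp M gamma Mh ^+ i)`_(L' - i * m) * Zn m else 0.
Proof.
have cB : commuting (bicomm gop) := bicomm_commuting (gamma_op_comm gg).
have cO := over_commuting cB; have sB := bicomm_subring gop; have so := over_subring sB.
have oe : over (bicomm gop) eg%:P.
  move=> k; rewrite coefC; case: ifP => _; last exact: (sub0 sB).
  by apply: bicomm_gen; apply: gop_e.
have oh : over (bicomm gop) (Hp M gamma Mh).
  move=> k; rewrite coef_poly; case: ifP => _; last exact: (sub0 sB).
  by apply: bicomm_gen; apply: (@gop_h _ _ M gamma s 1).
have oz : over (bicomm gop) (Zp M gamma R).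
  move=> k; rewrite coef_poly; case: ifP => _; last exact: (sub0 sB).
  by apply: bicomm_gen; apply: zproj_gop.
rewrite /HZ exprMn_comm; last exact: cO (subM so oe oh) oz.
rewrite exprMn_comm; last exact: cO oe oh.
rewrite ZpX mulr_sumr coef_sum; apply: eq_bigr => m _.
by rewrite coefM_monomial; case: ifP => // _; rewrite -polyC_exp coefCM.
Qed.

(** Coefficients with j <= R and l <= Mh of the truncated powers are exact, by [GpX] and [HpX]; all
    others vanish on u, by [bnd_G] and [al_kill]. *)
Lemma theta_zterm u N : bnd u -> (Mh.+1 + i * (R + R).+1 + R <= N)%N ->
  theta al (- R%:Z) N i (fgamma M gamma s R Mh ^+ i) u =
  \sum_(m < (R + R).+1) \sum_(j < R.+1) \sum_(l < Mh.+1) zterm m j l u.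
Proof.
move=> bu NN; rewrite /theta endo_sumE.
(* Brings the coefficient of the power of [Gp] next to u, where [bnd_G] applies. *)
have alG j x : (Gp M gamma R ^+ i)`_j * al x = al x * (Gp M gamma R ^+ i)`_j.
  have bG : bicomm gop (Gp M gamma R ^+ i)`_j := @Gp_gop _ _ M gamma s R i j.
  by symmetry; apply: bG => g gopg; rewrite (gamma_op_al gg ag _ gopg).
transitivity (\sum_(L' < N) \sum_(j < R.+1) \sum_(m < (R + R).+1)
   if (i * m <= L')%N then
     (eg ^+ i * (Hp M gamma Mh ^+ i)`_(L' - i * m) * Zn m * gser M (gamma *+ i) j)
       (al (- (- R%:Z * i%:Z + L'%:Z - j%:Z)) u) else 0).
  apply: eq_bigr => L' _; rewrite endo_sumE.
  rewrite (@big_ord_widen_nz _ R.+1 N (fun j => (((fgamma M gamma s R Mh ^+ i)`_L')`_j *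
      al (- (- R%:Z * i%:Z + L'%:Z - j%:Z))) u)) //; last 2 first.
  - lia.
  - by move=> j /andP[Rj _]; rewrite coef_fgammaX // -mulrA alG !endoME (bnd_G bu) ?endo_0.
  apply: eq_bigr => j _; rewrite coef_fgammaX // GpX -1?ltnS // HZX mulr_suml mulr_suml endo_sumE.
  by apply: eq_bigr => m _; case: ifP => _; rewrite ?mul0r ?endo0E // !endoME.
rewrite exchange_big /=; under eq_bigr => j _ do rewrite exchange_big /=.
rewrite exchange_big /=; apply: eq_bigr => m _; apply: eq_bigr => j _.
have -> : N = (i * m + (N - i * m))%N by have := ltn_ord m; nia.
rewrite big_split_ord /= big1 ?add0r; last first.
  by move=> k _; rewrite ifF //; have := ltn_ord k; lia.
under eq_bigr => k _ do rewrite leq_addr addKn.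
have shiftE k : - R%:Z * i%:Z + (i * m + k)%N%:Z - j%:Z = i%:Z * (m%:Z - R%:Z) + k%:Z - j%:Z.
  by rewrite PoszD PoszM; lia.
under eq_bigr => k _ do rewrite shiftE.
rewrite (@big_ord_widen_nz _ Mh.+1 (N - i * m) (fun k =>
     (eg ^+ i * (Hp M gamma Mh ^+ i)`_k * Zn m * gser M (gamma *+ i) j)
       (al (- (i%:Z * (m%:Z - R%:Z) + k%:Z - j%:Z)) u))) //; last 2 first.
- by have := ltn_ord m; nia.
- move=> k /andP[Mk _]; rewrite (al_kill gg ag RK bu) ?endo_0 //.
  have iR : i%:Z * (m%:Z - R%:Z) >= - (i * R)%N%:Z by rewrite PoszM; nia.
  by have := ltn_ord j; lia.
by apply: eq_bigr => l _; rewrite HpX // -ltnS.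
Qed.

(** The largest index of alpha in any term is iR + R, within the range of [bounded_al]; the other
    factors are covered by [bounded_gop]. *)
Lemma zmode_stable u : (i * R + R <= K)%N -> bnd u ->
  bnd (zmode alpha gamma s i u).
Proof.
move=> iK bu; rewrite zmode_zterm //.
have bs := @bounded_sum _ _ M _ _ gg ag R K RK.
apply: (bs) => m _; apply: (bs) => j _; apply: (bs) => l _.
rewrite /zterm !endoME; apply: (bounded_gopX gg ag RK); first exact: gop_e.
apply: (bounded_gop (s := s) gg ag RK); first exact: gop_h.
apply: (bounded_gop (s := s) gg ag RK); first exact: zproj_gop.
apply: (bounded_gop (s := s) gg ag RK); first exact: gop_g.
apply: (bounded_al s gg ag RK) => //.
have iR : i%:Z * (m%:Z - R%:Z) >= - (i * R)%N%:Z by rewrite PoszM; nia.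
by have := ltn_ord j; lia.
Qed.

End Fixed.

Lemma span_bounded v : span v -> exists R0, forall R K, (R0 <= R)%N -> (R <= K)%N ->
  bounded alpha gamma R K v.
Proof.
elim=> [|b J u w mu _ [R0 IH]]; first by exists 0%N => R K _ _; apply: bounded0.
exists (R0 + J + `|ip gamma b|)%N => R K RR RK; apply: (boundedD gg ag RK); last by apply: IH; lia.
by apply: (bounded_mon gg ag RK mu); lia.
Qed.

End ZeroModeExp.

(** * Exponentials of operators on a stable set of vectors *)

Section OperatorExp.
Variable V : algType rat.

(* Convertible to oppow and opexp when V is VQ C. *)
Fixpoint gpow (c : nat -> V -> V) (k q : nat) (v : V) : V :=
  if k is k'.+1 then \sum_(1 <= i < q.+1) c i (gpow c k' (q - i) v)
  else if q == 0%N then v else 0.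
Definition gexp (c : nat -> V -> V) (q : nat) (v : V) : V :=
  \sum_(k < q.+1) (k`!)%:R^-1 *: gpow c k q v.

(** The coefficient of x^q only involves the operators with i <= q, applied to vectors reached from
    v. So c and F may differ elsewhere, as the zero modes and their truncations do. *)
Lemma gexp_endo (P : V -> Prop) (c : nat -> V -> V) (F : nat -> endo V) q v :
  P 0 -> (forall u w, P u -> P w -> P (u + w)) ->
  (forall i u, (0 < i <= q)%N -> P u -> c i u = F i u /\ P (c i u)) ->
  P v -> gexp c q v = serexp F q v.
Proof.
move=> P0 PD cF Pv.
have key k r : (r <= q)%N -> gpow c k r v = serpow F k r v /\ P (gpow c k r v).
  elim: k r => [|k IH] r rq /=.
    by case: eqP => _; rewrite ?endo1E ?endo0E.
  rewrite !big_add1 /= !big_mkord endo_sumE; split.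
    apply: eq_bigr => i _; have [E1 P1] := IH (r - i.+1)%N (leq_trans (leq_subr _ _) rq).
    have [|E2 _] := cF i.+1 _ _ P1; first by have := ltn_ord i; lia.
    by rewrite E2 E1.
  elim/big_ind: _ => // i _; have [_ P1] := IH (r - i.+1)%N (leq_trans (leq_subr _ _) rq).
  by have [|_ //] := cF i.+1 _ _ P1; have := ltn_ord i; lia.
rewrite /gexp /serexp endo_sumE; apply: eq_bigr => k _.
by rewrite endoZE; have [->] := key k q (leqnn q).
Qed.

End OperatorExp.

Lemma zmode_exp_int (L : evenLattice) (C : doubleCover L) (M : model C)
    (alpha gamma : vec L) (s : bool) (q : nat) (v : M) :
  ip gamma gamma = 0 -> ip alpha gamma = 0 -> intV v ->
  intV (gexp (fun i v => i%:R^-1 *: zmode alpha gamma s i v) q v).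
Proof.
move=> gg ag iv; have /dvdzP[h aa] := gram_even alpha.
have aa2 : ip alpha alpha = 2 * h by rewrite mulrC.
have [R0 bR] := span_bounded gg ag (intV_span iv).
(* K and Mh meet the bounds of [zmode_stable] and [zterm0] for all i <= q at once. *)
pose K := (q * R0 + R0)%N; pose Mh := (K + q * R0 + R0)%N.
have RK : (R0 <= K)%N by rewrite /K; lia.
have [N0 FI] := fgamma_exp_int M s gg ag R0 Mh q aa2.
pose N := (N0 + (Mh.+1 + q * (R0 + R0).+1 + R0))%N.
pose F i : endo M := i%:R^-1 *: theta (mo M alpha) (- R0%:Z) N i (fgamma M gamma s R0 Mh ^+ i).
rewrite (@gexp_endo _ (bounded alpha gamma R0 K) _ F).
- by apply: FI => //; rewrite /N; lia.
- exact: bounded0.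
- by move=> u w; apply: (boundedD gg ag RK).
- move=> i u /andP[i0 iq] bu.
  have iR : (i * R0 <= q * R0)%N by rewrite leq_mul2r iq orbT.
  have KM : (K + i * R0 + R0 <= Mh)%N by rewrite /Mh; lia.
  split; last first.
    by apply: boundedZ; apply: (zmode_stable s gg ag i0 RK KM); rewrite // /K; lia.
  rewrite /F endoZE (theta_zterm s gg ag i0 RK KM) ?(zmode_zterm s gg ag i0 RK KM) //.
  have iRR : (i * (R0 + R0).+1 <= q * (R0 + R0).+1)%N by rewrite leq_mul2r iq orbT.
  by rewrite /N; lia.
by apply: bR.
Qed.

(** * The lifting *)

Section Instance.
Variables (L : evenLattice) (C : doubleCover L).

Fact der_linear (de : vec L -> VQ C) (dx : var L -> VQ C) : linear (der de dx).
Proof. by move=> x u v; rewrite /der linearP. Qed.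

Definition diagV (phi : vec L -> rat) : VQ C -> VQ C := lin (fun x => phi x.1 *: vb C x).
Fact diagV_linear phi : linear (diagV phi).
Proof. by move=> x u v; rewrite /diagV linearP. Qed.

Fact VQ_bm_ext (f g : endo (VQ C)) :
  (forall b m, f (vb C (b, m)) = g (vb C (b, m))) -> f = g.
Proof.
by move=> fg; apply: endoP; apply: (VQ_ext (endo_lin f) (endo_lin g)) => -[b m]; apply: fg.
Qed.

Fact VQ_der_bm (de : vec L -> VQ C) (dx : var L -> VQ C) b (m : cmonom (var L)) :
  der de dx (vb C (b, m)) = de b * vb C (b, m) +
    \sum_(i <- finsupp m) (m i)%:R *: (dx i * vb C (b, divcm m (ucm i))).
Proof. exact: linE. Qed.

Fact VQ_diag_bm phi b (m : cmonom (var L)) :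
  diagV phi (vb C (b, m)) = phi b *: vb C (b, m).
Proof. exact: linE. Qed.

Definition VQ_model : model C := @Model L C (VQ C) (fun b m => vb C (b, m))
  (fun de dx => Endo (@der_linear de dx)) (fun phi => Endo (@diagV_linear phi))
  (fun a m b m' => @VQ_mulbb L C (a, m) (b, m')) erefl VQ_bm_ext VQ_der_bm VQ_diag_bm.

Lemma posE a j : pos C a j = pos_m VQ_model a j.
Proof. by []. Qed.

Lemma modeE a j (v : VQ C) : mode a j v = mo VQ_model a j v.
Proof. by case: j => [[|j]|j]. Qed.

Lemma zpowE a N (v : VQ C) : zpow a N v = zproj VQ_model a N v.
Proof.
apply: lext_eq => x; case: eqP => _; first by rewrite scale1r.
by rewrite scale0r.
Qed.

Lemma eltE s a : elt C s a = elt_m VQ_model s a.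
Proof. by []. Qed.

Notation M := VQ_model.

Lemma DdivE i (v : VQ C) : Ddiv i v = dE M i v.
Proof.
rewrite /Ddiv /dE endoZE; congr (_ *: _); elim: i => [//|i IH].
by rewrite iterS exprS endoME -IH.
Qed.

Lemma inV_intV (v : VQ C) : inV v -> intV (M := M) v.
Proof.
elim=> [|u w _ iu _ iw|u w _ iu _ iw|s a|i u _ iu].
- exact: intV1.
- exact: intVB.
- exact: intVM.
- by rewrite eltE; apply: intV_elt.
by rewrite DdivE; apply: intV_dE.
Qed.

Lemma intV_inV (v : VQ C) : intV (M := M) v -> inV v.
Proof.
elim=> [|u w _ iu _ iw|u w _ iu _ iw|s a|i u _ iu].
- exact: inV1.
- exact: inVB.
- exact: inVM.
- by rewrite -eltE; apply: inV_elt.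
by rewrite -DdivE; apply: inV_Ddiv.
Qed.

Lemma opexpE (c : nat -> VQ C -> VQ C) q v : opexp c q v = gexp c q v.
Proof. by []. Qed.

Lemma gexp_endo_all (c : nat -> VQ C -> VQ C) (F : nat -> endo (VQ C)) q v :
  (forall i u, (0 < i)%N -> c i u = F i u) -> gexp c q v = serexp F q v.
Proof.
by move=> cF; apply: (@gexp_endo _ (fun=> True)) => // i u /andP[i0 _] _; split=> //; apply: cF.
Qed.

Lemma expcreatE a N (v : VQ C) : expcreat a N v = mexpcreat (M := M) a N v.
Proof.
rewrite /expcreat /mexpcreat; case: ifP => // _; rewrite opexpE.
rewrite (@gexp_endo_all _ (fun j => lmul (eulerV (pser M a) j))).
  rewrite -lmulE lmul_hser (serexpE (X := fun j => lmul (eulerV (pser M a) j))) //.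
  by rewrite eulerV0 lmul0.
by case=> // j u _; rewrite modeE /eulerV lmulZ endoZE.
Qed.

Lemma expannihE a N (v : VQ C) : expannih a N v = mexpannih (M := M) a N v.
Proof.
rewrite /expannih /mexpannih; case: ifP => // _; rewrite opexpE.
rewrite (@gexp_endo_all _ (eulerV (nser M a))).
  by rewrite (serexpE (X := eulerV (nser M a))) // eulerV0.
by case=> // j u _; rewrite modeE /eulerV nserS endoZE endoNE scalerN.
Qed.

Lemma fcompE (f g : field C) : fcomp f g = mcomp (M := M) f g.
Proof. by []. Qed.

Lemma YexpE a : @Yexp L C a = mYexp (M := M) a.
Proof.
apply: funext => N; apply: funext => v; rewrite /Yexp /mYexp eltE !fcompE.
have -> : @zpow L C a = fun n => zproj M a n :> (VQ C -> VQ C).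
  by apply: funext => n; apply: funext => u; apply: zpowE.
have -> : @expcreat L C a = mexpcreat (M := M) a.
  by apply: funext => n; apply: funext => u; apply: expcreatE.
have -> : @expannih L C a = mexpannih (M := M) a.
  by apply: funext => n; apply: funext => u; apply: expannihE.
by [].
Qed.

Lemma fderiv0 (f : field C) : fderiv 0 f = f.
Proof.
apply: funext => N; apply: funext => v.
by rewrite /fderiv big_nil fact0 invr1 mulr1 scale1r addr0.
Qed.

Lemma normordE k (f : field C) N v :
  normord (0%N, k) f N v = mnormord (M := M) k f N v.
Proof.
rewrite /normord /mnormord /= !fderiv0 !fcompE.
have -> : @creat L C (basis k) = mcreat (M := M) (basis k).
  by apply: funext => n; apply: funext => u; rewrite /creat /mcreat modeE.
have -> : @annih L C (basis k) = mannih (M := M) (basis k).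
  by apply: funext => n; apply: funext => u; rewrite /annih /mannih modeE.
by [].
Qed.

Lemma factors_ucm (i : var L) : factors (ucm i) = [:: i].
Proof.
by rewrite /factors (mdomU i) enum_fsetE ?enum_fset1 /= ucmE eqxx.
Qed.

Lemma nprod_zmode alpha gamma s i v :
  nprod (pos C alpha 0 * elt C s gamma ^+ i) 0 v = zmode (M := M) alpha gamma s i v.
Proof.
have wE : pos C alpha 0 * elt C s gamma ^+ i = \sum_k (alpha 0 k)%:~R *:
    (sgn (sgi C gamma s i) *: vb C (gamma *+ i, ucm (0%N, k))).
  rewrite -[elt C s gamma ^+ i]/(elt_m M s gamma ^+ i) elt_mX.
  rewrite posE /pos_m mulr_suml; apply: eq_bigr => k _.
  rewrite -scalerAl -scalerAr; congr (_ *: (_ *: _)).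
  exact: etrans (X_mul M (0%N, k) (gamma *+ i) (onecm _)) (congr1 (bm M _) (mulcm0 _)).
rewrite wE /nprod /Y linear_sum; apply: eq_bigr => k _.
rewrite !linearZ /= linE /= factors_ucm /= YexpE normordE.
have -> : (- 0 - 1 : int) = -1 by [].
by rewrite scalerA mulrC -scalerA.
Qed.

End Instance.

Section Lifting.
Variables (U T : algType rat) (tens : U -> U -> T).
Hypothesis tensT : tensor_square tens.

Lemma fexp_tensl (X : fps U) n :
  fexp (fun i => tens (X i) 1 : T) n = tens (fexp X n) 1.
Proof.
rewrite -(@fexp_morph _ _ (fun a => tens a 1)) //.
- exact: (tens_linl tensT).
- exact: (tens1 tensT).
by move=> x y; rewrite (tensM tensT) mulr1.
Qed.

Lemma fexp_tensr (X : fps U) n :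
  fexp (fun i => tens 1 (X i) : T) n = tens 1 (fexp X n).
Proof.
rewrite -(@fexp_morph _ _ (tens 1)) //.
- exact: (tens_linr tensT).
- exact: (tens1 tensT).
by move=> x y; rewrite (tensM tensT) mulr1.
Qed.

Lemma tens0l b : tens 0 b = 0.
Proof.
have := tens_linl tensT b (-1) 0 0.
by rewrite scaler0 addr0 scaleN1r addNr.
Qed.

Lemma tens0r a : tens a 0 = 0.
Proof.
have := tens_linr tensT a (-1) 0 0.
by rewrite scaler0 addr0 scaleN1r addNr.
Qed.

(** X (x) 1 and 1 (x) X commute, so the exponential of their sum factors as exp X (x) exp X; the sum
    is Delta X because the coefficients are primitive. *)
Lemma serexp_lifting (Delta : {lrmorphism U -> T}) (c : nat -> U) :
  (forall i, Delta (c i) = tens (c i) 1 + tens 1 (c i)) ->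
  lifting tens Delta (c 1%N) (serexp c).
Proof.
move=> Dc; pose X : fps U := fun i => if i is 0 then 0 else c i.
have cX n : serexp c n = fexp X n by apply: serexpE => // -[].
split=> [||n].
- by rewrite cX fexp_coef0.
- by rewrite /serexp big_ord_recl big_ord1 /= big_nat1 subnn mulr1 scaler0 add0r invr1 scale1r.
pose P1 : fps T := fun i => tens (X i) 1; pose P2 : fps T := fun i => tens 1 (X i).
rewrite cX (@fexp_morph _ _ Delta) ?rmorph1 //; first last.
- exact: rmorphM.
- exact: linearP.
have -> : (fun i => Delta (X i)) = P1 + P2 :> fps T.
  apply: fpsP => -[|i]; rewrite fpsDE /P1 /P2 /X ?Dc //.
  by rewrite linear0 tens0l tens0r addr0.
rewrite fexpD.
- rewrite fpsME; apply: eq_bigr => i _.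
  by rewrite /P1 /P2 fexp_tensl fexp_tensr (tensM tensT) mulr1 mul1r !cX.
- exact: tens0l.
- exact: tens0r.
by apply: fps_comm => i j; rewrite !(tensM tensT) !mulr1 !mul1r.
Qed.

End Lifting.

Section Action.
Variables (L : evenLattice) (C : doubleCover L) (U : algType rat).
Variables (iota : {linear VQ C -> U}) (act : U -> VQ C -> VQ C).
Hypothesis actP : zero_action iota act.

Lemma act_serexp (w : nat -> VQ C) (q : nat) (v : VQ C) :
  act (serexp (fun i => i%:R^-1 *: iota (w i)) q) v =
  opexp (fun i u => i%:R^-1 *: nprod (w i) 0 u) q v.
Proof.
pose al (u : VQ C) : U -> VQ C := fun a => act a u.
pose lact u : {linear U -> VQ C} :=
  HB.pack (al u) (GRing.isLinear.Build rat _ _ _ (al u) (act_linl actP u)).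
have lsum u n (F : nat -> U) m :
    act (\sum_(m <= i < n) F i) u = \sum_(m <= i < n) act (F i) u.
  exact: (linear_sum (lact u)).
have lZ u a x : act (a *: x) u = a *: act x u by exact: (linearZ_LR (lact u)).
rewrite /serexp /opexp -(big_mkord xpredT
  (fun k => k`!%:R^-1 *: serpow (fun i => i%:R^-1 *: iota (w i)) k q)) lsum big_mkord.
apply: eq_bigr => k _; rewrite lZ; congr (_ *: _).
move: (nat_of_ord k) => {}k; elim: k q v => [|k IH] q v /=.
  by case: (q == 0)%N; [apply: (act1 actP) | apply: (linear0 (lact v))].
rewrite lsum; apply: eq_bigr => i _.
by rewrite (actM actP) lZ (act_iota actP) IH.
Qed.

End Action.

Lemma opexp_nprod_int (L : evenLattice) (C : doubleCover L)
    (alpha gamma : vec L) (s : bool) n v :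
  ip gamma gamma = 0 -> ip alpha gamma = 0 -> inV v ->
  inV (opexp (fun i v => i%:R^-1 *:
    nprod (pos C alpha 0 * elt C s gamma ^+ i) 0 v) n v).
Proof.
move=> gg ag iv; apply: intV_inV; rewrite opexpE.
have -> : (fun i v => i%:R^-1 *: nprod (pos C alpha 0 * elt C s gamma ^+ i) 0 v)
    = (fun i v => i%:R^-1 *: zmode (M := VQ_model C) alpha gamma s i v)
    :> (nat -> VQ C -> VQ C).
  by apply: funext => i; apply: funext => u; rewrite nprod_zmode.
exact: (@zmode_exp_int L C (VQ_model C) alpha gamma s n v gg ag (inV_intV iv)).
Qed.

Theorem theorem3p5 (L : evenLattice) (C : doubleCover L)
    (alpha gamma : vec L) (s : bool)
    (gamma_norm0 : ip gamma gamma = 0)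
    (alpha_gamma : ip alpha gamma = 0)
    (U : algType rat) (iota : {linear VQ C -> U})
    (envU : enveloping iota)
    (T : algType rat) (tens : U -> U -> T) (tensT : tensor_square tens)
    (Delta : {lrmorphism U -> T})
    (Delta_iota : forall u, Delta (iota u) = tens (iota u) 1 + tens 1 (iota u)) :
  (* w i is alpha(1) e^(i gamma), for the lift e^gamma = elt C s gamma *)
  let w (i : nat) : VQ C := pos C alpha 0 * elt C s gamma ^+ i in
  let a : nat -> U := serexp (fun i => i%:R^-1 *: iota (w i)) in
  [/\ lifting tens Delta (iota (w 1%N)) a,
      forall act : U -> VQ C -> VQ C, zero_action iota act ->
        forall (n : nat) (v : VQ C), inV v -> inV (act (a n) v)
    & forall (n : nat) (v : VQ C), inV v ->
        inV (opexp (fun i v => i%:R^-1 *: nprod (w i) 0 v) n v)].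
Proof.
move=> w a.
have vint n v : inV v ->
    inV (opexp (fun i v => i%:R^-1 *: nprod (w i) 0 v) n v).
  exact: opexp_nprod_int.
split=> // [|act actP n v iv].
  have -> : iota (w 1%N) = 1%:R^-1 *: iota (w 1%N) by rewrite invr1 scale1r.
  apply: (@serexp_lifting U T tens tensT Delta (fun i => i%:R^-1 *: iota (w i))).
  move=> i; have -> : Delta (i%:R^-1 *: iota (w i)) = i%:R^-1 *: Delta (iota (w i)).
    exact: linearZ_LR.
  rewrite Delta_iota scalerDr.
  have tl := tens_linl tensT 1; have tr := tens_linr tensT 1.
  congr (_ + _).
    by have := tl i%:R^-1 (iota (w i)) 0; rewrite (tens0l tensT) !addr0.
  by have := tr i%:R^-1 (iota (w i)) 0; rewrite (tens0r tensT) !addr0.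
by rewrite /a (act_serexp actP); apply: vint.
Qed.
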